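(* Let $V$ be a vector superspace (parity $p$) with an even endomorphism $\partial$ and an increasing filtration $\{0\}=F^{-1}V\subset F^0V\subset F^1V\subset\dots\subset V$ by $\mathbb F[\partial]$-submodules. Under the correspondence $$\int^{\lambda}d\sigma[u_\sigma v]=(-1)^{p(u)}X^{z_1,z_2}_{\lambda,-\lambda-\partial}\Big(u,v;\frac1{z_2-z_1}\Big)$$ between odd elements $X\in W^{\mathrm{ch}}_1(\Pi V)$ with $X\Box X=0$ and non-unital vertex algebra structures on the $\mathbb F[\partial]$-module $V$, the structures of filtered (non-unital) vertex algebra on $V$ are in bijection with the odd elements $X\in F^1W^{\mathrm{ch}}_1(\Pi V)$ satisfying $X\Box X=0$.
   Context: $\mathbb F$ is a field of characteristic $0$; $\langle\Phi\rangle$ denotes the image of an endomorphism $\Phi$; $z_{ij}=z_i-z_j$; $\mathcal O^{\star T}_n=\mathbb F[z_{ij}^{\pm1}]_{1\le i<j\le n}$, $\mathcal O^T_n=\mathbb F[z_{ij}]$; $\Pi V$ is $V$ with parity $\bar p=1-p$ and the same filtration. **Chiral operad.** For a superspace $U$ with even endomorphism $\partial$, $P^{\mathrm{ch}}(U)(n)$ is the superspace of linear maps $X:U^{\otimes n}\otimes\mathcal O^{\star T}_n\to U[\lambda_1,\dots,\lambda_n]/\langle\partial+\lambda_1+\dots+\lambda_n\rangle$ with $X(\dots,(\partial+\lambda_i)v_i,\dots;f)=X(v_1,\dots,v_n;\partial f/\partial z_i)$ and $X(v_1,\dots,v_n;z_{ij}f)=(\partial_{\lambda_j}-\partial_{\lambda_i})X(v_1,\dots,v_n;f)$.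 $S_n$ acts on the right by $(X^\sigma)_{\lambda_1,\dots,\lambda_n}(v_1,\dots,v_n;f(z_1,\dots,z_n))=\epsilon_v(\sigma)X^{z_1,\dots,z_n}_{\lambda_{i_1},\dots,\lambda_{i_n}}(v_{i_1},\dots,v_{i_n};f(z_{i_1},\dots,z_{i_n}))$, $i_s=\sigma^{-1}(s)$, $\epsilon_v(\sigma)=\prod_{i<j,\sigma(i)>\sigma(j)}(-1)^{\mathrm{par}(v_i)\mathrm{par}(v_j)}$. For $X\in P^{\mathrm{ch}}(n)$, $Y\in P^{\mathrm{ch}}(m)$ and $h=f(z_1,\dots,z_n)g(z_1,\dots,z_{n+m-1})$ with $g$ having no poles at $z_i=z_j$, $i<j\le n$: $(Y\circ_1X)(v_1,\dots,v_{n+m-1};h)=Y^{w,z_{n+1},\dots,z_{n+m-1}}_{\lambda_1+\dots+\lambda_n,\lambda_{n+1},\dots}\big(X_{\lambda_1-\partial_{z_1},\dots,\lambda_n-\partial_{z_n}}(v_1,\dots,v_n;f)_\to,v_{n+1},\dots;g|_{z_1=\dots=z_n=w}\big)$, the $\partial_{z_i}$ being applied to $g$ before the substitution. $W^{\mathrm{ch}}_k(U)=P^{\mathrm{ch}}(U)(k+1)^{S_{k+1}}$; for $f\in W_n,g\in W_m$, $f\Box g=\sum_{\sigma\in S_{m+1,n}}(f\circ_1g)^{\sigma^{-1}}$, with $S_{m+1,n}$ the permutations of $\{1,\dots,m+n+1\}$ increasing on $\{1,\dots,m+1\}$ and on $\{m+2,\dots,m+n+1\}$. One uses $V[\lambda_1,\lambda_2]/\langle\partial+\lambda_1+\lambda_2\rangle\simeq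 V[\lambda]$, $\lambda_1=\lambda$, $\lambda_2=-\lambda-\partial$. **Filtrations.** $F^r\mathcal O^{\star T}_n=\sum\mathcal O^T_n[z_{i_1j_1}^{-1},\dots,z_{i_rj_r}^{-1}]$ (sums of functions with at most $r$ distinct polar divisors $z_i=z_j$, not counting multiplicities), $F^{r}=0$ for $r<0$. $F^s(V^{\otimes n}\otimes\mathcal O^{\star T}_n)=\sum_{r_1+\dots+r_{n+1}=s}F^{r_1}V\otimes\dots\otimes F^{r_n}V\otimes F^{r_{n+1}}\mathcal O^{\star T}_n$ ($0$ for $s<0$). $F^rP^{\mathrm{ch}}(n)$ is the set of $X$ with $X(F^s(V^{\otimes n}\otimes\mathcal O^{\star T}_n))\subset(F^{s-r}V)[\lambda_1,\dots,\lambda_n]/\langle\partial+\lambda_1+\dots+\lambda_n\rangle$ for every $s$, and $F^rW_k^{\mathrm{ch}}=W_k^{\mathrm{ch}}\cap F^rP^{\mathrm{ch}}(k+1)$. **Non-unital vertex algebra.** A $\mathbb Z/2\mathbb Z$-graded $\mathbb F[\partial]$-module $V$ with an even linear map $V\otimes V\to V[\lambda]$, $u\otimes v\mapsto\int^\lambda d\sigma[u_\sigma v]=\,:\!uv\!:+\int_0^\lambda d\sigma[u_\sigma v]$ ($:\!uv\!:$ is the constant term, $[u_\lambda v]$ the $\lambda$-derivative) such that: $[\partial u_\lambda v]=-\lambda[u_\lambda v]$, $[u_\lambda\partial v]=(\partial+\lambda)[u_\lambda v]$, $\partial:\!uv\!:\,=\,:\!(\partial u)v\!:+:\!u\,\partial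 v\!:$; $\int^\lambda d\sigma[v_\sigma u]=(-1)^{p(u)p(v)}\int^{-\lambda-\partial}d\sigma[u_\sigma v]$; and $\int^\lambda d\sigma\int^\mu d\tau([u_\sigma[v_\tau w]]-(-1)^{p(u)p(v)}[v_\tau[u_\sigma w]]-[[u_\sigma v]_{\sigma+\tau}w])=0$, where the first term means $:\!u:\!vw\!:\,\!:+\int_0^\mu d\tau:\!u[v_\tau w]\!:+\int_0^\lambda d\sigma[u_\sigma:\!vw\!:]+\int_0^\lambda d\sigma\int_0^\mu d\tau[u_\sigma[v_\tau w]]$, the second is analogous, and the third means $:\!A\,w\!:+\int_0^{\lambda+\mu}d\tau[A_\tau w]$ with $A=\int_{-\mu-\partial}^\lambda d\sigma[u_\sigma v]$. It is *filtered* if $:\!(F^pV)(F^qV)\!:\,\subset F^{p+q}V$ and $[F^pV{}_\lambda F^qV]\subset F^{p+q-1}V[\lambda]$ for all $p,q$.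
   Formalization: The F^rV are taken to be graded (sub-superspaces), without which the claim fails; in the S_n-action the variable z_i in f moves with v_i and λ_i to slot σ(i) (z_i becomes z_{σ(i)}), since the literal substitution breaks sesquilinearity for 3-cycles. *)

(* Defs.v *)
From HB Require Import structures.
From mathcomp Require Import all_boot all_order all_fingroup all_algebra.
From mathcomp Require Import generic_quotient ring_quotient.
From mathcomp Require Import finmap.
From mathcomp Require Import boolp classical_sets functions.
From mathcomp Require Import monalg.
From mathcomp Require Import mpoly.

Set Implicit Arguments.
Unset Strict Implicit.
Unset Printing Implicit Defensive.

Import GRing.Theory Num.Theory.
Local Open Scope ring_scope.
Local Open Scope classical_set_scope.
Local Open Scope quotient_scope.

(* monalg and mpoly both declare this notation. *)
Notation "{ 'mpoly' T [ n ] }" := (mpoly.mpoly n T) : type_scope.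

(* A Z/2-grading U = U_0 (+) U_1, given by the two projections
   (false = even, true = odd). *)
Record superspace (F : fieldType) (U : lmodType F) := Superspace {
  pr : bool -> {linear U -> U};
  pr_id : forall b u, pr b (pr b u) = pr b u;
  pr_orth : forall b u, pr b (pr (~~ b) u) = 0;
  pr_sum : forall u, pr false u + pr true u = u
}.

Section Superspace.
Variables (F : fieldType) (U : lmodType F) (gr : superspace U).

Definition hom_par (b : bool) (u : U) : Prop := pr gr b u = u.

Definition even_endo (d : U -> U) : Prop :=
  forall b u, hom_par b u -> hom_par b (d u).

Lemma parity_shift_orth b u : pr gr (~~ b) (pr gr (~~ ~~ b) u) = 0.
Proof. exact: pr_orth. Qed.

Lemma parity_shift_sum u : pr gr (~~ false) u + pr gr (~~ true) u = u.
Proof. by rewrite addrC pr_sum. Qed.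

(* Pi U: the same space with parity 1 - p. *)
Definition parity_shift : superspace U :=
  @Superspace F U (fun b => pr gr (~~ b)) (fun b => pr_id gr (~~ b))
    parity_shift_orth parity_shift_sum.

End Superspace.

(* The filtration is indexed by all integers, with Fil r = 0 for r < 0;
   its terms are sub-superspaces. *)
Record is_filtration (F : fieldType) (U : lmodType F) (gr : superspace U)
    (d : U -> U) (Fil : int -> set U) : Prop := {
  fil_lin : forall r a u v, Fil r u -> Fil r v -> Fil r (a *: u + v);
  fil_graded : forall r b u, Fil r u -> Fil r (pr gr b u);
  fil_d : forall r u, Fil r u -> Fil r (d u);
  fil_incr : forall r s, r <= s -> Fil r `<=` Fil s;
  fil_neg : forall r, r < 0 -> Fil r = [set 0];
  fil_0 : forall r, Fil r 0
}.

Definition lpoly (F : fieldType) (U : lmodType F) (n : nat) : Type :=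
  monalg.malg 'X_{1..n} U.

HB.instance Definition _ (F : fieldType) (U : lmodType F) (n : nat) :=
  GRing.Zmodule.copy (lpoly U n) (monalg.malg 'X_{1..n} U).

Section LPolyBase.
Variables (F : fieldType) (U : lmodType F) (n : nat).
Local Notation lpoly := (lpoly U n).

Definition lcoef (m : 'X_{1..n}) (p : lpoly) : U := monalg.mcoeff m p.
Definition lsupp (p : lpoly) : {fset 'X_{1..n}} := monalg.msupp p.
Definition lmonom (m : 'X_{1..n}) (u : U) : lpoly := monalg.mkmalgU m u.
Definition lconst (u : U) : lpoly := lmonom 0%MM u.

End LPolyBase.

HB.lock Definition lmap (F : fieldType) (U : lmodType F) (n : nat)
    (phi : U -> U) (p : lpoly U n) : lpoly U n :=
  monalg.mkmalg [fsfun m in lsupp p => phi (lcoef m p)].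

HB.lock Definition lmul (F : fieldType) (U : lmodType F) (n : nat)
    (i : 'I_n) (p : lpoly U n) : lpoly U n :=
  \sum_(m <- lsupp p) lmonom (U_(i) + m)%MM (lcoef m p).

HB.lock Definition lderiv (F : fieldType) (U : lmodType F) (n : nat)
    (i : 'I_n) (p : lpoly U n) : lpoly U n :=
  \sum_(m <- lsupp p) lmonom (m - U_(i))%MM (lcoef m p *+ m i).

Section LPoly.
Variables (F : fieldType) (U : lmodType F) (n : nat).
Local Notation lpoly := (lpoly U n).
Implicit Types p q : lpoly.

Lemma lcoef_lmap phi p m : phi 0 = 0 -> lcoef m (lmap phi p) = phi (lcoef m p).
Proof.
move=> phi0; rewrite lmap.unlock /lcoef monalg.mcoeffE.
by case: monalg.msuppP => // _; rewrite phi0.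
Qed.

Lemma lpolyP (p q : lpoly) : (forall m, lcoef m p = lcoef m q) -> p = q.
Proof. by move=> h; apply/monalg.malgP. Qed.

Lemma lcoefD m (p q : lpoly) : lcoef m (p + q) = lcoef m p + lcoef m q.
Proof. exact: monalg.mcoeffD. Qed.

Definition lscale (a : F) (p : lpoly) : lpoly := lmap (fun u => a *: u) p.

Lemma lcoef_scale a p m : lcoef m (lscale a p) = a *: lcoef m p.
Proof. by rewrite lcoef_lmap ?scaler0. Qed.

Fact lscaleA a b p : lscale a (lscale b p) = lscale (a * b) p.
Proof. by apply/lpolyP => m; rewrite !lcoef_scale scalerA. Qed.
Fact lscale1 p : lscale 1 p = p.
Proof. by apply/lpolyP => m; rewrite lcoef_scale scale1r. Qed.
Fact lscaleDr a p q : lscale a (p + q) = lscale a p + lscale a q.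
Proof. by apply/lpolyP => m; rewrite lcoefD !lcoef_scale lcoefD scalerDr. Qed.
Fact lscaleDl p a b : lscale (a + b) p = lscale a p + lscale b p.
Proof. by apply/lpolyP => m; rewrite lcoefD !lcoef_scale scalerDl. Qed.

HB.instance Definition _ := GRing.Zmodule_isLmodule.Build F lpoly
  lscaleA lscale1 lscaleDr lscaleDl.

(* For p = sum_m lambda^m u_m and pairwise commuting operators A_i, the value
   sum_m A_1^(m_1) .. A_n^(m_n) (phi u_m) obtained by substituting A_i for
   lambda_i. *)
Definition lsubst (M : zmodType) (A : 'I_n -> M -> M) (phi : U -> M)
    (p : lpoly) : M :=
  \sum_(m <- lsupp p)
    foldr (fun i x => iter (m i) (A i) x) (phi (lcoef m p)) (enum 'I_n).

End LPoly.

Section LQuot.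
Variables (F : fieldType) (U : lmodType F) (d : {linear U -> U}) (n : nat).
Local Notation lpoly := (lpoly U n).

Definition ltot (p : lpoly) : lpoly := lmap d p + \sum_(i < n) lmul i p.

Definition ltot_im : {pred lpoly} := fun p => `[< exists q, p = ltot q >].

Lemma lcoef_lmul i (p : lpoly) m :
  lcoef m (lmul i p) = if m i is 0 then 0 else lcoef (m - U_(i))%MM p.
Proof.
rewrite lmul.unlock /lcoef raddf_sum /=.
under eq_bigr do rewrite monalg.mcoeffU.
have [mi0|mi_gt0] := posnP (m i).
  rewrite mi0 big1 // => k _; case: eqP => // /mnmP/(_ i).
  by rewrite mnmDE mnm1E eqxx mi0.
have def_m : m = (U_(i) + (m - U_(i)))%MM.
  apply/mnmP => j; rewrite mnmDE mnmBE mnm1E.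
  by case: eqP => [<-|_]; rewrite ?subnKC ?subn0.
case: (m i) mi_gt0 => // k _.
have sub_eq k' : ((U_(i) + k')%MM == m) = (k' == (m - U_(i))%MM).
  by rewrite {1}def_m (inj_eq (@addmI _ _)).
case: (monalg.msuppP p (m - U_(i))%MM) => [mp|mNp].
  rewrite (bigD1_seq _ mp) ?fset_uniq //= sub_eq eqxx mulr1n big1 ?addr0 //.
  by move=> k' /negPf nk; rewrite sub_eq nk.
rewrite big_seq big1 // => k' k'p; rewrite sub_eq.
by case: eqP => // eqk; rewrite -eqk k'p in mNp.
Qed.

Lemma lmul_linear i : linear (@lmul F U n i).
Proof.
move=> a p q; apply/lpolyP => m.
rewrite lcoef_lmul [RHS]lcoefD lcoef_scale !lcoef_lmul.
by case: (m i) => [|k]; rewrite ?scaler0 ?addr0 // lcoefD lcoef_scale.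
Qed.
HB.instance Definition _ i := GRing.isLinear.Build F lpoly lpoly *:%R
  (@lmul F U n i) (lmul_linear i).

Lemma lmap_linear : linear (@lmap F U n d).
Proof.
move=> a p q; apply/lpolyP => m.
by rewrite !(lcoefD, lcoef_scale, lcoef_lmap) ?raddf0 // linearP.
Qed.

Lemma ltot_linear : linear ltot.
Proof.
move=> a p q; rewrite /ltot lmap_linear.
under eq_bigr do rewrite linearP.
by rewrite big_split -scaler_sumr /= scalerDr addrACA.
Qed.
HB.instance Definition _ := GRing.isLinear.Build F lpoly lpoly *:%R
  ltot ltot_linear.

Fact ltot_im_zmod : zmod_closed ltot_im.
Proof.
split=> [|p q /asboolP[p' ->] /asboolP[q' ->]]; apply/asboolP.
  by exists 0; rewrite linear0.
by exists (p' - q'); rewrite linearB.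
Qed.
HB.instance Definition _ := GRing.isZmodClosed.Build lpoly ltot_im ltot_im_zmod.

Definition lquot : Type := Quotient.quot ltot_im.
HB.instance Definition _ := ZmodQuotient.copy lquot (Quotient.quot ltot_im).

Lemma ltot_imZ (a : F) (p : lpoly) : p \in ltot_im -> a *: p \in ltot_im.
Proof.
by move=> /asboolP[q ->]; apply/asboolP; exists (a *: q); rewrite linearZ.
Qed.

Definition qscale (a : F) (x : lquot) : lquot := \pi_lquot (a *: repr x).

Lemma qscale_pi a (p : lpoly) : qscale a (\pi p) = \pi_lquot (a *: p).
Proof.
apply/eqP; rewrite -Quotient.idealrBE -scalerBr ltot_imZ //.
by rewrite Quotient.idealrBE reprK.
Qed.

Fact qscaleA a b x : qscale a (qscale b x) = qscale (a * b) x.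
Proof. by elim/quotW: x => p; rewrite (qscale_pi b) !qscale_pi scalerA. Qed.
Fact qscale1 x : qscale 1 x = x.
Proof. by elim/quotW: x => p; rewrite qscale_pi scale1r. Qed.
Fact qscaleDr a x y : qscale a (x + y) = qscale a x + qscale a y.
Proof.
elim/quotW: x => p; elim/quotW: y => q.
by rewrite -raddfD !qscale_pi scalerDr raddfD.
Qed.
Fact qscaleDl x a b : qscale (a + b) x = qscale a x + qscale b x.
Proof. by elim/quotW: x => p; rewrite !qscale_pi scalerDl raddfD. Qed.

HB.instance Definition _ := GRing.Zmodule_isLmodule.Build F lquot
  qscaleA qscale1 qscaleDr qscaleDl.

(* The operations below are computed on a representative: they commute with
   ltot on lpoly. *)

Definition qmul (i : 'I_n) (x : lquot) : lquot := \pi_lquot (lmul i (repr x)).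

Definition qderivB (j i : 'I_n) (x : lquot) : lquot :=
  \pi_lquot (lderiv j (repr x) - lderiv i (repr x)).

(* the image of S[lambda_1, .., lambda_n] in the quotient *)
Definition qcoef_in (S : set U) : set lquot :=
  [set x | exists2 p : lpoly, x = \pi_lquot p & forall m, S (lcoef m p)].

End LQuot.

Section Functions.
Variable F : fieldType.
Local Notation ratf n := {fraction {mpoly F[n]}}.
Local Notation frac x := (FracField.tofrac x).

Definition fconst n (a : F) : ratf n := frac a%:MP.

Definition zdiff n (i j : 'I_n) : ratf n := frac ('X_i - 'X_j).

Definition fderiv n (i : 'I_n) (f : ratf n) : ratf n :=
  let p := \n_(repr f) in let q := \d_(repr f) in
  frac (p^`M(i) * q - p * q^`M(i)) / frac (q ^+ 2).

(* The substitution z_i := z_(k i), computed on any presentation p / q whose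
   denominator does not vanish under it. *)
Definition zsubst n n' (k : 'I_n -> 'I_n') (f : ratf n) : ratf n' :=
  let phi := mmap (@mpolyC n' F) (fun i => 'X_(k i)) in
  xget 0 [set y | exists p q : {mpoly F[n]},
    [/\ phi q != 0, f = frac p / frac q & y = frac (phi p) / frac (phi q)]].

Inductive adjoin n (S : set (ratf n)) : ratf n -> Prop :=
| adjoin_gen f : S f -> adjoin S f
| adjoin_const a : adjoin S (fconst n a)
| adjoin_add f g : adjoin S f -> adjoin S g -> adjoin S (f + g)
| adjoin_mul f g : adjoin S f -> adjoin S g -> adjoin S (f * g).

(* O^T_n [z_ij^-1 : (i, j) \in E] *)
Definition OT_polar n (E : {set 'I_n * 'I_n}) : set (ratf n) :=
  adjoin ([set f | exists i j : 'I_n, (i < j)%N /\ f = zdiff i j] `|`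
          [set f | exists2 e, e \in E & f = (zdiff e.1 e.2)^-1]).

Definition ltpairs n : {set 'I_n * 'I_n} := [set e : 'I_n * 'I_n | (e.1 < e.2)%N]%SET.

Definition OstarT n : set (ratf n) := @OT_polar n (ltpairs n).

Definition filO n (r : int) : set (ratf n) :=
  [set f | exists (N : nat) (E : 'I_N -> {set 'I_n * 'I_n}) (g : 'I_N -> ratf n),
    (forall k, [/\ E k \subset ltpairs n, (#|E k|%:Z <= r) & OT_polar (E k) (g k)])
    /\ f = \sum_(k < N) g k].

End Functions.

Section Chiral.
Variables (F : fieldType) (U : lmodType F) (d : {linear U -> U}).
Local Notation ratf n := {fraction {mpoly F[n]}}.
Local Notation lquot n := (lquot d n).

(* Elements of P^ch(U)(n) are multilinear maps on U^n x O^{*T}_n; they are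
   extended by 0 to the rational functions outside O^{*T}_n, so that equality of
   functions is equality of linear maps. *)
Definition chmap (n : nat) : Type := {ffun 'I_n -> U} -> ratf n -> lquot n.

HB.instance Definition _ n :=
  GRing.Zmodule.copy (chmap n) ({ffun 'I_n -> U} -> ratf n -> lquot n).

Definition upd n (v : {ffun 'I_n -> U}) (i : 'I_n) (x : U) : {ffun 'I_n -> U} :=
  [ffun j => if j == i then x else v j].

Record is_chiral n (X : chmap n) : Prop := {
  chiral_linv : forall v i a x y f,
    X (upd v i (a *: x + y)) f = a *: X (upd v i x) f + X (upd v i y) f;
  chiral_linf : forall v a f g, OstarT f -> OstarT g ->
    X v (fconst n a * f + g) = a *: X v f + X v g;
  chiral_out : forall v f, ~ OstarT f -> X v f = 0;
  chiral_d : forall v i f, OstarT f ->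
    X (upd v i (d (v i))) f + qmul i (X v f) = X v (fderiv i f);
  chiral_z : forall v i j f, OstarT f ->
    X v (zdiff F i j * f) = qderivB j i (X v f)
}.

Section Graded.
Variable gr : superspace U.

Definition ch_parity n (b : bool) (X : chmap n) : Prop :=
  forall (c : 'I_n -> bool) (v : {ffun 'I_n -> U}) f,
    (forall i, hom_par gr (c i) (v i)) ->
    qcoef_in (hom_par gr (b (+) \big[addb/false]_(i < n) c i)) (X v f).

Definition koszul n (s : 'S_n) (c : 'I_n -> bool) : F :=
  \prod_(e : 'I_n * 'I_n | (e.1 < e.2)%N && (s e.2 < s e.1)%N)
    (-1) ^+ (c e.1 && c e.2).

Definition qperm n (k : 'I_n -> 'I_n) (x : lquot n) : lquot n :=
  \pi_(lquot n) (lsubst (fun i => lmul (k i)) (@lconst F U n) (repr x)).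

(* X^s: the vector v_i, with its variables lambda_i and z_i, is put in the slot
   s i of X (so z_i becomes z_(s i) in f, as chiral_d requires); the signs are
   extended linearly from homogeneous vectors. *)
Definition ch_act n (s : 'S_n) (X : chmap n) : chmap n := fun v f =>
  \sum_(c : {ffun 'I_n -> bool}) koszul s c *:
    qperm (s^-1)%g (X [ffun j => pr gr (c ((s^-1)%g j)) (v ((s^-1)%g j))]
                      (zsubst s f)).

Definition Wch (k : nat) : set (chmap k.+1) :=
  [set X | is_chiral X /\ forall s, ch_act s X = X].

Section Comp.
Variables (n m : nat).

(* z_1 = .. = z_n = w, the other variables being shifted accordingly *)
Definition collapse (i : 'I_(n + m)) : 'I_m.+1 :=
  match fintype.split i with inl _ => ord0 | inr j => lift ord0 j end.

(* The substitution of lambda_1 + .. + lambda_n, lambda_(n+1), .. for the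
   m.+1 variables of Y. *)
Definition qexpand (x : lquot m.+1) : lquot (n + m) :=
  \pi_(lquot (n + m))
    (lsubst (fun (i : 'I_m.+1) p =>
               if unlift ord0 i is Some j then lmul (rshift n j) p
               else \sum_(l < n) lmul (lshift m l) p)
            (@lconst F U (n + m)) (repr x)).

(* The value of Y o_1 X on h = f g. For a coefficient c of X(v_1, .., v_n; f),
   the operator lambda_i - d/dz_i acts on the function
   g |-> Y(c, v_(n+1), ..; g|_(z_1 = .. = z_n = w)). *)
Definition comp1_at (Y : chmap m.+1) (X : chmap n) (v : {ffun 'I_(n + m) -> U})
    (f : ratf n) (g : ratf (n + m)) : lquot (n + m) :=
  lsubst
    (fun (i : 'I_n) (Phi : ratf (n + m) -> lquot (n + m)) g' =>
       qmul (lshift m i) (Phi g') - Phi (fderiv (lshift m i) g'))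
    (fun c g' =>
       qexpand (Y [ffun i => if unlift ord0 i is Some j then v (rshift n j)
                             else c]
                  (zsubst collapse g')))
    (repr (X [ffun i => v (lshift m i)] f)) g.

(* Every h in O^{*T} is a product f g as below, and the value does not depend
   on the factorization; f is viewed as a function of z_1, .., z_(n+m), and g has
   no poles at z_i = z_j for i < j <= n (indices are shifted by 1 here). *)
Definition comp1 (Y : chmap m.+1) (X : chmap n) : chmap (n + m) := fun v h =>
  xget 0 [set y | exists (f : ratf n) (g : ratf (n + m)),
    [/\ OstarT f,
        OT_polar [set e : 'I_(n + m) * 'I_(n + m) |
                    (e.1 < e.2)%N && (n <= e.2)%N]%SET g,
        h = zsubst (lshift m) f * g
      & y = comp1_at Y X v f g]].

End Comp.

Definition shuffle m n (s : 'S_(m + n)) : bool :=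
  [forall i : 'I_(m + n), forall j : 'I_(m + n),
    (i < j)%N && ((j < m)%N || (m <= i)%N) ==> (s i < s j)%N].

Definition box n m (X : chmap n.+1) (Y : chmap m.+1) : chmap (m.+1 + n) :=
  \sum_(s : 'S_(m.+1 + n) | shuffle s) ch_act (s^-1)%g (comp1 X Y).

End Graded.

Arguments Wch gr k _ : clear implicits.

(* F^r P^ch(n); the inclusion is stated on the pure tensors spanning F^s, where
   s = r_1 + .. + r_n + r'. *)
Definition filP (Fil : int -> set U) n (r : int) : set (chmap n) :=
  [set X | is_chiral X /\
    forall (rs : 'I_n -> int) (r' : int) (v : {ffun 'I_n -> U}) f,
      (forall i, Fil (rs i) (v i)) -> filO r' f ->
      qcoef_in (Fil (\sum_(i < n) rs i + r' - r)) (X v f)].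

Definition filW (gr : superspace U) (Fil : int -> set U) (k : nat) (r : int) :
  set (chmap k.+1) := Wch gr k `&` filP Fil r.

End Chiral.

Arguments Wch {F U} d gr k _.
Arguments filP {F U} d Fil n r _.
Arguments filW {F U} d gr Fil k r _.

Section VertexAlgebra.
Variables (F : fieldType) (V : lmodType F) (gr : superspace V).
Variable d : {linear V -> V}.

(* A structure is given by the map I u v = \int^lambda [u_sigma v] dsigma. *)
Variable I : V -> V -> lpoly V 1.

Definition nprod (u v : V) : V := lcoef 0%MM (I u v).
Definition lbracket (u v : V) : lpoly V 1 := lderiv ord0 (I u v).

(* \int^A [u_sigma v] dsigma, where A is substituted for lambda. As
   \int^lambda = :uv: + \int_0^lambda, an integral with two bounds is a
   difference of such terms. *)
Definition int_to n (A : lpoly V n -> lpoly V n) (u v : V) : lpoly V n :=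
  lsubst (fun _ : 'I_1 => A) (@lconst F V n) (I u v).

(* The extensions of int_to, linear in the formal variables, to a polynomial
   second (resp. first) argument. *)
Definition int_to_r n A (u : V) (p : lpoly V n) : lpoly V n :=
  lsubst (@lmul F V n) (fun c => int_to A u c) p.
Definition int_to_l n A (p : lpoly V n) (w : V) : lpoly V n :=
  lsubst (@lmul F V n) (fun c => int_to A c w) p.

Local Notation lam := (@lmul F V 2 ord0).
Local Notation mu := (@lmul F V 2 ord_max).

Record is_nuva : Prop := {
  nuva_linl : forall a u u' v, I (a *: u + u') v = a *: I u v + I u' v;
  nuva_linr : forall a u v v', I u (a *: v + v') = a *: I u v + I u v';
  nuva_even : forall a b u v, hom_par gr a u -> hom_par gr b v ->
    forall m, hom_par gr (a (+) b) (lcoef m (I u v));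
  nuva_dl : forall u v, lbracket (d u) v = - lmul ord0 (lbracket u v);
  nuva_dr : forall u v,
    lbracket u (d v) = lmap d (lbracket u v) + lmul ord0 (lbracket u v);
  nuva_dprod : forall u v, d (nprod u v) = nprod (d u) v + nprod u (d v);
  nuva_skew : forall a b u v, hom_par gr a u -> hom_par gr b v ->
    I v u = (-1) ^+ (a && b) *: int_to (fun p => - lmul ord0 p - lmap d p) u v;
  nuva_jacobi : forall a b u v w, hom_par gr a u -> hom_par gr b v ->
    int_to_r lam u (int_to mu v w)
    - (-1) ^+ (a && b) *: int_to_r mu v (int_to lam u w)
    - int_to_l (fun p => lam p + mu p)
        (int_to lam u v - int_to (fun p => - mu p - lmap d p) u v) w = 0
}.

Definition is_filtered_nuva (Fil : int -> set V) : Prop :=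
  is_nuva /\ forall (p q : int) u v, Fil p u -> Fil q v ->
    Fil (p + q) (nprod u v) /\ forall m, Fil (p + q - 1) (lcoef m (lbracket u v)).

End VertexAlgebra.

Section Correspondence.
Variables (F : fieldType) (V : lmodType F) (gr : superspace V).
Variable d : {linear V -> V}.

(* lambda_1 := lambda, lambda_2 := - lambda - d *)
Definition to_lambda (x : lquot d 2) : lpoly V 1 :=
  lsubst (fun (i : 'I_2) (p : lpoly V 1) =>
            if i == ord0 then lmul ord0 p else - lmul ord0 p - lmap d p)
         (@lconst F V 1) (repr x).

(* The sign (-1)^p(u) is extended linearly in u; parities are those of V, not of
   Pi V. *)
Definition va_of (X : chmap d 2) (u v : V) : lpoly V 1 :=
  \sum_(b : bool) (-1) ^+ b *:
    to_lambda (X [ffun i => if i == ord0 then pr gr b u else v]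
                 (zdiff F ord_max ord0)^-1).

End Correspondence.

Arguments va_of {F V} gr d X u v.

(* Main.v *)
(* Let z = z_2 - z_1. The functions on which a binary chiral operation X takes
   values are generated by 1/z under multiplication by z and by d/dz_1 (this uses
   characteristic 0), so X is determined by J(u, v) = X(u, v; 1/z), and after the
   elimination of lambda_2 this is a polynomial in one variable: the
   lambda-integral, up to sign. The values of X at 1 = z (1/z) are then the
   derivatives of J, that is, the lambda-brackets, and the axioms of X at 1 and at
   1/z are the axioms of V concerning d, while the invariance under S_2 is
   skew-symmetry. Conversely, the values at the powers of 1/z are forced by d/dz_1
   and the values at all p(z)/z^N by multiplication by z, consistently by these
   axioms.

   X [] X is chiral and S_3-invariant. By partial fractions it vanishes as soon as
   it does at 1/((z_3 - z_1)(z_3 - z_2)), and by symmetry this is the only function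
   to be considered; its value there is, up to sign, the defect of the Jacobi
   identity.

   For the filtrations, 1/z lies in F^1 and 1 in F^0: the condition on X at these
   two functions is the condition on the products, respectively on the brackets.
   It propagates to all functions: those with a pole are generated by 1/z as above,
   and the polynomials by 1 under multiplication by z. *)

(* The definitions choose: [comp1] picks a factorization f g, operations on quotients pick a
   representative, and arguments outside a domain get a default value. Much of the work is thus
   independence of choices, and many rules hold only on suitable functions. In X o_1 X the operators
   lambda_i - d/dz_i respect total derivatives only on functions g regular at z_1 = z_2, where
   restriction to that diagonal obeys the chain rule. The factorization can be changed by moving
   powers of z_2 - z_1 between f and g, which is harmless because of the rule for multiplication by
   z_ij.

   X [] X is invariant because X o_1 X is already symmetric in its first two arguments: the sum over
   the three shuffles is half of the sum over S_3.

   The function 1/((z_3 - z_1)(z_3 - z_2)) makes each shuffle yield one Jacobi term. The identity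
   shuffle sees no pole at z_1 = z_2, so its inner operation is evaluated at 1, a bracket; the two
   others see one pole inside and one outside.

   Filtrations count polar divisors without multiplicity, so d/dz_1 stays in F^1: higher powers of
   1/z cost no more than 1/z. *)
From HB Require Import structures.
Require Import Defs.
From mathcomp Require Import all_boot all_order all_fingroup all_algebra.
From mathcomp Require Import generic_quotient ring_quotient.
From mathcomp Require Import finmap.
From mathcomp Require Import boolp classical_sets functions.
(* Not imported: its notation for {mpoly F[n]} clashes with that of [mpoly]. *)
From mathcomp Require monalg.
From mathcomp Require Import mpoly.
From mathcomp Require Import ring.

Set Implicit Arguments.
Unset Strict Implicit.
Unset Printing Implicit Defensive.

Import GRing.Theory Num.Theory.
Local Open Scope ring_scope.
Local Open Scope classical_set_scope.
Local Open Scope quotient_scope.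

(** * Polynomials with vector coefficients *)

(* Sealed copies of [lcoef], [lmonom] and [lconst]: unification would otherwise
   try to tell two of their values apart by computing in [malg]. *)
HB.lock Definition lcf (F : fieldType) (U : lmodType F) (n : nat)
    (m : 'X_{1..n}) (p : lpoly U n) : U := lcoef m p.
HB.lock Definition lmon (F : fieldType) (U : lmodType F) (n : nat)
    (m : 'X_{1..n}) (u : U) : lpoly U n := lmonom m u.
HB.lock Definition lcst (F : fieldType) (U : lmodType F) (n : nat) (u : U) :
  lpoly U n := lconst n u.

Section LpolyTheory.
Variables (F : fieldType) (U : lmodType F) (n : nat).
Local Notation lpoly := (lpoly U n).
Local Notation lcst := (@lcst F U n).
Implicit Types (p q : lpoly) (i j : 'I_n) (m : 'X_{1..n}).

Lemma lcfP p q : (forall m, lcf m p = lcf m q) -> p = q.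
Proof. by rewrite lcf.unlock; apply: lpolyP. Qed.

Lemma lcf_monom m m1 (u : U) : lcf m1 (lmon m u) = u *+ (m == m1).
Proof. by rewrite lcf.unlock lmon.unlock; apply: monalg.mcoeffU. Qed.

Lemma lcf0 m : lcf m (0 : lpoly) = 0.
Proof. by rewrite lcf.unlock; apply: monalg.mcoeff0. Qed.

Lemma lcfN m p : lcf m (- p) = - lcf m p.
Proof. by rewrite lcf.unlock; apply: monalg.mcoeffN. Qed.

Lemma lcfD m p q : lcf m (p + q) = lcf m p + lcf m q.
Proof. by rewrite lcf.unlock; apply: lcoefD. Qed.

Lemma lcfZ m a p : lcf m (a *: p) = a *: lcf m p.
Proof. by rewrite lcf.unlock; apply: lcoef_scale. Qed.

Lemma lcf_map m (phi : U -> U) p : phi 0 = 0 -> lcf m (lmap phi p) = phi (lcf m p).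
Proof. by rewrite lcf.unlock; apply: lcoef_lmap. Qed.

Lemma lcf_mul i m p :
  lcf m (lmul i p) = if m i is 0 then 0 else lcf (m - U_(i))%MM p.
Proof. by rewrite lcf.unlock; apply: lcoef_lmul. Qed.

Lemma lmulD i p q : lmul i (p + q) = lmul i p + lmul i q.
Proof. exact: linearD. Qed.

Lemma lmulZ i a p : lmul i (a *: p) = a *: lmul i p.
Proof. exact: linearZ. Qed.

Lemma lmul0 i : lmul i (0 : lpoly) = 0.
Proof. exact: linear0. Qed.

Lemma lmulN i p : lmul i (- p) = - lmul i p.
Proof. exact: linearN. Qed.

Lemma lmonE p : p = \sum_(m <- lsupp p) lmon m (lcf m p).
Proof. by rewrite lcf.unlock lmon.unlock; apply: monalg.monalgE. Qed.

Lemma lcf_sum (I : Type) (r : seq I) (P : pred I) (f : I -> lpoly) m :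
  lcf m (\sum_(i <- r | P i) f i) = \sum_(i <- r | P i) lcf m (f i).
Proof. exact: (big_morph (lcf m) (lcfD m) (lcf0 m)). Qed.

Lemma lcf_outdom p m : m \notin lsupp p -> lcf m p = 0.
Proof. by rewrite lcf.unlock; apply: monalg.mcoeff_outdom. Qed.

Lemma lderivE i p :
  lderiv i p = \sum_(m <- lsupp p) lmon (m - U_(i))%MM (lcf m p *+ m i).
Proof. by rewrite lderiv.unlock lcf.unlock lmon.unlock. Qed.

Lemma lsuppD p q : (lsupp (p + q)%R `<=` lsupp p `|` lsupp q)%fset.
Proof. exact: monalg.msuppD_le. Qed.

Lemma lsupp_mon m (u : U) : (lsupp (lmon m u) `<=` [fset m])%fset.
Proof. by rewrite lmon.unlock; apply: monalg.msuppU_le. Qed.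

Lemma lcstE u : lcst u = lmon 0%MM u.
Proof. by rewrite lcst.unlock lmon.unlock. Qed.

Lemma lcf_cst m (u : U) : lcf m (lcst u) = u *+ (0%MM == m).
Proof. by rewrite lcstE lcf_monom. Qed.

Lemma lmonD m (u v : U) : lmon m (u + v) = lmon m u + lmon m v.
Proof. by apply/lcfP => k; rewrite lcfD !lcf_monom mulrnDl. Qed.

Lemma lcstD (u v : U) : lcst (u + v) = lcst u + lcst v.
Proof. by rewrite !lcstE lmonD. Qed.

Lemma lcstZ a (u : U) : lcst (a *: u) = a *: lcst u.
Proof. by apply/lcfP => k; rewrite lcfZ !lcf_cst scalerMnr. Qed.

Lemma lcst0 : lcst (0 : U) = 0.
Proof. by apply/lcfP => k; rewrite lcf_cst mul0rn lcf0. Qed.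

Lemma lmul_monom i m (u : U) : lmul i (lmon m u) = lmon (U_(i) + m)%MM u.
Proof.
apply/lcfP => k; rewrite lcf_mul !lcf_monom.
case ki: (k i) => [|x].
  case: eqP => // /mnmP/(_ i); by rewrite mnmDE mnm1E eqxx ki.
congr (_ *+ nat_of_bool _).
have def_k : k = (U_(i) + (k - U_(i)))%MM.
  apply/mnmP => j; rewrite mnmDE mnmBE mnm1E.
  by case: eqP => [<-|_]; rewrite ?subnKC ?subn0 // ki.
by rewrite {2}def_k (inj_eq (@addmI _ _)).
Qed.

Lemma mnm_neq0 (m : 'X_{1..n}) : m != 0%MM ->
  {i | m = (U_(i) + (m - U_(i)))%MM & (0 < m i)%N}.
Proof.
move=> m0; have /sigW[i mi] : exists i, (0 < m i)%N.
  apply: contrapT => h; move/eqP: m0; apply; apply/mnmP => i.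
  rewrite mnm0E; apply/eqP; rewrite -leqn0 leqNgt; apply/negP => hi.
  by apply: h; exists i.
exists i => //; apply/mnmP => j; rewrite mnmDE mnmBE mnm1E.
by case: eqP => [<-|_]; rewrite ?subnKC ?subn0.
Qed.

(** The maps studied below are additive and have a known commutation with the [lmul i], so this
    induction reduces their identities to constants and avoids computing with monomials. *)
Lemma lpoly_ind (P : lpoly -> Prop) :
  (forall p q, P p -> P q -> P (p + q)) -> (forall u, P (lcst u)) ->
  (forall i p, P p -> P (lmul i p)) -> forall p, P p.
Proof.
move=> PD Pc Pm.
have P0 : P 0 by rewrite -lcst0.
have Pmon m u : P (lmon m u).
  have [k] := ubnP (mdeg m); elim: k m => // k IH m le_m.
  have [->|m0] := eqVneq m 0%MM; first by rewrite -lcstE; apply: Pc.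
  have [i def_m mi] := mnm_neq0 m0.
  rewrite def_m -lmul_monom; apply/Pm/IH.
  by move: le_m; rewrite {1}def_m mdegD mdeg1 add1n.
move=> p; rewrite (lmonE p); elim/big_rec: _ => // m q _ Pq.
by apply: PD => //; apply: Pmon.
Qed.

Lemma lcf_deriv i m p :
  lcf m (lderiv i p) = lcf (U_(i) + m)%MM p *+ (m i).+1.
Proof.
rewrite lderivE lcf_sum.
under eq_bigr do rewrite lcf_monom.
pose k := (U_(i) + m)%MM.
have ki : k i = (m i).+1 by rewrite mnmDE mnm1E eqxx.
have kK : (k - U_(i))%MM = m by rewrite /k addmC addmK.
(* Subtraction of exponents is truncated: besides [k], an exponent [k'] with [k' i = 0] may also
   reduce to [m], but then the factor [k' i] vanishes. *)
have key k' : k' != k -> lcf k' p *+ k' i *+ ((k' - U_(i))%MM == m) = 0.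
  move=> nk; case: eqP => [eqk|]; last by rewrite mulr0n.
  case k'i: (k' i) => [|x]; first by rewrite mulr0n mul0rn.
  case/eqP: nk; rewrite /k -eqk; apply/mnmP => j; rewrite mnmDE mnmBE mnm1E.
  by case: eqP => [<-|_]; rewrite ?subnKC ?subn0 // k'i.
rewrite -/k; case: (boolP (k \in lsupp p)) => [kp|].
  rewrite (bigD1_seq k) ?fset_uniq //= kK eqxx mulr1n ki.
  by rewrite big1 ?addr0 // => k' /key.
move/lcf_outdom => k0; rewrite k0 mul0rn.
rewrite big1 // => k' _; have [->|/key//] := eqVneq k' k.
by rewrite k0 !mul0rn.
Qed.

Lemma lderivD i p q : lderiv i (p + q) = lderiv i p + lderiv i q.
Proof. by apply/lcfP => m; rewrite !(lcfD, lcf_deriv) mulrnDl. Qed.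

Lemma lderivZ i a p : lderiv i (a *: p) = a *: lderiv i p.
Proof.
by apply/lcfP => m; rewrite !(lcfZ, lcf_deriv) scalerMnr.
Qed.

Lemma lderiv_const i (u : U) : lderiv i (lcst u) = 0.
Proof.
apply/lcfP => m; rewrite lcf_deriv lcf0 lcf_cst.
by case: eqP => [/mnmP/(_ i)|]; rewrite ?mul0rn // mnmDE mnm1E eqxx mnm0E.
Qed.

Lemma lderiv_mul i j p :
  lderiv i (lmul j p) = lmul j (lderiv i p) + p *+ (i == j).
Proof.
apply/lcfP => m; rewrite lcfD lcf_deriv !lcf_mul mnmDE mnm1E.
have [<-{j}|nij] := eqVneq i j.
  rewrite /= mulr1n; have -> : (U_(i) + m - U_(i))%MM = m by rewrite addmC addmK.
  case mi: (m i) => [|x]; first by rewrite mulr1n add0r.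
  rewrite lcf_deriv !mnmBE mnm1E eqxx mi subn1 /= [LHS]mulrSr.
  suff -> : (U_(i) + (m - U_(i)))%MM = m by [].
  apply/mnmP => l; rewrite mnmDE mnmBE mnm1E; case: eqP => [<-|_].
    by rewrite mi subnKC.
  by rewrite add0n subn0.
rewrite mulr0n lcf0 addr0 add0n; case: (m j) (erefl (m j)) => [|x] mj.
  by rewrite mul0rn.
rewrite lcf_deriv mnmBE mnm1E eq_sym (negPf nij) subn0.
congr (lcf _ p *+ _); apply/mnmP => l; rewrite !(mnmDE, mnmBE, mnm1E).
have [<-{l}|njl] := eqVneq j l; last by rewrite !subn0.
by rewrite (negPf nij) !add0n.
Qed.

Lemma lmap_const (phi : U -> U) (u : U) : phi 0 = 0 ->
  lmap phi (lcst u) = lcst (phi u).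
Proof.
move=> phi0; apply/lcfP => m; rewrite lcf_map // !lcf_cst.
by case: eqP; rewrite ?mulr1n ?mulr0n.
Qed.

Lemma lmap_mul (phi : U -> U) i p : phi 0 = 0 ->
  lmap phi (lmul i p) = lmul i (lmap phi p).
Proof.
move=> phi0; apply/lcfP => m; rewrite lcf_map // !lcf_mul.
by case: (m i) => //= x; rewrite lcf_map.
Qed.

Lemma lmapD (phi : {additive U -> U}) p q :
  lmap phi (p + q) = lmap phi p + lmap phi q.
Proof.
by apply/lcfP => m; rewrite !(lcfD, lcf_map) ?raddf0 // raddfD.
Qed.

Lemma lmulC i j p : lmul i (lmul j p) = lmul j (lmul i p).
Proof.
apply/lcfP => m; rewrite !lcf_mul !mnmBE !mnm1E.
have [->//|nij] := eqVneq i j; rewrite /= !subn0.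
by case: (m i) (m j) => [|x] [|y] //; congr lcf; rewrite submDA addmC -submDA.
Qed.

Section Lsubst.
Variables (M : zmodType) (A : 'I_n -> M -> M) (phi : U -> M).
Hypothesis AD : forall i, {morph A i : x y / x + y}.
Hypothesis AC : forall i j x, A i (A j x) = A j (A i x).
Hypothesis phiD : {morph phi : x y / x + y}.

Let morph0 (V W : zmodType) (f : V -> W) : {morph f : x y / x + y} -> f 0 = 0.
Proof. by move=> fD; apply: (addrI (f 0)); rewrite -fD !addr0. Qed.

Let term m u :=
  foldr (fun i x => iter (m i) (A i) x) (phi u) (enum 'I_n) : M.

Let iterD i k : {morph iter k (A i) : x y / x + y}.
Proof. by elim: k => //= k IH x y /=; rewrite IH AD. Qed.

Let termD m : {morph term m : u v / u + v}.
Proof.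
move=> u v; rewrite /term; elim: (enum _) => [|i s IH] /=; first exact: phiD.
by rewrite IH iterD.
Qed.

Let term0 m : term m 0 = 0. Proof. exact/morph0/termD. Qed.

Let lsubstEw (D : {fset 'X_{1..n}}) p : (lsupp p `<=` D)%fset ->
  lsubst A phi p = \sum_(m <- D) term m (lcf m p).
Proof.
move=> sD; rewrite /lsubst -/(lsupp p) (big_fset_incl _ sD) //= => [|m _ mp].
  by rewrite lcf.unlock.
by have := term0 m; rewrite -(lcf_outdom mp) lcf.unlock.
Qed.

Lemma lsubstD : {morph lsubst A phi : p q / p + q}.
Proof.
move=> p q.
rewrite (lsubstEw (D := (lsupp p `|` lsupp q)%fset)) ?lsuppD //.
rewrite (lsubstEw (D := (lsupp p `|` lsupp q)%fset)) ?fsubsetUl //.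
rewrite (@lsubstEw (lsupp p `|` lsupp q)%fset q) ?fsubsetUr //.
by rewrite -big_split; apply: eq_bigr => m _; rewrite lcfD termD.
Qed.

Let lsubst_monom m u : lsubst A phi (lmon m u) = term m u.
Proof.
rewrite (@lsubstEw [fset m]%fset) ?lsupp_mon //.
by rewrite big_seq_fset1 lcf_monom eqxx mulr1n.
Qed.

Lemma lsubst_const u : lsubst A phi (lcst u) = phi u.
Proof.
rewrite lcstE lsubst_monom /term; elim: (enum _) => //= i s ->; by rewrite mnm0E.
Qed.

Let iterC i j k x : A i (iter k (A j) x) = iter k (A j) (A i x).
Proof. by elim: k => //= k IH; rewrite AC IH. Qed.

(** The additional factor [A i] is carried to the front through the factors of the variables
    enumerated before [i]; this is where commutation of the operators enters. *)
Let termM i m u : term (U_(i) + m)%MM u = A i (term m u).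
Proof.
rewrite /term; have := enum_uniq 'I_n; have : i \in enum 'I_n by rewrite mem_enum.
elim: (enum _) => // j s IH; rewrite inE /=.
have [<-{j} _ /andP[nis _]|nij /= si /andP[_ us]] := eqVneq i j.
  rewrite mnmDE mnm1E eqxx add1n iterS; congr (A i (iter _ _ _)).
  elim: s nis {IH} => //= j s IH; rewrite inE negb_or => /andP[nij /IH ->].
  by rewrite mnmDE mnm1E (negPf nij).
by rewrite IH // mnmDE mnm1E (negPf nij) iterC.
Qed.

Lemma lsubst_mul i p : lsubst A phi (lmul i p) = A i (lsubst A phi p).
Proof.
have AlD q r : A i (lsubst A phi (q + r))
    = A i (lsubst A phi q) + A i (lsubst A phi r) by rewrite lsubstD AD.
rewrite (lmonE p); elim: (enum_fset _) => [|m s IH].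
  rewrite !big_nil lmul0 -lcst0 !lsubst_const (morph0 phiD).
  by rewrite (morph0 (AD i)).
rewrite !big_cons lmulD lsubstD IH AlD; congr (_ + _).
by rewrite lmul_monom !lsubst_monom termM.
Qed.

End Lsubst.

End LpolyTheory.

Section LpolyMaps.
Variables (F : fieldType) (U : lmodType F) (n : nat) (M : zmodType).

Lemma lpoly_eqfun (f g : lpoly U n -> M) :
  {morph f : p q / p + q} -> {morph g : p q / p + q} ->
  (forall u, f (lcst n u) = g (lcst n u)) ->
  (forall i p, f p = g p -> f (lmul i p) = g (lmul i p)) -> f =1 g.
Proof.
move=> fD gD fgc fgm p; elim/lpoly_ind: p => [p q hp hq|u|i p hp].
- by rewrite fD gD hp hq.
- exact: fgc.
- exact: fgm.
Qed.

End LpolyMaps.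

(** * The quotient by the total derivative *)

Section LsubstMore.
Variables (F : fieldType) (U : lmodType F) (n : nat).

Lemma eq_lsubst (M : zmodType) (A A' : 'I_n -> M -> M) (phi phi' : U -> M) :
  A =2 A' -> phi =1 phi' -> lsubst A phi =1 lsubst A' phi'.
Proof.
move=> eA ephi p; apply: eq_bigr => m _; elim: (enum _) => [|i s IH] //=.
by rewrite IH; elim: (m i) => //= k ->; rewrite eA.
Qed.

Lemma lcst_unlock (u : U) : lconst n u = lcst n u.
Proof. by rewrite lcst.unlock. Qed.

Lemma morphD0 (V W : zmodType) (f : V -> W) :
  {morph f : x y / x + y} -> f 0 = 0.
Proof. by move=> fD; apply: (addrI (f 0)); rewrite -fD !addr0. Qed.

Lemma morphDN (V W : zmodType) (f : V -> W) :
  {morph f : x y / x + y} -> {morph f : x / - x}.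
Proof.
by move=> fD x; apply: (addrI (f x)); rewrite -fD !subrr (morphD0 fD).
Qed.

Lemma morphDB (V W : zmodType) (f : V -> W) :
  {morph f : x y / x + y} -> {morph f : x y / x - y}.
Proof. by move=> fD x y /=; rewrite fD (morphDN fD). Qed.

Lemma morphD_sum (V W : zmodType) (f : V -> W) (I : Type) (r : seq I)
    (P : pred I) (g : I -> V) : {morph f : x y / x + y} ->
  f (\sum_(i <- r | P i) g i) = \sum_(i <- r | P i) f (g i).
Proof. by move=> fD; apply: (big_morph f fD (morphD0 fD)). Qed.

End LsubstMore.

HB.lock Definition qp (F : fieldType) (U : lmodType F) (d : {linear U -> U})
  (n : nat) (p : lpoly U n) : lquot d n := \pi_(lquot d n) p.
HB.lock Definition qc (F : fieldType) (U : lmodType F) (d : {linear U -> U})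
  (n : nat) (u : U) : lquot d n := qp d (lcst n u).

HB.lock Definition sqmul (F : fieldType) (U : lmodType F) (d : {linear U -> U})
  (n : nat) (i : 'I_n) (x : lquot d n) : lquot d n := qmul i x.
HB.lock Definition sqderivB (F : fieldType) (U : lmodType F)
  (d : {linear U -> U}) (n : nat) (j i : 'I_n) (x : lquot d n) : lquot d n :=
  qderivB j i x.

Section LquotTheory.
Variables (F : fieldType) (U : lmodType F) (d : {linear U -> U}) (n : nat).
Local Notation lpoly := (lpoly U n).
Local Notation lquot := (lquot d n).
Local Notation qp := (@qp F U d n).
Local Notation qc := (@qc F U d n).

Lemma qpE p : \pi_lquot p = qp p.
Proof. by rewrite qp.unlock. Qed.

Lemma qpD p q : qp (p + q) = qp p + qp q.
Proof. by rewrite -!qpE raddfD. Qed.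

Lemma qpN p : qp (- p) = - qp p.
Proof. by rewrite -!qpE raddfN. Qed.

Lemma qpB p q : qp (p - q) = qp p - qp q.
Proof. by rewrite qpD qpN. Qed.

Lemma qp0 : qp 0 = 0.
Proof. by rewrite -!qpE raddf0. Qed.

Lemma qpZ a p : qp (a *: p) = a *: qp p.
Proof. by rewrite -!qpE -(qscale_pi d). Qed.

Lemma qp_sum (I : Type) (r : seq I) (P : pred I) (f : I -> lpoly) :
  qp (\sum_(i <- r | P i) f i) = \sum_(i <- r | P i) qp (f i).
Proof. exact: (morphD_sum _ _ _ qpD). Qed.

Lemma qp_repr (x : lquot) : qp (repr x) = x.
Proof. by rewrite -qpE reprK. Qed.

Lemma qp_tot p : qp (ltot d p) = 0.
Proof.
rewrite -qpE -(raddf0 \pi_lquot); apply/eqP.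
by rewrite -Quotient.idealrBE subr0; apply/asboolP; exists p.
Qed.

Lemma repr_qp p : exists q, repr (qp p) = p + ltot d q.
Proof.
have : qp (repr (qp p)) = qp p by rewrite qp_repr.
rewrite -!qpE => /eqP; rewrite -Quotient.idealrBE => /asboolP[q hq].
by exists q; rewrite -hq addrC subrK.
Qed.

(** Operations on the quotient are computed on [repr], which differs from [p] by a total derivative;
    an additive map killing these does not see the choice. *)
Lemma lquot_lift (M : zmodType) (g : lpoly -> M) p :
  {morph g : p q / p + q} -> (forall q, g (ltot d q) = 0) ->
  g (repr (qp p)) = g p.
Proof.
by move=> gD g0; have [q ->] := repr_qp p; rewrite gD g0 addr0.
Qed.

Lemma lmapdD p q : lmap d (p + q : lpoly) = lmap d p + lmap d q.
Proof. exact: lmapD. Qed.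

Lemma ltotD p q : ltot d (p + q : lpoly) = ltot d p + ltot d q.
Proof. exact: linearD. Qed.

Lemma ltot_mul i (p : lpoly) : ltot d (lmul i p) = lmul i (ltot d p).
Proof.
rewrite /ltot lmulD lmap_mul ?raddf0 //; congr (_ + _).
rewrite (morphD_sum _ _ _ (lmulD i)).
by apply: eq_bigr => j _; rewrite lmulC.
Qed.

Lemma qmul_qp i p : sqmul i (qp p) = qp (lmul i p).
Proof.
rewrite sqmul.unlock /qmul qpE; apply: (lquot_lift (g := fun q => qp (lmul i q))) => [q r|q].
  by rewrite lmulD qpD.
by rewrite -ltot_mul qp_tot.
Qed.

Lemma qmulD i (x y : lquot) : sqmul i (x + y) = sqmul i x + sqmul i y.
Proof.
by rewrite -(qp_repr x) -(qp_repr y) -qpD !qmul_qp lmulD qpD.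
Qed.

Lemma qmulZ i a (x : lquot) : sqmul i (a *: x) = a *: sqmul i x.
Proof. by rewrite -(qp_repr x) -qpZ !qmul_qp lmulZ qpZ. Qed.

Lemma qmulC i j (x : lquot) : sqmul i (sqmul j x) = sqmul j (sqmul i x).
Proof. by rewrite -(qp_repr x) !qmul_qp lmulC. Qed.

Lemma qmul0 i : sqmul i (0 : lquot) = 0.
Proof. exact: (morphD0 (qmulD i)). Qed.

Lemma qmulN i (x : lquot) : sqmul i (- x) = - sqmul i x.
Proof. exact: (morphDN (qmulD i)). Qed.

(** The commutator with [ltot] is the identity, because lambda_i occurs once in the total
    derivative. A single [lderiv i] therefore does not descend to the quotient, but the difference
    of two does. *)
Lemma lderiv_tot i (p : lpoly) : lderiv i (ltot d p) = ltot d (lderiv i p) + p.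
Proof.
elim/lpoly_ind: p => [p q hp hq|u|k p hp].
- by rewrite ltotD [in LHS]lderivD hp hq (lderivD i p) ltotD addrACA.
- rewrite lderiv_const (morphD0 ltotD) add0r /ltot lderivD lmap_const ?raddf0 //.
  rewrite lderiv_const add0r (morphD_sum _ _ _ (lderivD i)) (bigD1 i) //=.
  rewrite lderiv_mul lderiv_const lmul0 add0r eqxx mulr1n big1 ?addr0 // => j nj.
  by rewrite lderiv_mul lderiv_const lmul0 add0r eq_sym (negPf nj).
- rewrite ltot_mul !lderiv_mul hp lmulD ltotD ltot_mul.
  rewrite [LHS]addrAC; congr (_ + _ + _).
  by case: (i == k); rewrite ?mulr1n ?mulr0n ?(morphD0 ltotD).
Qed.

Lemma qderivB_qp j i p :
  sqderivB j i (qp p) = qp (lderiv j p - lderiv i p).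
Proof.
rewrite sqderivB.unlock /qderivB qpE.
apply: (lquot_lift (g := fun q => qp (lderiv j q - lderiv i q))) => [q r|q] /=.
  by rewrite -qpD; congr qp; rewrite !lderivD opprD addrACA.
rewrite !lderiv_tot opprD addrACA subrr addr0.
by rewrite -(morphDB ltotD) qp_tot.
Qed.

Lemma qderivBD j i (x y : lquot) :
  sqderivB j i (x + y) = sqderivB j i x + sqderivB j i y.
Proof.
rewrite -(qp_repr x) -(qp_repr y) -qpD !qderivB_qp -qpD; congr qp.
by rewrite !lderivD opprD addrACA.
Qed.

Lemma qderivBZ j i a (x : lquot) :
  sqderivB j i (a *: x) = a *: sqderivB j i x.
Proof.
by rewrite -(qp_repr x) -qpZ !qderivB_qp !lderivZ -scalerBr qpZ.
Qed.

Lemma qcD u v : qc (u + v) = qc u + qc v.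
Proof. by rewrite qc.unlock lcstD qpD. Qed.

Lemma qcZ a u : qc (a *: u) = a *: qc u.
Proof. by rewrite qc.unlock lcstZ qpZ. Qed.

Lemma qcE u : qp (lcst n u) = qc u.
Proof. by rewrite qc.unlock. Qed.

Lemma qderivB_c j i u : sqderivB j i (qc u) = 0.
Proof. by rewrite -qcE qderivB_qp !lderiv_const subrr qp0. Qed.

Lemma qderivB_mul j i k (x : lquot) :
  sqderivB j i (sqmul k x)
    = sqmul k (sqderivB j i x) + (x *+ (j == k) - x *+ (i == k)).
Proof.
rewrite -(qp_repr x) qmul_qp !qderivB_qp qmul_qp !lderiv_mul lmulD lmulN.
rewrite opprD addrACA [LHS]qpD; congr (_ + _); rewrite qpB.
by case: (j == k); case: (i == k); rewrite ?mulr1n ?mulr0n ?qp0.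
Qed.

Lemma qc_tot u : qc (d u) + \sum_(i < n) sqmul i (qc u) = 0.
Proof.
rewrite -[RHS](qp_tot (lcst n u)) /ltot qpD lmap_const ?raddf0 // qcE.
rewrite qp_sum; congr (_ + _); apply: eq_bigr => i _.
by rewrite -qmul_qp qcE.
Qed.

Lemma lquot_ind (P : lquot -> Prop) :
  (forall x y, P x -> P y -> P (x + y)) -> (forall u, P (qc u)) ->
  (forall i x, P x -> P (sqmul i x)) -> forall x, P x.
Proof.
move=> PD Pc Pm x; rewrite -(qp_repr x).
elim/lpoly_ind: (repr x) => [p q hp hq|u|i p hp].
- by rewrite qpD; apply: PD.
- by rewrite qcE.
- by rewrite -qmul_qp; apply: Pm.
Qed.

Lemma lquot_eqfun (M : zmodType) (f g : lquot -> M) :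
  {morph f : p q / p + q} -> {morph g : p q / p + q} ->
  (forall u, f (qc u) = g (qc u)) ->
  (forall i p, f p = g p -> f (sqmul i p) = g (sqmul i p)) -> f =1 g.
Proof.
move=> fD gD fgc fgm p; elim/lquot_ind: p => [p q hp hq|u|i p hp].
- by rewrite fD gD hp hq.
- exact: fgc.
- exact: fgm.
Qed.

(* [R] restricts to the arguments on which the relation holds. *)
Section Qsubst.
Variables (M N : zmodType) (R : M -> N) (A : 'I_n -> M -> M) (phi : U -> M).
Hypothesis AD : forall i, {morph A i : x y / x + y}.
Hypothesis AC : forall i j x, A i (A j x) = A j (A i x).
Hypothesis phiD : {morph phi : x y / x + y}.
Hypothesis RD : {morph R : x y / x + y}.
Hypothesis RA : forall i x, R x = 0 -> R (A i x) = 0.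
Hypothesis Rtot : forall u, R (phi (d u) + \sum_(i < n) A i (phi u)) = 0.

Let lsubst_tot p : R (lsubst A phi (ltot d p)) = 0.
Proof.
have sD := lsubstD AD phiD.
elim/lpoly_ind: p => [p q hp hq|u|i p hp].
- by rewrite ltotD sD RD hp hq addr0.
- rewrite /ltot sD lmap_const ?raddf0 // lsubst_const //.
  rewrite (morphD_sum _ _ _ sD) -(Rtot u); congr (R (_ + _)).
  by apply: eq_bigr => i _; rewrite lsubst_mul // lsubst_const.
- by rewrite ltot_mul lsubst_mul //; apply: RA.
Qed.

(** By [Rtot] and [RA], substitution sends every total derivative to something that [R] kills, so
    any representative may be used. *)
Lemma qsubst_qp p : R (lsubst A phi (repr (qp p))) = R (lsubst A phi p).
Proof.
apply: (lquot_lift (g := fun q => R (lsubst A phi q))) => [q r|]//.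
by rewrite (lsubstD AD phiD) RD.
Qed.

Lemma qsubstD (x y : lquot) : R (lsubst A phi (repr (x + y)))
  = R (lsubst A phi (repr x)) + R (lsubst A phi (repr y)).
Proof.
by rewrite -(qp_repr x) -(qp_repr y) -qpD !qsubst_qp (lsubstD AD phiD) RD.
Qed.

Lemma qsubst_c u : R (lsubst A phi (repr (qc u))) = R (phi u).
Proof. by rewrite -qcE qsubst_qp lsubst_const. Qed.

Lemma qsubst_mul i (x : lquot) :
  R (lsubst A phi (repr (sqmul i x))) = R (A i (lsubst A phi (repr x))).
Proof. by rewrite -{1}(qp_repr x) qmul_qp qsubst_qp lsubst_mul. Qed.

End Qsubst.

End LquotTheory.

(** * Elimination of the last variable *)

(* lambda_n := - lambda_0 - .. - lambda_(n-1) - d *)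
Definition last_op (F : fieldType) (U : lmodType F) (d : {linear U -> U}) n
    (i : 'I_n.+1) (p : lpoly U n) : lpoly U n :=
  if unlift ord_max i is Some j then lmul j p
  else - (\sum_(j < n) lmul j p) - lmap d p.

HB.lock Definition elim_last (F : fieldType) (U : lmodType F)
    (d : {linear U -> U}) n (x : lquot d n.+1) : lpoly U n :=
  lsubst (@last_op F U d n) (@lcst F U n) (repr x).

HB.lock Definition elim_last_inv (F : fieldType) (U : lmodType F)
    (d : {linear U -> U}) n (p : lpoly U n) : lquot d n.+1 :=
  lsubst (fun j => sqmul (lift ord_max j)) (@qc F U d n.+1) p.

Section LquotIso.
Variables (F : fieldType) (U : lmodType F) (d : {linear U -> U}) (n : nat).
Local Notation lcst := (@lcst F U _).
Local Notation qc := (@qc F U d _).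

Local Notation last_op := (@last_op F U d n).
Local Notation elim_last := (@elim_last F U d n).
Local Notation elim_last_inv := (@elim_last_inv F U d n).

Lemma last_op_lift j p : last_op (lift ord_max j) p = lmul j p.
Proof. by rewrite /last_op liftK. Qed.

Lemma last_op_max p :
  last_op ord_max p = - (\sum_(j < n) lmul j p) - lmap d p.
Proof. by rewrite /last_op unlift_none. Qed.

Lemma last_opD i : {morph last_op i : p q / p + q}.
Proof.
move=> p q /=; case: (unliftP ord_max i) => [j ->|->].
  by rewrite !last_op_lift lmulD.
rewrite !last_op_max lmapD addrACA -!opprD; congr (- (_ + _)).
by rewrite -big_split; apply: eq_bigr => j _; rewrite lmulD.
Qed.

Lemma last_op_mul i j p : last_op i (lmul j p) = lmul j (last_op i p).
Proof.
case: (unliftP ord_max i) => [k ->|->]; first by rewrite !last_op_lift lmulC.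
rewrite !last_op_max lmulD !lmulN lmap_mul ?raddf0 //; congr (- _ - _).
by rewrite (morphD_sum _ _ _ (lmulD j)); apply: eq_bigr => k _; rewrite lmulC.
Qed.

Lemma last_op_map i p : last_op i (lmap d p) = lmap d (last_op i p).
Proof.
have dD := lmapdD d (n := n).
case: (unliftP ord_max i) => [k ->|->].
  by rewrite !last_op_lift lmap_mul ?raddf0.
rewrite !last_op_max dD !(morphDN dD); congr (- _ - _).
rewrite (morphD_sum _ _ _ dD); apply: eq_bigr => k _.
by rewrite lmap_mul ?raddf0.
Qed.

Lemma last_opC i j p : last_op i (last_op j p) = last_op j (last_op i p).
Proof.
case: (unliftP ord_max j) => [k ->|->]; first by rewrite !last_op_lift last_op_mul.
have oD := last_opD i.
rewrite !last_op_max oD !(morphDN oD) (morphD_sum _ _ _ oD) last_op_map.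
by congr (- _ - _); apply: eq_bigr => k _; rewrite last_op_mul.
Qed.

Lemma last_op_tot u : lcst (d u) + \sum_(i < n.+1) last_op i (lcst u) = 0.
Proof.
rewrite (bigD1_ord ord_max) //= last_op_max lmap_const ?raddf0 //.
under eq_bigr do rewrite last_op_lift.
by rewrite [X in _ + X]addrAC addNr add0r subrr.
Qed.

Lemma elim_last_spec :
  [/\ {morph elim_last : x y / x + y},
      forall u, elim_last (qc u) = lcst u &
      forall i x, elim_last (sqmul i x) = last_op i (elim_last x)].
Proof.
have cD := @lcstD F U n.
have RA i (x : lpoly U n) : x = 0 -> last_op i x = 0.
  by move=> ->; apply: (morphD0 (last_opD i)).
rewrite elim_last.unlock; split=> [x y|u|i x].
- exact: (qsubstD (R := id) last_opD last_opC cD _ RA last_op_tot).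
- exact: (qsubst_c (R := id) last_opD last_opC cD _ RA last_op_tot).
- exact: (qsubst_mul (R := id) last_opD last_opC cD _ RA last_op_tot).
Qed.

Lemma elim_lastD : {morph elim_last : x y / x + y}.
Proof. by case: elim_last_spec. Qed.

Lemma elim_last_c u : elim_last (qc u) = lcst u.
Proof. by case: elim_last_spec. Qed.

Lemma elim_last_mul i x : elim_last (sqmul i x) = last_op i (elim_last x).
Proof. by case: elim_last_spec. Qed.

Lemma elim_lastZ a x : elim_last (a *: x) = a *: elim_last x.
Proof.
apply: (lquot_eqfun (f := fun x => elim_last (a *: x))
  (g := fun x => a *: elim_last x)) => [p q|p q|u|i p] /=.
- by rewrite scalerDr elim_lastD.
- by rewrite elim_lastD scalerDr.
- by rewrite -qcZ !elim_last_c lcstZ.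
- rewrite -qmulZ !elim_last_mul => ->.
  case: (unliftP ord_max i) => [j ->|->].
    by rewrite !last_op_lift lmulZ.
  rewrite !last_op_max scalerDr !scalerN scaler_sumr; congr (- _ - _).
    by apply: eq_bigr => j _; rewrite lmulZ.
  apply/lcfP => m; rewrite lcf_map ?raddf0 // !lcfZ lcf_map ?raddf0 //.
  by rewrite linearZ.
Qed.

Let ciD := @qcD F U d n.+1.
Let miD (j : 'I_n) := @qmulD F U d n.+1 (lift ord_max j).
Let miC (i j : 'I_n) := @qmulC F U d n.+1 (lift ord_max i) (lift ord_max j).

Lemma elim_last_invD : {morph elim_last_inv : p q / p + q}.
Proof. rewrite elim_last_inv.unlock; exact: lsubstD. Qed.

Lemma elim_last_inv_c u : elim_last_inv (lcst u) = qc u.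
Proof. rewrite elim_last_inv.unlock; exact: lsubst_const. Qed.

Lemma elim_last_inv_mul j p :
  elim_last_inv (lmul j p) = sqmul (lift ord_max j) (elim_last_inv p).
Proof. rewrite elim_last_inv.unlock; exact: lsubst_mul. Qed.

(** In the quotient the derivation acts as minus the sum of all the lambda_i. *)
Lemma elim_last_inv_map p :
  elim_last_inv (lmap d p) = - \sum_(i < n.+1) sqmul i (elim_last_inv p).
Proof.
have sumD : {morph (fun x : lquot d n.+1 => - \sum_(i < n.+1) sqmul i x)
    : x y / x + y}.
  move=> x y /=; rewrite -opprD -big_split; congr (- _).
  by apply: eq_bigr => j _; rewrite qmulD.
move: p; apply: lpoly_eqfun => [p q|p q|u|i p hp] /=.
- by rewrite lmapD elim_last_invD.
- by rewrite elim_last_invD; apply: sumD.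
- rewrite lmap_const ?raddf0 // !elim_last_inv_c.
  by apply/eqP; rewrite -addr_eq0 qc_tot.
- rewrite lmap_mul ?raddf0 // !elim_last_inv_mul hp qmulN; congr (- _).
  rewrite (morphD_sum _ _ _ (miD i)).
  by apply: eq_bigr => j _; rewrite qmulC.
Qed.

Lemma elim_lastK : cancel elim_last elim_last_inv.
Proof.
have iD := elim_last_invD.
apply: lquot_eqfun => [x y|x y|u|i x hx] //=.
- by rewrite elim_lastD iD.
- by rewrite elim_last_c elim_last_inv_c.
- rewrite elim_last_mul; case: (unliftP ord_max i) => [j ->|->].
    by rewrite last_op_lift elim_last_inv_mul hx.
  rewrite last_op_max iD !(morphDN iD) elim_last_inv_map opprK.
  rewrite (morphD_sum _ _ _ iD) hx (bigD1_ord ord_max) //=.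
  under eq_bigr do rewrite elim_last_inv_mul hx.
  by rewrite addrCA addNr addr0.
Qed.

Lemma elim_last_invK : cancel elim_last_inv elim_last.
Proof.
apply: lpoly_eqfun => [x y|x y|u|i x hx] //=.
- by rewrite elim_last_invD elim_lastD.
- by rewrite elim_last_inv_c elim_last_c.
- by rewrite elim_last_inv_mul elim_last_mul last_op_lift hx.
Qed.

Lemma elim_last_inj : injective elim_last.
Proof. exact: can_inj elim_lastK. Qed.

End LquotIso.

Section LquotDeriv.
Variables (F : fieldType) (U : lmodType F) (d : {linear U -> U}) (n : nat).

(** Chain rule: the last variable is replaced by - lambda_j - .., so d/dlambda_j after elimination
    is the difference of the derivatives in lambda_j and in the last variable. *)
Lemma elim_last_deriv j (x : lquot d n.+1) :
  elim_last (sqderivB (lift ord_max j) ord_max x) = lderiv j (elim_last x).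
Proof.
move: x; apply: lquot_eqfun => [x y|x y|u|i x hx] /=.
- by rewrite qderivBD elim_lastD.
- by rewrite elim_lastD lderivD.
- by rewrite qderivB_c elim_last_c lderiv_const (morphD0 (@elim_lastD _ _ d n)).
- have eD := @elim_lastD _ _ d n.
  rewrite qderivB_mul eD (morphDB eD) !elim_last_mul hx.
  case: (unliftP ord_max i) => [k ->|->].
    rewrite !last_op_lift lderiv_mul (inj_eq (lift_inj)) [ord_max == _]eq_sym.
    rewrite [lift _ _ == _]eq_sym (negPf (neq_lift _ _)) mulr0n.
    rewrite (morphD0 eD) subr0.
    by case: (j == k); rewrite ?mulr1n // mulr0n (morphD0 eD).
  rewrite eq_sym (negPf (neq_lift _ _)) eqxx mulr0n mulr1n (morphD0 eD) sub0r.
  rewrite !last_op_max lderivD (morphDN (@lderivD _ _ _ j)).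
  rewrite (morphD_sum _ _ _ (@lderivD _ _ _ j)).
  under [in RHS]eq_bigr do rewrite lderiv_mul.
  rewrite big_split opprD /= -!addrA; congr (_ + _); rewrite addrC.
  rewrite (bigD1 j) //= eqxx mulr1n big1 ?addr0 => [|k]; last first.
    by rewrite eq_sym => /negPf ->; rewrite mulr0n.
  congr (_ + _); apply/lcfP => m.
  rewrite (morphDN (@lderivD _ _ _ j)) !lcfN; congr (- _).
  rewrite lcf_map ?raddf0 // !lcf_deriv lcf_map ?raddf0 //.
  by rewrite raddfMn.
Qed.

End LquotDeriv.

(** * Permutation and expansion of the variables in the quotient *)

HB.lock Definition sqperm (F : fieldType) (U : lmodType F)
  (d : {linear U -> U}) (n : nat) (k : 'I_n -> 'I_n) (x : lquot d n) :
  lquot d n := qperm k x.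
HB.lock Definition sqexpand (F : fieldType) (U : lmodType F)
  (d : {linear U -> U}) (n m : nat) (x : lquot d m.+1) : lquot d (n + m) :=
  qexpand n x.
Arguments sqexpand {F U d n m} x.

Section LquotSubst.
Variables (F : fieldType) (U : lmodType F) (d : {linear U -> U}).
Local Notation qc := (@qc F U d _).

Section Qperm.
Variables (n : nat) (k : 'I_n -> 'I_n).
Hypothesis kI : injective k.

Let A (i : 'I_n) := @lmul F U n (k i).
Let RD : {morph (@qp F U d n) : x y / x + y}. Proof. exact: qpD. Qed.
Let RA i (x : lpoly U n) : qp d x = 0 -> qp d (A i x) = 0.
Proof. by rewrite /A -qmul_qp => ->; apply: qmul0. Qed.
Let Rtot u : qp d (lcst n (d u) + \sum_(i < n) A i (lcst n u)) = 0.
Proof.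
rewrite qpD qp_sum qcE -[RHS](qc_tot d n u); congr (_ + _).
rewrite [RHS](reindex_inj kI); apply: eq_bigr => i _ /=.
by rewrite /A -qmul_qp qcE.
Qed.
Let AD i : {morph A i : x y / x + y}. Proof. exact: lmulD. Qed.
Let AC i j x : A i (A j x) = A j (A i x). Proof. exact: lmulC. Qed.

Lemma qpermE (x : lquot d n) : sqperm k x = qp d (lsubst A (@lcst F U n) (repr x)).
Proof.
rewrite sqperm.unlock /qperm qpE; congr qp; apply: eq_lsubst => // u.
exact: lcst_unlock.
Qed.

Lemma qpermD : {morph @sqperm F U d n k : x y / x + y}.
Proof. by move=> x y; rewrite !qpermE (qsubstD AD AC (@lcstD _ _ _) RD RA Rtot). Qed.

Lemma qperm_c u : sqperm k (qc u) = qc u.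
Proof. by rewrite qpermE (qsubst_c AD AC (@lcstD _ _ _) RD RA Rtot) qcE. Qed.

Lemma qperm_mul i (x : lquot d n) : sqperm k (sqmul i x) = sqmul (k i) (sqperm k x).
Proof.
rewrite !qpermE (qsubst_mul AD AC (@lcstD _ _ _) RD RA Rtot).
by rewrite qmul_qp.
Qed.

Lemma qpermZ a (x : lquot d n) : sqperm k (a *: x) = a *: sqperm k x.
Proof.
apply: (lquot_eqfun (f := fun x => sqperm k (a *: x))
  (g := fun x => a *: sqperm k x)) => [p q|p q|u|i p] /=.
- by rewrite scalerDr qpermD.
- by rewrite qpermD scalerDr.
- by rewrite -qcZ !qperm_c qcZ.
- by rewrite -qmulZ !qperm_mul => ->; rewrite qmulZ.
Qed.

Lemma qperm_deriv i j (x : lquot d n) :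
  sqperm k (sqderivB i j x) = sqderivB (k i) (k j) (sqperm k x).
Proof.
move: x; apply: lquot_eqfun => [x y|x y|u|l x hx] /=.
- by rewrite qderivBD qpermD.
- by rewrite qpermD qderivBD.
- by rewrite qperm_c !qderivB_c (morphD0 qpermD).
- rewrite qperm_mul !qderivB_mul qpermD (morphDB qpermD) qperm_mul hx.
  rewrite !(inj_eq kI); congr (_ + (_ - _)).
    by case: (i == l); rewrite ?mulr1n ?mulr0n ?(morphD0 qpermD).
  by case: (j == l); rewrite ?mulr1n ?mulr0n ?(morphD0 qpermD).
Qed.

End Qperm.

Lemma qperm_comp n (k l : 'I_n -> 'I_n) (x : lquot d n) : injective k -> injective l ->
  sqperm k (sqperm l x) = sqperm (k \o l) x.
Proof.
move=> kI lI; have klI : injective (k \o l) by apply: inj_comp.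
move: x; apply: lquot_eqfun => [x y|x y|u|i x hx] /=.
- by rewrite !qpermD.
- by rewrite qpermD.
- by rewrite !qperm_c.
- by rewrite !qperm_mul // hx.
Qed.

Lemma qperm_id n (x : lquot d n) (k : 'I_n -> 'I_n) : k =1 id -> sqperm k x = x.
Proof.
move=> kid; have kI : injective k by move=> i j; rewrite !kid.
move: x; apply: lquot_eqfun => [x y|x y|u|i x hx] //=.
- by rewrite !qpermD.
- by rewrite !qperm_c.
- by rewrite !qperm_mul // hx kid.
Qed.

Lemma eq_qperm n (k l : 'I_n -> 'I_n) (x : lquot d n) :
  k =1 l -> sqperm k x = sqperm l x.
Proof. by move=> kl; rewrite (_ : k = l) //; apply: funext. Qed.

Section Qexpand.
Variables n m : nat.
Local Notation sqexpand := (@sqexpand F U d n m).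

Definition expand_op (i : 'I_m.+1) (p : lpoly U (n + m)) : lpoly U (n + m) :=
  if unlift ord0 i is Some j then lmul (rshift n j) p
  else \sum_(l < n) lmul (lshift m l) p.

Let RD : {morph (@qp F U d (n + m)) : x y / x + y}. Proof. exact: qpD. Qed.
Let AD i : {morph expand_op i : x y / x + y}.
Proof.
move=> x y /=; rewrite /expand_op; case: unlift => [j|]; first exact: lmulD.
by rewrite -big_split; apply: eq_bigr => j _; rewrite lmulD.
Qed.
Let A_mul i j x : expand_op i (lmul j x) = lmul j (expand_op i x).
Proof.
rewrite /expand_op; case: unlift => [k|]; first exact: lmulC.
rewrite (morphD_sum _ _ _ (lmulD j)).
by apply: eq_bigr => k _; rewrite lmulC.
Qed.
Let AC i j x : expand_op i (expand_op j x) = expand_op j (expand_op i x).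
Proof.
rewrite {2 3}/expand_op; case: unlift => [k|]; first exact: A_mul.
rewrite (morphD_sum _ _ _ (AD i)).
by apply: eq_bigr => k _; rewrite A_mul.
Qed.
Let RA i (x : lpoly U (n + m)) : qp d x = 0 -> qp d (expand_op i x) = 0.
Proof.
rewrite /expand_op; case: unlift => [k|] x0.
  by rewrite -qmul_qp x0 qmul0.
by rewrite qp_sum big1 // => k _; rewrite -qmul_qp x0 qmul0.
Qed.
Let Rtot u : qp d (lcst _ (d u) + \sum_(i < m.+1) expand_op i (lcst _ u)) = 0.
Proof.
rewrite qpD qp_sum qcE -[RHS](qc_tot d (n + m) u); congr (_ + _).
rewrite big_ord_recl big_split_ord /= {1}/expand_op unlift_none qp_sum.
congr (_ + _); apply: eq_bigr => i _; rewrite ?/expand_op ?liftK -qmul_qp qcE//.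
Qed.

Lemma qexpandE (x : lquot d m.+1) :
  sqexpand x = qp d (lsubst expand_op (@lcst F U _) (repr x)).
Proof.
rewrite sqexpand.unlock /qexpand qpE; congr qp; apply: eq_lsubst => // u.
exact: lcst_unlock.
Qed.

Lemma qexpandD : {morph sqexpand : x y / x + y}.
Proof.
by move=> x y; rewrite !qexpandE (qsubstD AD AC (@lcstD _ _ _) RD RA Rtot).
Qed.

Lemma qexpand_c u : sqexpand (qc u) = qc u.
Proof. by rewrite qexpandE (qsubst_c AD AC (@lcstD _ _ _) RD RA Rtot) qcE. Qed.

Let qexpand_mul i (x : lquot d m.+1) : sqexpand (sqmul i x)
  = qp d (expand_op i (lsubst expand_op (@lcst F U _) (repr x))).
Proof. by rewrite !qexpandE (qsubst_mul AD AC (@lcstD _ _ _) RD RA Rtot). Qed.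

Lemma qexpand_mul0 (x : lquot d m.+1) :
  sqexpand (sqmul ord0 x) = \sum_(l < n) sqmul (lshift m l) (sqexpand x).
Proof.
rewrite qexpand_mul /expand_op unlift_none qp_sum.
by apply: eq_bigr => l _; rewrite -qmul_qp -qexpandE.
Qed.

Lemma qexpand_mul_lift j (x : lquot d m.+1) :
  sqexpand (sqmul (lift ord0 j) x) = sqmul (rshift n j) (sqexpand x).
Proof. by rewrite qexpand_mul /expand_op liftK -qmul_qp -qexpandE. Qed.

Lemma qexpandZ a (x : lquot d m.+1) : sqexpand (a *: x) = a *: sqexpand x.
Proof.
apply: (lquot_eqfun (f := fun x => sqexpand (a *: x))
  (g := fun x => a *: sqexpand x)) => [p q|p q|u|i p] /=.
- by rewrite scalerDr qexpandD.
- by rewrite qexpandD scalerDr.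
- by rewrite -qcZ !qexpand_c qcZ.
- rewrite -qmulZ; case: (unliftP ord0 i) => [j ->|->].
    by rewrite !qexpand_mul_lift => ->; rewrite qmulZ.
  rewrite !qexpand_mul0 => ->; rewrite scaler_sumr.
  by apply: eq_bigr => j _; rewrite qmulZ.
Qed.

End Qexpand.

End LquotSubst.

(* Stated over an abstract field, since [field] is too slow on the structure of
   [{fraction R}]. *)
Section QuotientRules.
Variable K : fieldType.
Implicit Types p q dp dq : K.

Lemma quotient_rule_unique p q dp dq g : q != 0 -> g * q + p / q * dq = dp ->
  (dp * q - p * dq) / q ^+ 2 = g.
Proof. by move=> q0 <-; field. Qed.

Lemma quotient_ruleM p q dp dq p1 q1 dp1 dq1 : q != 0 -> q1 != 0 ->
  ((dp * q - p * dq) / q ^+ 2 * (p1 / q1)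
   + p / q * ((dp1 * q1 - p1 * dq1) / q1 ^+ 2)) * (q * q1)
  + p / q * (p1 / q1) * (dq * q1 + q * dq1) = dp * p1 + p * dp1.
Proof. by move=> q0 q10; field; rewrite q0 q10. Qed.

Lemma quotient_ruleD p q dp dq p1 q1 dp1 dq1 : q != 0 -> q1 != 0 ->
  ((dp * q - p * dq) / q ^+ 2 + (dp1 * q1 - p1 * dq1) / q1 ^+ 2) * (q * q1)
  + (p / q + p1 / q1) * (dq * q1 + q * dq1)
  = dp * q1 + p * dq1 + (dp1 * q + p1 * dq).
Proof. by move=> q0 q10; field; rewrite q0 q10. Qed.

(** The two hypotheses are the mixed second derivatives of an identity [g * q = p] in both orders:
    the cross terms [x] and [y] are merely exchanged, so the second derivatives [a] and [b] of [g]
    agree. *)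
Lemma leibniz_comm_cancel (a b q x y z w : K) : q != 0 ->
  a * q + x + (y + z) = w -> b * q + y + (x + z) = w -> a = b.
Proof.
move=> q0 <- /eqP; rewrite -subr_eq0 => /eqP e; apply: (mulIf q0).
by apply/eqP; rewrite eq_sym -subr_eq0 -e; apply/eqP; ring.
Qed.
End QuotientRules.

(** * Derivations and substitutions in fraction fields *)

HB.lock Definition frac_deriv (R : idomainType) (D : R -> R) (f : {fraction R}) :
    {fraction R} :=
  let p := \n_(repr f) in let q := \d_(repr f) in
  FracField.tofrac (D p * q - p * D q) / FracField.tofrac (q ^+ 2).

Section FracDerivation.
Variable R : idomainType.
Local Notation "x %:F" := (@FracField.tofrac R x) : ring_scope.
Implicit Types f g : {fraction R}.

Lemma frac_reprE f : f = (\n_(repr f))%:F / (\d_(repr f))%:F.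
Proof.
have dn0 : (\d_(repr f))%:F != 0 by rewrite tofrac_eq0 denom_ratioP.
apply: (mulIf dn0); rewrite mulfVK //.
rewrite -{1}(reprK f); case: (repr f) => -[p q] /= q0.
rewrite !piE; apply/eqmodP; rewrite /= FracField.equivfE /= !numden_Ratio ?oner_neq0 ?mulr1 //=.
by rewrite mulrC.
Qed.

Lemma frac_eq (p q p1 q1 : R) : q != 0 -> q1 != 0 ->
  (p%:F / q%:F = p1%:F / q1%:F) <-> p * q1 = p1 * q.
Proof.
move=> q0 q10; split=> [|e].
  move/eqP; rewrite eqr_div ?tofrac_eq0 // -!tofracM tofrac_eq => /eqP //.
by apply/eqP; rewrite eqr_div ?tofrac_eq0 // -!tofracM e.
Qed.

Variable D : R -> R.
Hypothesis DD : {morph D : x y / x + y}.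
Hypothesis DM : forall x y, D (x * y) = D x * y + x * D y.
Local Notation frac_deriv := (frac_deriv D).

Lemma frac_deriv_frac p q : q != 0 ->
  frac_deriv (p%:F / q%:F) = (D p * q - p * D q)%:F / (q ^+ 2)%:F.
Proof.
move=> q0; rewrite frac_deriv.unlock; move: (frac_reprE (p%:F / q%:F)).
move: (denom_ratioP (repr (p%:F / q%:F))).
move: (\n_ _) (\d_ _) => p1 q1 q10 /(frac_eq _ _ q0 q10) e.
apply/frac_eq; rewrite ?expf_neq0 //.
have := congr1 D e; rewrite !DM => e'.
have eD : D p1 * q = D p * q1 + p * D q1 - p1 * D q by rewrite e'; ring.
transitivity ((D p1 * q) * (q1 * q) - (p1 * q) * (D q1 * q)); first by ring.
rewrite eD -e; transitivity (D p * q1 * q1 * q + p * D q1 * q1 * q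
  - (p1 * q) * D q * q1 - p * q1 * (D q1 * q)); first by ring.
by rewrite -e; ring.
Qed.

Lemma frac_deriv_to p : frac_deriv p%:F = (D p)%:F.
Proof.
have D1 : D 1 = 0.
  by apply: (addrI (D 1)); rewrite addr0 -{3}[1]mulr1 DM mulr1 mul1r.
have {1}-> : p%:F = p%:F / 1%:F by rewrite tofrac1 divr1.
rewrite frac_deriv_frac ?oner_neq0 // D1 mulr0 subr0 mulr1 expr1n tofrac1.
by rewrite divr1.
Qed.

(** The Leibniz rule applied to [f * q = p] determines the derivative of [f]; sum and product rules
    need then be checked on one presentation only. *)
Lemma frac_deriv_unique f g p q : q != 0 -> f = p%:F / q%:F ->
  g * q%:F + f * (D q)%:F = (D p)%:F -> frac_deriv f = g.
Proof.
move=> q0 -> e; have qF0 : q%:F != 0 by rewrite tofrac_eq0.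
rewrite frac_deriv_frac // tofracXn tofracB !tofracM.
exact: quotient_rule_unique.
Qed.

Lemma frac_derivM f g :
  frac_deriv (f * g) = frac_deriv f * g + f * frac_deriv g.
Proof.
rewrite (frac_reprE f) (frac_reprE g).
move: (denom_ratioP (repr f)) (denom_ratioP (repr g)).
move: (\n_ (repr f)) (\d_ (repr f)) (\n_ (repr g)) (\d_ (repr g)).
move=> p q p1 q1 q0 q10.
have qF0 : q%:F != 0 by rewrite tofrac_eq0.
have qF10 : q1%:F != 0 by rewrite tofrac_eq0.
apply: (@frac_deriv_unique _ _ (p * p1) (q * q1)); first by rewrite mulf_neq0.
  by rewrite mulf_div !tofracM.
rewrite !frac_deriv_frac // !DM !(tofracM, tofracB, tofracD, tofracXn).
exact: quotient_ruleM.
Qed.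

Lemma frac_derivD f g : frac_deriv (f + g) = frac_deriv f + frac_deriv g.
Proof.
rewrite (frac_reprE f) (frac_reprE g).
move: (denom_ratioP (repr f)) (denom_ratioP (repr g)).
move: (\n_ (repr f)) (\d_ (repr f)) (\n_ (repr g)) (\d_ (repr g)).
move=> p q p1 q1 q0 q10.
have qF0 : q%:F != 0 by rewrite tofrac_eq0.
have qF10 : q1%:F != 0 by rewrite tofrac_eq0.
apply: (@frac_deriv_unique _ _ (p * q1 + p1 * q) (q * q1)).
- by rewrite mulf_neq0.
- by rewrite addf_div // !(tofracM, tofracD).
rewrite !frac_deriv_frac // DD !DM !(tofracM, tofracB, tofracD, tofracXn).
exact: quotient_ruleD.
Qed.

End FracDerivation.

Lemma frac_deriv_comm (R : idomainType) (D E : R -> R) f :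
  {morph D : x y / x + y} -> (forall x y, D (x * y) = D x * y + x * D y) ->
  {morph E : x y / x + y} -> (forall x y, E (x * y) = E x * y + x * E y) ->
  (forall x, D (E x) = E (D x)) ->
  frac_deriv D (frac_deriv E f) = frac_deriv E (frac_deriv D f).
Proof.
move=> DD DM ED EM DE; have fM := frac_derivM; have fD := frac_derivD.
rewrite (frac_reprE f); move: (denom_ratioP (repr f)).
move: (\n_ (repr f)) (\d_ (repr f)) => p q q0.
set tf := @FracField.tofrac R; set g := tf p / tf q.
have qF0 : tf q != 0 by rewrite tofrac_eq0.
have e : g * tf q = tf p by rewrite mulfVK.
clearbody g.
have eD := congr1 (frac_deriv D) e; have eE := congr1 (frac_deriv E) e.
move: eD eE; rewrite !fM // !frac_deriv_to // => eD eE.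
have e2 := congr1 (frac_deriv E) eD; have e1 := congr1 (frac_deriv D) eE.
move: e1 e2; rewrite !fD // !fM // !frac_deriv_to // !DE.
exact: leibniz_comm_cancel.
Qed.

Section FracSubst.
Variables (R R' : idomainType) (phi : {rmorphism R -> R'}).
Local Notation "x %:F" := (@FracField.tofrac _ x) : ring_scope.
Implicit Types f g : {fraction R}.

Definition frac_subst f : {fraction R'} :=
  xget 0 [set y | exists p q : R,
    [/\ phi q != 0, f = p%:F / q%:F & y = (phi p)%:F / (phi q)%:F]].

(** A fraction all of whose denominators vanish under [phi] gets the default value 0, so
    [frac_subst] is a ring morphism only on this local ring. *)
Definition subst_dom f := exists p q, phi q != 0 /\ f = p%:F / q%:F.

(** Two presentations of a fraction are related by a cross product, which [phi] preserves; hence the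
    presentation selected by [xget] is irrelevant. *)
Lemma frac_subst_frac p q : phi q != 0 ->
  frac_subst (p%:F / q%:F) = (phi p)%:F / (phi q)%:F.
Proof.
move=> pq0; rewrite /frac_subst; case: xgetP => [y _ [p1 [q1 [pq10 e ->]]]|].
  have nz r : phi r != 0 -> r != 0 by apply: contraNneq => ->; rewrite rmorph0.
  move: e; rewrite frac_eq ?nz // => e.
  by apply/frac_eq; rewrite // -!rmorphM e.
by move/(_ ((phi p)%:F / (phi q)%:F)) => h; case: h; exists p, q.
Qed.

Lemma frac_subst_to p : frac_subst p%:F = (phi p)%:F.
Proof.
have {1}-> : p%:F = p%:F / 1%:F by rewrite tofrac1 divr1.
by rewrite frac_subst_frac rmorph1 ?oner_neq0 // (rmorph1 (@FracField.tofrac _)) divr1.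
Qed.

Lemma subst_dom_to p : subst_dom p%:F.
Proof. by exists p, 1; rewrite rmorph1 oner_neq0 tofrac1 divr1. Qed.

Lemma frac_substD f g : subst_dom f -> subst_dom g ->
  subst_dom (f + g) /\ frac_subst (f + g) = frac_subst f + frac_subst g.
Proof.
move=> [p [q [pq0 ->]]] [p1 [q1 [pq10 ->]]].
have nz r : phi r != 0 -> r%:F != 0.
  by rewrite tofrac_eq0; apply: contraNneq => ->; rewrite rmorph0.
have pqq : phi (q * q1) != 0 by rewrite rmorphM mulf_neq0.
have -> : p%:F / q%:F + p1%:F / q1%:F = (p * q1 + p1 * q)%:F / (q * q1)%:F.
  by rewrite addf_div ?nz // !(tofracM, tofracD).
split; first by exists (p * q1 + p1 * q), (q * q1).
rewrite !frac_subst_frac // addf_div ?tofrac_eq0 //.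
by rewrite !rmorphD !rmorphM.
Qed.

Lemma frac_substM f g : subst_dom f -> subst_dom g ->
  subst_dom (f * g) /\ frac_subst (f * g) = frac_subst f * frac_subst g.
Proof.
move=> [p [q [pq0 ->]]] [p1 [q1 [pq10 ->]]].
have pqq : phi (q * q1) != 0 by rewrite rmorphM mulf_neq0.
have -> : p%:F / q%:F * (p1%:F / q1%:F) = (p * p1)%:F / (q * q1)%:F.
  by rewrite mulf_div !tofracM.
split; first by exists (p * p1), (q * q1).
by rewrite !frac_subst_frac // mulf_div !rmorphM.
Qed.

Lemma frac_substV p : phi p != 0 ->
  subst_dom (p%:F)^-1 /\ frac_subst (p%:F)^-1 = ((phi p)%:F)^-1.
Proof.
move=> pp0; have -> : (p%:F)^-1 = 1%:F / p%:F by rewrite tofrac1 mul1r.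
split; first by exists 1, p.
by rewrite frac_subst_frac // rmorph1 tofrac1 mul1r.
Qed.

End FracSubst.

(** * Functions with poles along the diagonals *)

HB.lock Definition fc (F : fieldType) n (a : F) : {fraction {mpoly F[n]}} :=
  fconst n a.
HB.lock Definition zd (F : fieldType) n (i j : 'I_n) :
  {fraction {mpoly F[n]}} := zdiff F i j.
HB.lock Definition fd (F : fieldType) n (i : 'I_n)
  (f : {fraction {mpoly F[n]}}) : {fraction {mpoly F[n]}} := fderiv i f.
HB.lock Definition zs (F : fieldType) n n' (k : 'I_n -> 'I_n')
  (f : {fraction {mpoly F[n]}}) : {fraction {mpoly F[n']}} := zsubst k f.
Arguments zd {F n} i j.
Arguments fc {F} n a.

Definition mpoly_subst (F : fieldType) n n' (k : 'I_n -> 'I_n') :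
    {mpoly F[n]} -> {mpoly F[n']} :=
  mmap (@mpolyC n' F) (fun i => 'X_(k i)).
HB.instance Definition _ F n n' k :=
  GRing.RMorphism.copy (@mpoly_subst F n n' k)
    (mmap (@mpolyC n' F) (fun i => 'X_(k i))).

Section Ratf.
Variables (F : fieldType) (n : nat).
Local Notation ratf := {fraction {mpoly F[n]}}.
Local Notation zd := (@zd F n).
Local Notation fc := (@fc F n).
Local Notation fd := (@fd F n).
Implicit Types (f g : ratf) (i j k : 'I_n).

Lemma fdE i : fd i = frac_deriv (mderiv i).
Proof. by rewrite fd.unlock frac_deriv.unlock. Qed.

Lemma fdD i f g : fd i (f + g) = fd i f + fd i g.
Proof. by rewrite fdE; apply: frac_derivD; [exact: mderivD|exact: mderivM]. Qed.

Lemma fdM i f g : fd i (f * g) = fd i f * g + f * fd i g.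
Proof. by rewrite fdE; apply: frac_derivM; exact: mderivM. Qed.

Lemma fd_to i (p : {mpoly F[n]}) :
  fd i (FracField.tofrac p) = FracField.tofrac (p^`M(i)).
Proof. by rewrite fdE; apply: frac_deriv_to; exact: mderivM. Qed.

Lemma fdc i a : fd i (fc a) = 0.
Proof. by rewrite fc.unlock fd_to mderivC tofrac0. Qed.

Lemma fcD a b : fc (a + b) = fc a + fc b.
Proof. by rewrite fc.unlock /fconst mpolyCD tofracD. Qed.

Lemma fcM a b : fc (a * b) = fc a * fc b.
Proof. by rewrite fc.unlock /fconst mpolyCM tofracM. Qed.

Lemma fc1 : fc 1 = 1.
Proof. by rewrite fc.unlock /fconst tofrac1. Qed.

Lemma fc0 : fc 0 = 0.
Proof. by rewrite fc.unlock /fconst mpolyC0 tofrac0. Qed.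

Lemma fcN a : fc (- a) = - fc a.
Proof. exact: (morphDN fcD). Qed.

Lemma fd0 i : fd i 0 = 0. Proof. exact: (morphD0 (fdD i)). Qed.

Lemma fd1 i : fd i 1 = 0. Proof. by rewrite -fc1 fdc. Qed.

Lemma fdC i j f : fd i (fd j f) = fd j (fd i f).
Proof.
rewrite !fdE; apply: frac_deriv_comm.
- exact: mderivD.
- exact: mderivM.
- exact: mderivD.
- exact: mderivM.
- by move=> p; rewrite mderiv_comm.
Qed.

Lemma fd_zd l i j : fd l (zd i j) = (l == i)%:R - (l == j)%:R.
Proof.
have dX m : ('X_m : {mpoly F[n]})^`M(l) = (l == m)%:R.
  rewrite mderivX mnm1E eq_sym; case: eqP => [->|_]; last by rewrite scale0r.
  by rewrite -[X in (X - _)%MM]addm0 [(U_(m) + _)%MM]addmC addmK mpolyX0 scale1r.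
rewrite zd.unlock fd_to mderivB !dX tofracB.
by congr (_ - _); case: eqP => _; rewrite ?tofrac1 ?tofrac0.
Qed.

Lemma fdV i f : f != 0 -> fd i f^-1 = - (fd i f * f^-1 * f^-1).
Proof.
move=> f0; have : fd i (f * f^-1) = 0 by rewrite mulfV // fd1.
rewrite fdM => /(canRL (addKr _)); rewrite addr0 => e.
apply: (mulfI f0); rewrite e mulrN; congr (- _).
by rewrite [RHS]mulrC -[RHS]mulrA mulVf // mulr1.
Qed.

Lemma zd_neq0 i j : i != j -> zd i j != 0.
Proof.
move=> nij; apply/negP => /eqP e; have := congr1 (fd i) e.
rewrite fd0 fd_zd eqxx (negPf nij) subr0 => /eqP.
by rewrite oner_eq0.
Qed.

Lemma zdN i j : zd j i = - zd i j.
Proof. by rewrite zd.unlock /zdiff -tofracN opprB. Qed.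

Lemma zd_add i j k : zd i j + zd j k = zd i k.
Proof. by rewrite zd.unlock /zdiff -tofracD addrA subrK. Qed.

Lemma zdii i : zd i i = 0.
Proof. by rewrite zd.unlock /zdiff subrr tofrac0. Qed.

Local Notation pair_set := {set 'I_n * 'I_n}.

Lemma OT_c (E : pair_set) a : OT_polar E (fc a).
Proof. by rewrite fc.unlock; apply: adjoin_const. Qed.

Lemma OT_D (E : pair_set) f g : OT_polar E f -> OT_polar E g -> OT_polar E (f + g).
Proof. exact: adjoin_add. Qed.

Lemma OT_M (E : pair_set) f g : OT_polar E f -> OT_polar E g -> OT_polar E (f * g).
Proof. exact: adjoin_mul. Qed.

Lemma OT_1 (E : pair_set) : OT_polar E (1 : ratf).
Proof. by rewrite -fc1; apply: OT_c. Qed.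

Lemma OT_0 (E : pair_set) : OT_polar E (0 : ratf).
Proof. by rewrite -fc0; apply: OT_c. Qed.

Lemma OT_N (E : pair_set) f : OT_polar E f -> OT_polar E (- f).
Proof.
by move=> hf; rewrite -mulN1r -fc1 -fcN; apply: OT_M => //; apply: OT_c.
Qed.

Lemma OT_X (E : pair_set) f m : OT_polar E f -> OT_polar E (f ^+ m).
Proof.
move=> hf; elim: m => [|m IH]; first by rewrite expr0; apply: OT_1.
by rewrite exprS; apply: OT_M.
Qed.

Lemma OT_zd (E : pair_set) i j : OT_polar E (zd i j).
Proof.
have h i' j' : (i' < j')%N -> OT_polar E (zd i' j').
  by move=> lt; apply: adjoin_gen; left; exists i', j'; rewrite zd.unlock.
have [/h//|/h h'|/val_inj ->] := ltngtP i j.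
  by rewrite zdN; apply: OT_N.
by rewrite zdii; apply: OT_0.
Qed.

Lemma OT_zdV (E : pair_set) i j :
  ((i, j) \in E) || ((j, i) \in E) -> OT_polar E (zd i j)^-1.
Proof.
have h i' j' : (i', j') \in E -> OT_polar E (zd i' j')^-1.
  by move=> eE; apply: adjoin_gen; right; exists (i', j'); rewrite ?zd.unlock.
case/orP => [/h//|/h h']; by rewrite zdN invrN; apply: OT_N.
Qed.

Lemma OT_ind (E : pair_set) (P : ratf -> Prop) :
  (forall a, P (fc a)) ->
  (forall f g, OT_polar E f -> OT_polar E g -> P f -> P g -> P (f + g)) ->
  (forall f g, OT_polar E f -> OT_polar E g -> P f -> P g -> P (f * g)) ->
  (forall i j, (i < j)%N -> P (zd i j)) ->
  (forall e, e \in E -> P (zd e.1 e.2)^-1) ->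
  forall f, OT_polar E f -> P f.
Proof.
rewrite fc.unlock zd.unlock => Pc PD PM Pz PV f.
elim=> [g [[i [j [lt ->]]]|[e eE ->]]|a|g h hg Pg hh Ph|g h hg Pg hh Ph].
- exact: Pz.
- exact: PV.
- exact: Pc.
- exact: PD.
- exact: PM.
Qed.

Lemma OT_fd (E : pair_set) l f : (forall e, e \in E -> e.1 != e.2) ->
  OT_polar E f -> OT_polar E (fd l f).
Proof.
move=> En; elim/OT_ind: f / => [a|f g hf hg Pf Pg|f g hf hg Pf Pg|i j _|e eE].
- by rewrite fdc; apply: OT_0.
- by rewrite fdD; apply: OT_D.
- by rewrite fdM; apply: OT_D; apply: OT_M.
- rewrite fd_zd; apply: OT_D; last apply: OT_N;
  by case: (_ == _); [apply: OT_1|apply: OT_0].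
- have hV : OT_polar E (zd e.1 e.2)^-1 by apply: OT_zdV; rewrite -surjective_pairing eE.
  rewrite fdV; last by apply: zd_neq0; apply: En.
  apply: OT_N; apply: OT_M => //; apply: OT_M => //; rewrite fd_zd.
  by apply: OT_D; last apply: OT_N; case: (_ == _); [apply: OT_1|apply: OT_0
    |apply: OT_1|apply: OT_0].
Qed.

(** Translation invariance: the generators depend only on differences of the variables. *)
Lemma OT_fd_sum (E : pair_set) f : (forall e, e \in E -> e.1 != e.2) ->
  OT_polar E f -> \sum_(l < n) fd l f = 0.
Proof.
move=> En.
have Pz i j : \sum_(l < n) fd l (zd i j) = 0.
  under eq_bigr do rewrite fd_zd.
  have h m : \sum_(l < n) (l == m)%:R = 1 :> ratf.
    by rewrite (bigD1 m) //= eqxx big1 ?addr0 // => l /negPf ->.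
  by rewrite sumrB !h subrr.
elim/OT_ind: f / => [a|f g hf hg Pf Pg|f g hf hg Pf Pg|i j _|e eE].
- by rewrite big1 // => l _; rewrite fdc.
- by under eq_bigr do rewrite fdD; rewrite big_split /= Pf Pg addr0.
- under eq_bigr do rewrite fdM.
  by rewrite big_split -mulr_suml -mulr_sumr /= Pf Pg mul0r mulr0 addr0.
- exact: Pz.
- under eq_bigr do rewrite fdV ?zd_neq0 ?En //.
  by rewrite sumrN -!mulr_suml Pz !mul0r oppr0.
Qed.

Lemma OT_sub (E E' : pair_set) f : E \subset E' -> OT_polar E f -> OT_polar E' f.
Proof.
move=> /fintype.subsetP sE; elim/OT_ind: f / => [a|f g _ _|f g _ _|i j _|e eE].
- exact: OT_c.
- exact: OT_D.
- exact: OT_M.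
- exact: OT_zd.
- by apply: OT_zdV; rewrite -surjective_pairing sE.
Qed.

Lemma ltpairs_neq (e : 'I_n * 'I_n) : e \in ltpairs n -> e.1 != e.2.
Proof. by rewrite inE; apply: contraTneq => ->; rewrite ltnn. Qed.

Lemma OstarT_zdV i j : i != j -> OstarT (zd i j)^-1.
Proof. by move=> nij; apply: OT_zdV; rewrite !inE /= -neq_ltn. Qed.

Lemma OstarT_fd l f : OstarT f -> OstarT (fd l f).
Proof. by apply: OT_fd => e /ltpairs_neq. Qed.

End Ratf.

Section Zsubst.
Variables (F : fieldType) (n n' : nat) (k : 'I_n -> 'I_n').
Local Notation ratf n := {fraction {mpoly F[n]}}.
Local Notation zs := (@zs F n n' k).
Implicit Types (f g : ratf n).

Definition zdom f := subst_dom (@mpoly_subst F n n' k) f.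

Lemma zsE : zs = frac_subst (@mpoly_subst F n n' k).
Proof. by rewrite zs.unlock. Qed.

Lemma mpoly_substC a : mpoly_subst k a%:MP = a%:MP :> {mpoly F[n']}.
Proof. by rewrite /mpoly_subst mmapC. Qed.

Lemma mpoly_substX i : mpoly_subst k 'X_i = 'X_(k i) :> {mpoly F[n']}.
Proof. by rewrite /mpoly_subst mmapX mmap1U. Qed.

Lemma zsD f g : zdom f -> zdom g -> zs (f + g) = zs f + zs g.
Proof. by move=> hf hg; rewrite zsE; case: (frac_substD hf hg). Qed.

Lemma zsM f g : zdom f -> zdom g -> zs (f * g) = zs f * zs g.
Proof. by move=> hf hg; rewrite zsE; case: (frac_substM hf hg). Qed.

Lemma zdomD f g : zdom f -> zdom g -> zdom (f + g).
Proof. by move=> hf hg; case: (frac_substD hf hg). Qed.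

Lemma zdomM f g : zdom f -> zdom g -> zdom (f * g).
Proof. by move=> hf hg; case: (frac_substM hf hg). Qed.

Lemma zs_c a : zs (fc n a) = fc n' a.
Proof. by rewrite fc.unlock zsE /fconst frac_subst_to /= mpoly_substC. Qed.

Lemma zdom_c a : zdom (fc n a).
Proof. by rewrite fc.unlock; apply: subst_dom_to. Qed.

Lemma zs_zd i j : zs (zd i j) = zd (k i) (k j).
Proof.
by rewrite zd.unlock zsE /zdiff frac_subst_to rmorphB /= !mpoly_substX.
Qed.

Lemma zdom_zd i j : zdom (zd i j).
Proof. by rewrite zd.unlock; apply: subst_dom_to. Qed.

Lemma zs_zdV i j : k i != k j ->
  zdom (zd i j)^-1 /\ zs (zd i j)^-1 = (zd (k i) (k j))^-1.
Proof.
move=> nk; have := zd_neq0 F nk; rewrite zd.unlock /zdiff tofrac_eq0 => nz.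
have nz' : mpoly_subst k ('X_i - 'X_j) != 0 :> {mpoly F[n']}.
  by rewrite rmorphB /= !mpoly_substX.
have [h1 h2] := frac_substV nz'; split=> //.
by rewrite zsE h2 rmorphB /= !mpoly_substX.
Qed.

Lemma zs0 : zs 0 = 0. Proof. by rewrite -(fc0 F n) zs_c fc0. Qed.
Lemma zs1 : zs 1 = 1. Proof. by rewrite -(fc1 F n) zs_c fc1. Qed.
Lemma zdom1 : zdom 1. Proof. by rewrite -(fc1 F n); apply: zdom_c. Qed.

Lemma zdom0 : zdom 0. Proof. by rewrite -(fc0 F n); apply: zdom_c. Qed.

Lemma zsN f : zdom f -> zs (- f) = - zs f.
Proof.
move=> hf; rewrite -mulN1r -fc1 -fcN zsM //; last exact: zdom_c.
by rewrite zs_c fcN fc1 mulN1r.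
Qed.

Lemma zdomX f m : zdom f -> zdom (f ^+ m).
Proof.
move=> hf; elim: m => [|m IH]; first by rewrite expr0; apply: zdom1.
by rewrite exprS; apply: zdomM.
Qed.

Lemma zsX f m : zdom f -> zs (f ^+ m) = zs f ^+ m.
Proof.
move=> hf; elim: m => [|m IH]; first by rewrite !expr0 zs1.
by rewrite !exprS zsM ?IH //; apply: zdomX.
Qed.

Variable E : {set 'I_n * 'I_n}.
Hypothesis kE : forall e, e \in E -> k e.1 != k e.2.

Let kE' e : e \in E -> e.1 != e.2.
Proof. by move/kE; apply: contra_neq => ->. Qed.

Lemma OT_zdom f : OT_polar E f -> zdom f.
Proof.
elim/OT_ind: f / => [a|f g _ _|f g _ _|i j _|e /kE eE].
- exact: zdom_c.
- exact: zdomD.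
- exact: zdomM.
- exact: zdom_zd.
- by case: (zs_zdV eE).
Qed.

Lemma OT_zs f (E' : {set 'I_n' * 'I_n'}) :
  (forall e, e \in E -> ((k e.1, k e.2) \in E') || ((k e.2, k e.1) \in E')) ->
  OT_polar E f -> OT_polar E' (zs f).
Proof.
move=> sE; elim/OT_ind: f / => [a|f g hf hg Pf Pg|f g hf hg Pf Pg|i j _|e eE].
- by rewrite zs_c; apply: OT_c.
- by rewrite zsD; [apply: OT_D|exact: OT_zdom..].
- by rewrite zsM; [apply: OT_M|exact: OT_zdom..].
- by rewrite zs_zd; apply: OT_zd.
- case: (zs_zdV (kE eE)) => _ ->; apply: OT_zdV; exact: sE.
Qed.

Lemma OstarT_zs f : OT_polar E f -> OstarT (zs f).
Proof.
apply: OT_zs => e /kE; rewrite !inE /=.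
by rewrite -neq_ltn.
Qed.

(** Chain rule: z_j has been put in place of every z_i with [k i = j]. *)
Lemma fd_zs j f : OT_polar E f -> fd j (zs f) = \sum_(i | k i == j) zs (fd i f).
Proof.
have b0 (b : bool) : zdom (b%:R) 
  by case: b; rewrite ?mulr1n ?mulr0n; [exact: zdom1|exact: zdom0].
have zb (b : bool) : zs (b%:R) = b%:R 
  by case: b; rewrite ?mulr1n ?mulr0n ?zs1 ?zs0.
have zdB (i i1 i2 : 'I_n) : zdom (- (i == i2)%:R) /\ zs ((i == i1)%:R - (i == i2)%:R)
    = (i == i1)%:R - (i == i2)%:R :> ratf n' .
  have dN : zdom (- (i == i2)%:R).
    by rewrite -mulN1r; apply: zdomM => //; rewrite -fc1 -fcN; apply: zdom_c.
  split=> //; rewrite zsD; [|exact: b0|exact: dN].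
  by rewrite zsN; [rewrite !zb|exact: b0].
have key i1 i2 : fd j (zd (k i1) (k i2))
    = \sum_(i | k i == j) zs (fd i (zd i1 i2)).
  rewrite fd_zd; under eq_bigr do rewrite fd_zd (proj2 (zdB _ _ _)).
  have h (m : 'I_n) : \sum_(i | k i == j) (i == m)%:R = (j == k m)%:R :> ratf n'.
    have [e|ne] := eqVneq j (k m).
      rewrite (bigD1 m) ?e //= eqxx big1 ?addr0 // => i /andP[_ /negPf ->] //.
    rewrite big1 // => i /eqP ki; case: eqP => // im.
    by rewrite -ki im eqxx in ne.
  by rewrite sumrB !h.
have OTd g i : OT_polar E g -> zdom (fd i g) by move=> hg; apply/OT_zdom/OT_fd.
elim/OT_ind: f / => [a|f g hf hg Pf Pg|f g hf hg Pf Pg|i1 i2 _|e eE].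
- by rewrite zs_c fdc big1 // => i _; rewrite fdc zs0.
- rewrite zsD; [|exact: OT_zdom..].
  rewrite fdD Pf Pg -big_split; apply: eq_bigr => i _ /=.
  by rewrite fdD zsD //; apply: OTd.
- have [df dg] := (OT_zdom hf, OT_zdom hg).
  rewrite zsM // fdM Pf Pg mulr_suml mulr_sumr -big_split.
  apply: eq_bigr => i _ /=; have [ddf ddg] := (OTd _ i hf, OTd _ i hg).
  by rewrite fdM zsD; [rewrite !zsM|exact: zdomM..].
- by rewrite zs_zd key.
- have [dV zV] := zs_zdV (kE eE); rewrite zV fdV ?zd_neq0 ?kE // key.
  rewrite !mulr_suml -sumrN; apply: eq_bigr => i _; rewrite fdV ?zd_neq0 ?kE' //.
  have d1 : zdom (fd i (zd e.1 e.2)).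
    by rewrite fd_zd; apply: zdomD; [exact: b0|case: (zdB i e.1 e.2)].
  have d2 := zdomM d1 dV; have d3 := zdomM d2 dV.
  by rewrite (zsN d3) (zsM d2 dV) (zsM d1 dV) zV.
Qed.

End Zsubst.

Section PermSubst.
Variable F : fieldType.

Lemma mpoly_subst_comp n n1 n2 (k : 'I_n -> 'I_n1) (l : 'I_n1 -> 'I_n2)
    (p : {mpoly F[n]}) :
  mpoly_subst l (mpoly_subst k p) = mpoly_subst (l \o k) p.
Proof.
elim/mpolyind: p => [|c m p _ _ IH]; first by rewrite !rmorph0.
rewrite !rmorphD /= IH; congr (_ + _).
rewrite -mul_mpolyC !rmorphM /= !mpoly_substC; congr (_ * _).
rewrite /mpoly_subst !mmapX /mmap1 -/(mpoly_subst l _) rmorph_prod.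
by apply: eq_bigr => i _; rewrite rmorphXn /= mpoly_substX.
Qed.

Lemma mpoly_subst_id n (k : 'I_n -> 'I_n) (p : {mpoly F[n]}) :
  k =1 id -> mpoly_subst k p = p.
Proof.
move=> kid; elim/mpolyind: p => [|c m p _ _ IH]; first by rewrite !rmorph0.
rewrite !rmorphD /= IH; congr (_ + _).
rewrite -mul_mpolyC rmorphM /= mpoly_substC; congr (_ * _).
rewrite /mpoly_subst mmapX (mpolyXE _ 1%g); apply: eq_bigr => i _.
by rewrite kid perm1.
Qed.

(** The renaming [l] recovers [p], so an injective renaming of variables never kills a
    denominator. *)
Lemma mpoly_subst_neq0 n n1 (k : 'I_n -> 'I_n1) (l : 'I_n1 -> 'I_n)
    (p : {mpoly F[n]}) : cancel k l -> p != 0 -> mpoly_subst k p != 0.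
Proof.
move=> kK; apply: contra_neq => e.
by rewrite -(mpoly_subst_id p kK) -(mpoly_subst_comp k l) e rmorph0.
Qed.

Lemma zdom_can n n1 (k : 'I_n -> 'I_n1) (l : 'I_n1 -> 'I_n) (f : {fraction {mpoly F[n]}}) :
  cancel k l -> zdom k f.
Proof.
move=> kK; exists (\n_(repr f)), (\d_(repr f)); split; last exact: frac_reprE.
by apply: (mpoly_subst_neq0 kK); apply: denom_ratioP.
Qed.

Lemma zs_frac n n1 (k : 'I_n -> 'I_n1) (p q : {mpoly F[n]}) :
  mpoly_subst k q != 0 ->
  zs k (FracField.tofrac p / FracField.tofrac q)
    = FracField.tofrac (mpoly_subst k p) / FracField.tofrac (mpoly_subst k q).
Proof. by move=> q0; rewrite zsE; apply: frac_subst_frac. Qed.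

Lemma zs_perm_comp n (s t : 'S_n) (f : {fraction {mpoly F[n]}}) :
  zs t (zs s f) = zs (s * t)%g f.
Proof.
rewrite (frac_reprE f); move: (denom_ratioP (repr f)).
move: (\n_ _) (\d_ _) => p q q0.
have nz (u : 'S_n) r : r != 0 -> mpoly_subst u r != 0 :> {mpoly F[n]}.
  exact: (mpoly_subst_neq0 (permK u)).
have q1 := nz s q q0; have q2 := nz t _ q1.
have q3 := nz (s * t)%g q q0.
rewrite (zs_frac p q1) (zs_frac _ q2) (zs_frac p q3).
rewrite !mpoly_subst_comp (_ : t \o s = (s * t)%g) //.
by apply: funext => i /=; rewrite permM.
Qed.

Lemma zs_id n (f : {fraction {mpoly F[n]}}) (k : 'I_n -> 'I_n) :
  k =1 id -> zs k f = f.
Proof.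
move=> kid; rewrite (frac_reprE f); move: (denom_ratioP (repr f)).
move: (\n_ _) (\d_ _) => p q q0.
have q1 : mpoly_subst k q != 0 by rewrite mpoly_subst_id.
by rewrite (zs_frac p q1) !mpoly_subst_id.
Qed.

Lemma zs_permK n (s : 'S_n) (f : {fraction {mpoly F[n]}}) :
  zs (s^-1)%g (zs s f) = f.
Proof. by rewrite zs_perm_comp mulgV zs_id // => i; rewrite perm1. Qed.

Lemma zdom_perm n (s : 'S_n) (f : {fraction {mpoly F[n]}}) : zdom s f.
Proof. exact: (zdom_can f (permK s)). Qed.

Lemma OstarT_perm n (s : 'S_n) (f : {fraction {mpoly F[n]}}) :
  OstarT (zs s f) <-> OstarT f.
Proof.
have h (t : 'S_n) (g : {fraction {mpoly F[n]}}) : OstarT g -> OstarT (zs t g).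
  by apply: OstarT_zs => e /ltpairs_neq; rewrite (inj_eq perm_inj).
by split=> [/(h (s^-1)%g)|/h//]; rewrite zs_permK.
Qed.

Lemma fd_perm n (s : 'S_n) i (f : {fraction {mpoly F[n]}}) :
  OstarT f -> fd (s i) (zs s f) = zs s (fd i f).
Proof.
move=> hf; rewrite (fd_zs _ _ hf) => [|e /ltpairs_neq]; last first.
  by rewrite (inj_eq perm_inj).
by rewrite (big_pred1 i) // => j; rewrite (inj_eq perm_inj).
Qed.

End PermSubst.

(** * Two variables: Laurent polynomials in z_2 - z_1 *)

Section Laurent.
Variable F : fieldType.
Local Notation K := {fraction {mpoly F[2]}}.
Local Notation z := (@zd F 2 ord_max ord0).

Fact fc_zmod n : zmod_morphism (@fc F n).
Proof. by move=> a b; rewrite fcD fcN. Qed.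
Fact fc_monoid n : monoid_morphism (@fc F n).
Proof. by split; [apply: fc1|move=> a b; apply: fcM]. Qed.
HB.instance Definition _ n := GRing.isZmodMorphism.Build F {fraction {mpoly F[n]}}
  (@fc F n) (fc_zmod n).
HB.instance Definition _ n := GRing.isMonoidMorphism.Build F
  {fraction {mpoly F[n]}} (@fc F n) (fc_monoid n).

(** One-variable polynomials evaluated at z = z_2 - z_1; over powers of z they exhaust the functions
    of two variables, with a presentation unique up to common factors by [pz_inj]. *)
Definition pz (p : {poly F}) : K := (map_poly (fc 2) p).[z].

Fact pz_zmod : zmod_morphism pz.
Proof. by move=> p q; rewrite /pz rmorphB hornerD hornerN. Qed.
Fact pz_monoid : monoid_morphism pz.
Proof.
by split=> [|p q]; rewrite /pz ?rmorph1 ?hornerC // rmorphM hornerM.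
Qed.
HB.instance Definition _ := GRing.isZmodMorphism.Build {poly F} K pz pz_zmod.
HB.instance Definition _ := GRing.isMonoidMorphism.Build {poly F} K pz pz_monoid.

Lemma pzD p q : pz (p + q) = pz p + pz q. Proof. exact: raddfD. Qed.
Lemma pzN p : pz (- p) = - pz p. Proof. exact: raddfN. Qed.
Lemma pzM p q : pz (p * q) = pz p * pz q. Proof. exact: rmorphM. Qed.
Lemma pzXn p n : pz (p ^+ n) = pz p ^+ n. Proof. exact: rmorphXn. Qed.
Lemma pz0 : pz 0 = 0. Proof. exact: rmorph0. Qed.
Lemma pz1 : pz 1 = 1. Proof. exact: rmorph1. Qed.

Lemma pzC a : pz a%:P = fc 2 a.
Proof. by rewrite /pz map_polyC hornerC. Qed.

Lemma pzX : pz 'X = z.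
Proof. by rewrite /pz map_polyX hornerX. Qed.

Lemma pz_inj : injective pz.
Proof.
apply: raddf_inj => p p0.
(* The specialization z_1 = 0, z_2 = X sends p(z_2 - z_1) back to p. *)
pose h (i : 'I_2) : {poly F} := if i == ord0 then 0 else 'X.
pose rho : {rmorphism {mpoly F[2]} -> {poly F}} := mmap polyC h.
pose P : {mpoly F[2]} :=
  (map_poly (@mpolyC 2 F) p).['X_(ord_max : 'I_2) - 'X_(ord0 : 'I_2)].
have pP : pz p = FracField.tofrac P.
  rewrite /pz /P zd.unlock fc.unlock -horner_map /= -map_poly_comp //.
have P0 : P = 0 by apply/eqP; rewrite -tofrac_eq0 -pP p0.
have := rmorph0 rho; rewrite -P0 /P -horner_map /= -map_poly_comp.
have -> : map_poly (rho \o @mpolyC 2 F) p = map_poly polyC p.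
  by apply: eq_map_poly => a /=; rewrite mmapC.
by rewrite mmapB !mmapX !mmap1U /h /= subr0 -[_.['X]]/(p \Po 'X) comp_polyXr.
Qed.

Lemma z_neq0 : z != 0. Proof. exact: zd_neq0. Qed.

Lemma ord2_eq (i : 'I_2) : i = ord0 \/ i = ord_max.
Proof. by case: i => -[|[|i]] //= h; [left|right]; apply: val_inj. Qed.

Lemma zd2 (i j : 'I_2) : i != j -> zd i j = z \/ zd i j = - z.
Proof.
case: (ord2_eq i) (ord2_eq j) => -> [] -> // _; first by right; rewrite zdN.
by left.
Qed.

Lemma OstarT2P f : OstarT f <-> exists N p, f = pz p / z ^+ N.
Proof.
split=> [|[N [p ->]]]; last first.
  apply: OT_M; last by rewrite -exprVn; apply/OT_X/OstarT_zdV.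
  rewrite /pz horner_coef; elim/big_rec: _ => [|i g _ hg]; first exact: OT_0.
  apply: OT_D hg; apply: OT_M; last exact/OT_X/OT_zd.
  by rewrite coef_map; apply: OT_c.
have zn := z_neq0; have zXn N : z ^+ N != 0 by rewrite expf_neq0.
elim/OT_ind => [a|g h _ _ [N [p ->]] [M [q ->]]|g h _ _ [N [p ->]] [M [q ->]]|i j lt|e].
- by exists 0%N, a%:P; rewrite pzC expr0 divr1.
- exists (N + M)%N, (p * 'X^M + q * 'X^N).
  by rewrite addf_div; [rewrite pzD !pzM !pzXn pzX exprD|exact: zXn..].
- by exists (N + M)%N, (p * q); rewrite mulf_div pzM exprD.
- exists 0%N; have /zd2[->|->] : i != j by rewrite neq_ltn lt.
    by exists 'X; rewrite pzX divr1.
  by exists (- 'X); rewrite pzN pzX divr1.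
- move/ltpairs_neq => /zd2[->|->]; exists 1%N.
    by exists 1; rewrite pz1 mul1r.
  by exists (- 1); rewrite pzN pz1 mulN1r invrN.
Qed.

Lemma fd_pz (i : 'I_2) p :
  fd i (pz p) = (if i == ord0 then - pz p^`() else pz p^`()).
Proof.
elim/poly_ind: p => [|p c IH].
  by rewrite pz0 fd0 deriv0 pz0 oppr0; case: ifP.
have e : pz p^`() * z + pz p = pz (p * 'X + c%:P)^`().
  by rewrite derivD derivM derivX derivC addr0 mulr1 pzD pzM pzX.
rewrite pzD pzM pzX pzC fdD fdM fdc addr0 IH fd_zd -e.
case: (ord2_eq i) => ->; rewrite /= ?mulr0n ?mulr1n ?sub0r ?subr0.
  by rewrite mulNr mulrN1 opprD.
by rewrite mulr1.
Qed.

End Laurent.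

(** * Three variables: a common denominator *)

Section Polar3.
Variable F : fieldType.
Local Notation K := {fraction {mpoly F[3]}}.
Definition o0 : 'I_3 := @Ordinal 3 0 isT.
Definition o1 : 'I_3 := @Ordinal 3 1 isT.
Definition o2 : 'I_3 := @Ordinal 3 2 isT.

Lemma ord3P (i : 'I_3) : [\/ i = o0, i = o1 | i = o2].
Proof.
case: i => -[|[|[|i]]] //= h; [apply: Or31|apply: Or32|apply: Or33];
  exact: val_inj.
Qed.

Definition zall : K := zd o0 o1 * zd o0 o2 * zd o1 o2.

Lemma zall_neq0 : zall != 0.
Proof. by rewrite !mulf_neq0 // zd_neq0. Qed.

Lemma OstarT3P (f : K) : OstarT f ->
  exists N p, OT_polar finset.set0 p /\ f = p / zall ^+ N.
Proof.
have zn N : zall ^+ N != 0 by rewrite expf_neq0 // zall_neq0.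
have hall : OT_polar finset.set0 zall by do !apply: OT_M; apply: OT_zd.
elim/OT_ind => [a|g h _ _ [N [p [hp ->]]] [M [q [hq ->]]]
  |g h _ _ [N [p [hp ->]]] [M [q [hq ->]]]|i j lt|[i j]].
- by exists 0%N, (fc 3 a); split; [apply: OT_c|rewrite expr0 divr1].
- exists (N + M)%N, (p * zall ^+ M + q * zall ^+ N); split.
    by apply: OT_D; apply: OT_M => //; apply: OT_X.
  by rewrite addf_div; [rewrite exprD|exact: zn..].
- exists (N + M)%N, (p * q); split; first exact: OT_M.
  by rewrite mulf_div exprD.
- by exists 0%N, (zd i j); split; [apply: OT_zd|rewrite expr0 divr1].
- rewrite inE /= => lt; exists 1%N.
  have nz (a b : 'I_3) : a != b -> zd a b != 0 :> K by apply: zd_neq0.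
  (* The inverse of one factor of [zall] is the product of the two others divided by [zall]. *)
  have key p : OT_polar finset.set0 p -> p * zd i j = zall -> exists p,
      OT_polar finset.set0 p /\ (zd i j)^-1 = p / zall ^+ 1.
    move=> hp e; exists p; split=> //; rewrite expr1 -e -[LHS]mul1r.
    have zij : zd i j != 0 :> K by rewrite nz // neq_ltn lt.
    have p0 : p != 0.
      by apply: contraTneq zall_neq0 => p0; rewrite -e p0 mul0r eqxx.
    by rewrite invfM mulrA mulfV.
  move: lt key; case: (ord3P i) => ->; case: (ord3P j) => -> // _ key.
  + apply: (key (zd o0 o2 * zd o1 o2)); first by apply: OT_M; apply: OT_zd.
    by rewrite /zall -mulrA mulrC.
  + apply: (key (zd o0 o1 * zd o1 o2)); first by apply: OT_M; apply: OT_zd.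
    by rewrite /zall mulrAC.
  + by apply: (key (zd o0 o1 * zd o0 o2)); first by apply: OT_M; apply: OT_zd.
Qed.

End Polar3.

(** * Signs and permutations of chiral operations *)

Section Superspace.
Variables (F : fieldType) (U : lmodType F) (gr : superspace U).

Lemma pr_par b b' u : hom_par gr b u -> pr gr b' u = if b' == b then u else 0.
Proof.
move=> hu; case: eqP => [->//|/eqP nb]; rewrite -hu.
have -> : b' = ~~ b by case: b b' nb {hu} => [] [].
by have := pr_orth gr (~~ b) u; rewrite negbK.
Qed.

Lemma hom_pr b u : hom_par gr b (pr gr b u).
Proof. exact: pr_id. Qed.

Lemma prE u : u = pr gr false u + pr gr true u.
Proof. by rewrite pr_sum. Qed.

Lemma even_endo_pr (d : {linear U -> U}) : even_endo gr d ->
  forall b u, pr gr b (d u) = d (pr gr b u).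
Proof.
move=> ev b u; rewrite {1}(prE u) !raddfD /=.
by rewrite !(pr_par _ (ev _ _ (hom_pr _ _))); case: b; rewrite ?add0r ?addr0.
Qed.

End Superspace.

Section Koszul.
Variables (F : fieldType) (n : nat).
Implicit Types (s t : 'S_n) (c : 'I_n -> bool).

(** A pair is inverted by [t * s] when exactly one of [t], and [s] on the image of the pair, inverts
    it; a pair inverted twice contributes the square of a sign. *)
Lemma koszul_comp s t c :
  koszul F (t * s)%g c = koszul F t c * koszul F s (fun j => c (t^-1%g j)).
Proof.
pose w (e : 'I_n * 'I_n) : F := (-1) ^+ (c e.1 && c e.2).
pose inv s (e : 'I_n * 'I_n) := (e.1 < e.2)%N (+) (s e.1 < s e.2)%N.
pose W (b : bool) e := if b then w e else 1.
have ltN (a b : 'I_n) : a != b -> (b < a)%N = ~~ (a < b)%N.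
  by move=> ne; case: ltngtP ne => // /val_inj ->; rewrite eqxx.
have inv_sym (r : 'S_n) e : e.1 != e.2 -> inv r (e.2, e.1) = inv r e.
  rewrite /inv /= => ne; have nr : r e.1 != r e.2 by rewrite (inj_eq perm_inj).
  by rewrite (ltN _ _ ne) (ltN _ _ nr); case: (_ < _)%N; case: (_ < _)%N.
have kE r : koszul F r c = \prod_(e : 'I_n * 'I_n | (e.1 < e.2)%N) W (inv r e) e.
  rewrite /koszul big_mkcondr; apply: eq_bigr => e lt; rewrite /inv lt /=.
  have nr : r e.1 != r e.2 by rewrite (inj_eq perm_inj) neq_ltn lt.
  by rewrite (ltN _ _ nr); case: (_ < _)%N.
have -> : koszul F s (fun j => c (t^-1%g j))
    = \prod_(e : 'I_n * 'I_n | (t e.1 < t e.2)%N) W (inv s (t e.1, t e.2)) e.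
  have tI : injective (fun e : 'I_n * 'I_n => (t e.1, t e.2)).
    by move=> [a b] [a' b'] [/perm_inj -> /perm_inj ->].
  rewrite /koszul (reindex_inj tI) big_mkcondr; apply: eq_bigr => e /= lt.
  rewrite /inv lt /= /W /w !permK.
  have nr : s (t e.1) != s (t e.2) by rewrite (inj_eq perm_inj) neq_ltn lt.
  by rewrite (ltN _ _ nr); case: (_ < _)%N.
(* The indicator of inversion and the sign are symmetric in the two entries, so pairs put in
   increasing order by [t] may be replaced by increasing pairs. *)
have -> : \prod_(e : 'I_n * 'I_n | (t e.1 < t e.2)%N) W (inv s (t e.1, t e.2)) e
    = \prod_(e : 'I_n * 'I_n | (e.1 < e.2)%N) W (inv s (t e.1, t e.2)) e.
  rewrite (bigID (fun e : 'I_n * 'I_n => e.1 < e.2)%N).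
  rewrite [RHS](bigID (fun e : 'I_n * 'I_n => t e.1 < t e.2)%N).
  congr (_ * _); first by apply: eq_bigl => e; rewrite andbC.
  have swI : injective (fun e : 'I_n * 'I_n => (e.2, e.1)).
    by move=> [a b] [a' b'] [-> ->].
  rewrite (reindex_inj swI) /=.
  apply: eq_big => [e|e /andP[lt _]].
    have [->|ne] := eqVneq e.1 e.2; first by rewrite !ltnn.
    have nt : t e.1 != t e.2 by rewrite (inj_eq perm_inj).
    by rewrite (ltN _ _ ne) (ltN _ _ nt); case: (_ < _)%N; case: (_ < _)%N.
  rewrite (inv_sym s (t e.1, t e.2)) /= ?neq_ltn ?lt ?orbT //.
  by rewrite /W /w /= andbC.
rewrite !kE -big_split; apply: eq_bigr => e _ /=.
have -> : inv (t * s)%g e = inv t e (+) inv s (t e.1, t e.2).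
  by rewrite /inv /= !permM addbA addbK.
rewrite /W /w; case: (inv t e); case: (inv s _); rewrite /= ?mulr1 ?mul1r //.
by rewrite -expr2 -exprM mulnC exprM sqrrN !expr1n.
Qed.

Lemma koszul1 c : koszul F 1%g c = 1.
Proof.
rewrite /koszul big_pred0 // => e; rewrite !perm1; case: ltngtP => //.
Qed.

Lemma eq_koszul s c c' : c =1 c' -> koszul F s c = koszul F s c'.
Proof. by move=> e; apply: eq_bigr => x _; rewrite !e. Qed.

End Koszul.

Section ChiralFacts.
Variables (F : fieldType) (U : lmodType F) (d : {linear U -> U}) (n : nat).
Local Notation ratf := {fraction {mpoly F[n]}}.
Implicit Types (X : chmap d n) (v : {ffun 'I_n -> U}) (f g : ratf).

Lemma updE v i x j : upd v i x j = if j == i then x else v j.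
Proof. by rewrite ffunE. Qed.

Lemma upd_id v i : upd v i (v i) = v.
Proof. by apply/ffunP => j; rewrite updE; case: eqP => [->|]. Qed.

Definition multilinear (X : chmap d n) f := forall v i a x y,
  X (upd v i (a *: x + y)) f = a *: X (upd v i x) f + X (upd v i y) f.

Lemma mlin0 X f v i : multilinear X f -> v i = 0 -> X v f = 0.
Proof.
move=> ml vi0; have := ml v i (-1) 0 0.
by rewrite scaler0 addr0 -vi0 upd_id scaleN1r addNr.
Qed.

Lemma mlinD X f v i x y : multilinear X f ->
  X (upd v i (x + y)) f = X (upd v i x) f + X (upd v i y) f.
Proof. by move=> ml; have := ml v i 1 x y; rewrite !scale1r. Qed.

Lemma mlinZ X f v i a x : multilinear X f ->
  X (upd v i (a *: x)) f = a *: X (upd v i x) f.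
Proof.
move=> ml; have := ml v i a x 0; rewrite addr0 => ->.
by rewrite (mlin0 (v := upd v i 0) (i := i)) ?addr0 // updE eqxx.
Qed.

(** Signs are explicit on homogeneous vectors only; this transfers identities proved there to all
    vectors. *)
Lemma mlin_hom_ext (gr : superspace U) X Y f : multilinear X f -> multilinear Y f ->
  (forall c v, (forall i, hom_par gr (c i) (v i)) -> X v f = Y v f) ->
  forall v, X v f = Y v f.
Proof.
move=> mX mY XY v.
(* Only the slots before [k] may be inhomogeneous; each induction step splits slot [k] into its even
   and odd parts. *)
suff h k : forall v, (forall i : 'I_n, (k <= i)%N -> exists b, hom_par gr b (v i)) ->
    X v f = Y v f.
  by apply: (h n) => i; rewrite leqNgt ltn_ord.
elim: k => [|k IH] {}v hv.
  have /fin_all_exists[c hc] : forall i : 'I_n, exists b, hom_par gr b (v i).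
    by move=> i; apply: hv.
  exact: (XY c).
have [kn|kn] := ltnP k n; last first.
  by apply: IH => i ki; have := ltn_ord i; rewrite ltnNge (leq_trans kn ki).
pose i := Ordinal kn; rewrite -(upd_id v i) [v i](prE gr).
rewrite (mlinD v i _ _ mX) (mlinD v i _ _ mY); congr (_ + _);
  apply: IH => j kj; rewrite updE; case: eqP => [_|/eqP nji];
  by [exists false; apply: hom_pr|exists true; apply: hom_pr
     |apply: hv; rewrite ltn_neqAle kj andbT eq_sym].
Qed.

Section Sealed.
Variable X : chmap d n.
Hypothesis cX : is_chiral X.

Lemma ch_mlin f : multilinear X f.
Proof. by move=> v i a x y; apply: (chiral_linv cX). Qed.

Lemma ch_lin v a f g : OstarT f -> OstarT g ->
  X v (fc n a * f + g) = a *: X v f + X v g.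
Proof. by rewrite fc.unlock; apply: (chiral_linf cX). Qed.

Lemma ch_out v f : ~ OstarT f -> X v f = 0.
Proof. exact: (chiral_out cX). Qed.

Lemma ch_d v i f : OstarT f ->
  X (upd v i (d (v i))) f + sqmul i (X v f) = X v (fd i f).
Proof. by rewrite fd.unlock sqmul.unlock; apply: (chiral_d cX). Qed.

Lemma ch_z v i j f : OstarT f -> X v (zd i j * f) = sqderivB j i (X v f).
Proof. by rewrite zd.unlock sqderivB.unlock; apply: (chiral_z cX). Qed.

Lemma ch_fD v f g : OstarT f -> OstarT g -> X v (f + g) = X v f + X v g.
Proof.
by move=> hf hg; rewrite -[f]mul1r -fc1 ch_lin // scale1r fc1 mul1r.
Qed.

Lemma ch_f0 v : X v 0 = 0.
Proof.
have h := OT_0 F (ltpairs n); apply: (addrI (X v 0)).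
by rewrite -ch_fD // !addr0.
Qed.

Lemma ch_fZ v a f : OstarT f -> X v (fc n a * f) = a *: X v f.
Proof.
move=> hf; rewrite -[fc n a * f]addr0 ch_lin ?ch_f0 ?addr0 //; exact: OT_0.
Qed.

Lemma ch_fN v f : OstarT f -> X v (- f) = - X v f.
Proof. by move=> hf; rewrite -mulN1r -fc1 -fcN ch_fZ // scaleN1r. Qed.

End Sealed.

Lemma is_chiralI X : (forall f, multilinear X f) ->
  (forall v a f g, OstarT f -> OstarT g ->
    X v (fc n a * f + g) = a *: X v f + X v g) ->
  (forall v f, ~ OstarT f -> X v f = 0) ->
  (forall v i f, OstarT f ->
    X (upd v i (d (v i))) f + sqmul i (X v f) = X v (fd i f)) ->
  (forall v i j f, OstarT f -> X v (zd i j * f) = sqderivB j i (X v f)) ->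
  is_chiral X.
Proof.
rewrite fc.unlock fd.unlock zd.unlock sqmul.unlock sqderivB.unlock.
move=> h1 h2 h3 h4 h5; split=> // v i a x y f; exact: h1.
Qed.

End ChiralFacts.

Section Action.
Variables (F : fieldType) (U : lmodType F) (d : {linear U -> U}).
Variables (gr : superspace U) (d_even : even_endo gr d) (n : nat).
Local Notation ratf := {fraction {mpoly F[n]}}.
Implicit Types (X : chmap d n) (v : {ffun 'I_n -> U}) (f g : ratf) (s t : 'S_n).

Definition vperm s v : {ffun 'I_n -> U} := [ffun j => v ((s^-1)%g j)].
Definition vproj (c : {ffun 'I_n -> bool}) v : {ffun 'I_n -> U} :=
  [ffun j => pr gr (c j) (v j)].

Lemma ch_actE s X v f : ch_act gr s X v f =
  \sum_(c : {ffun 'I_n -> bool})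
    koszul F s c *: sqperm (s^-1)%g (X (vperm s (vproj c v)) (zs s f)).
Proof.
rewrite sqperm.unlock zs.unlock; apply: eq_bigr => c _.
congr (_ *: qperm _ (X _ _)); apply/ffunP => j; by rewrite !ffunE.
Qed.

Lemma vperm_proj_upd s c v i x :
  vperm s (vproj c (upd v i x)) = upd (vperm s (vproj c v)) (s i) (pr gr (c i) x).
Proof.
apply/ffunP => j; rewrite !ffunE (canF_eq (permKV s)).
by case: eqP => // ->; rewrite permK.
Qed.

Lemma act_mlin s X : (forall f, multilinear X f) ->
  forall f, multilinear (ch_act gr s X) f.
Proof.
move=> mX f v i a x y; rewrite !ch_actE scaler_sumr -big_split.
apply: eq_bigr => c _ /=; rewrite !vperm_proj_upd linearP mX.
rewrite qpermD ?qpermZ; do ?exact: perm_inj.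
by rewrite scalerDr !scalerA mulrC.
Qed.

(** In the sum over parity vectors only that of [v] survives: any other one projects some entry of
    [v] to 0. *)
Lemma act_hom s X (c : 'I_n -> bool) v f : (forall f, multilinear X f) ->
  (forall i, hom_par gr (c i) (v i)) ->
  ch_act gr s X v f =
    koszul F s c *: sqperm (s^-1)%g (X (vperm s v) (zs s f)).
Proof.
move=> mX hv; rewrite ch_actE (bigD1 (finfun c)) //= big1 ?addr0.
  rewrite (eq_koszul _ _ (ffunE c)); congr (_ *: sqperm _ (X _ _)).
  by apply/ffunP => j; rewrite !ffunE hv.
move=> c' nc; have [i ni] : exists i, c' i != c i.
  apply: contrapT => h; move/eqP: nc; apply; apply/ffunP => i; rewrite ffunE.
  by apply/eqP; apply: contrapT => /negP ni; apply: h; exists i.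
rewrite (mlin0 (i := s i) (mX _)); last first.
  by rewrite !ffunE permK (pr_par _ (hv i)) (negPf ni).
by rewrite (morphD0 (qpermD (@perm_inj _ _))) scaler0.
Qed.

(** Products of permutations are read from left to right, so [t * s] is the map [s] after [t]: this
    is the law of a right action. *)
Lemma act_comp s t X : (forall f, multilinear X f) ->
  ch_act gr t (ch_act gr s X) = ch_act gr (t * s)%g X.
Proof.
move=> mX; apply/funext => v; apply/funext => f; move: v.
apply: (mlin_hom_ext (gr := gr)); [exact/act_mlin/act_mlin|exact: act_mlin|].
move=> c v hv; rewrite (act_hom _ _ (act_mlin _ mX) hv).
rewrite (act_hom (c := fun j => c (t^-1%g j)) _ _ mX); last first.
  by move=> i; rewrite ffunE.
rewrite (act_hom _ _ mX hv) koszul_comp qpermZ; last exact: perm_inj.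
rewrite scalerA zs_perm_comp qperm_comp; do ?exact: perm_inj.
congr (_ *: _); rewrite (eq_qperm (l := (t * s)^-1%g)).
  by congr (sqperm _ (X _ _)); apply/ffunP => j; rewrite !ffunE invMg permM.
by move=> j /=; rewrite invMg permM.
Qed.

Lemma act1 X : (forall f, multilinear X f) -> ch_act gr 1%g X = X.
Proof.
move=> mX; apply/funext => v; apply/funext => f; move: v.
apply: (mlin_hom_ext (gr := gr)); [exact/act_mlin|exact: mX|].
move=> c v hv; rewrite (act_hom _ _ mX hv) koszul1 scale1r zs_id => [|i]; last first.
  by rewrite perm1.
rewrite qperm_id => [|i]; last by rewrite invg1 perm1.
by congr (X _ _); apply/ffunP => j; rewrite ffunE invg1 perm1.
Qed.

Lemma act_chiral s X : is_chiral X -> is_chiral (ch_act gr s X).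
Proof.
move=> cX; have mX := ch_mlin cX; have sI := @perm_inj _ (s^-1)%g.
have pD := qpermD (d := d) sI.
apply: is_chiralI => [|v a f g hf hg|v f hf|v i f hf|v i j f hf].
- exact: act_mlin.
- rewrite !ch_actE scaler_sumr -big_split; apply: eq_bigr => c _ /=.
  rewrite zsD; [|exact: zdom_perm..]; rewrite zsM; [|exact: zdom_perm..].
  rewrite zs_c (ch_lin cX); [|exact/OstarT_perm..].
  by rewrite pD qpermZ // scalerDr !scalerA mulrC.
- rewrite ch_actE big1 // => c _; rewrite (ch_out cX); last by move/OstarT_perm.
  by rewrite (morphD0 pD) scaler0.
- rewrite !ch_actE (morphD_sum _ _ _ (@qmulD _ _ _ _ i)) -big_split.
  apply: eq_bigr => c _ /=; rewrite vperm_proj_upd.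
  rewrite (even_endo_pr d_even) -fd_perm //.
  rewrite -(ch_d cX); last exact/OstarT_perm.
  rewrite pD qperm_mul // permK scalerDr qmulZ; congr (_ + _).
  congr (_ *: sqperm _ (X (upd _ _ _) _)); by rewrite !ffunE permK.
- rewrite !ch_actE.
  rewrite (morphD_sum _ _ _ (@qderivBD _ _ _ _ j i)).
  apply: eq_bigr => c _ /=; rewrite zsM; [|exact: zdom_perm..].
  rewrite zs_zd (ch_z cX); last exact/OstarT_perm.
  by rewrite qperm_deriv // !permK qderivBZ.
Qed.

End Action.

(** * Compositions of binary operations *)

Section Vectors.
Variables (F : fieldType) (U : lmodType F).

Definition v2 (a b : U) : {ffun 'I_2 -> U} := [ffun i => if i == ord0 then a else b].
Definition v3 (a b c : U) : {ffun 'I_3 -> U} :=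
  [ffun i => if i == o0 then a else if i == o1 then b else c].

Lemma v2_0 a b : v2 a b ord0 = a. Proof. by rewrite ffunE. Qed.
Lemma v2_1 a b : v2 a b ord_max = b. Proof. by rewrite ffunE. Qed.
Lemma v2E (v : {ffun 'I_2 -> U}) : v = v2 (v ord0) (v ord_max).
Proof. by apply/ffunP => i; rewrite ffunE; case: (ord2_eq i) => ->. Qed.
Lemma v3E (v : {ffun 'I_3 -> U}) : v = v3 (v o0) (v o1) (v o2).
Proof. by apply/ffunP => i; rewrite ffunE; case: (ord3P i) => ->. Qed.
Lemma upd2_0 a b x : upd (v2 a b) ord0 x = v2 x b.
Proof. by apply/ffunP => i; rewrite !ffunE; case: (ord2_eq i) => ->. Qed.
Lemma upd2_1 a b x : upd (v2 a b) ord_max x = v2 a x.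
Proof. by apply/ffunP => i; rewrite !ffunE; case: (ord2_eq i) => ->. Qed.
Lemma upd3_0 a b c x : upd (v3 a b c) o0 x = v3 x b c.
Proof. by apply/ffunP => i; rewrite !ffunE; case: (ord3P i) => ->. Qed.
Lemma upd3_1 a b c x : upd (v3 a b c) o1 x = v3 a x c.
Proof. by apply/ffunP => i; rewrite !ffunE; case: (ord3P i) => ->. Qed.
Lemma upd3_2 a b c x : upd (v3 a b c) o2 x = v3 a b x.
Proof. by apply/ffunP => i; rewrite !ffunE; case: (ord3P i) => ->. Qed.
Lemma v3_0 a b c : v3 a b c o0 = a. Proof. by rewrite ffunE. Qed.
Lemma v3_1 a b c : v3 a b c o1 = b. Proof. by rewrite ffunE. Qed.
Lemma v3_2 a b c : v3 a b c o2 = c. Proof. by rewrite ffunE. Qed.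

End Vectors.

Definition emb (i : 'I_2) : 'I_3 := @lshift 2 1 i.
Definition col (i : 'I_3) : 'I_2 := @collapse 2 1 i.

Lemma emb0 : emb ord0 = o0. Proof. exact: val_inj. Qed.
Lemma emb1 : emb ord_max = o1. Proof. exact: val_inj. Qed.
Lemma emb_inj : injective emb. Proof. exact: lshift_inj. Qed.
Lemma embK i : col (emb i) = ord0.
Proof. by rewrite /col /collapse /emb (unsplitK (inl _ i)). Qed.
Lemma col0 : col o0 = ord0. Proof. by rewrite -emb0 embK. Qed.
Lemma col1 : col o1 = ord0. Proof. by rewrite -emb1 embK. Qed.
Lemma col2 : col o2 = ord_max.
Proof.
have -> : o2 = @rshift 2 1 ord0 by apply: val_inj.
by rewrite /col /collapse (unsplitK (inr _ _)); apply: val_inj.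
Qed.
Lemma o2_neq_emb i : (emb i == o2) = false.
Proof. by case: (ord2_eq i) => ->. Qed.

Lemma enum3 (M : zmodType) (f : 'I_3 -> M) :
  \sum_(i < 3) f i = f o0 + (f o1 + f o2).
Proof.
rewrite !big_ord_recl big_ord0 addr0.
by congr (f _ + (f _ + f _)); apply: val_inj.
Qed.

Lemma enum2 (M : zmodType) (f : 'I_2 -> M) :
  \sum_(i < 2) f i = f ord0 + f ord_max.
Proof.
rewrite !big_ord_recl big_ord0 addr0; congr (f _ + f _); exact: val_inj.
Qed.

HB.lock Definition ex (F : fieldType) (U : lmodType F) (d : {linear U -> U})
  (y : lquot d 2) : lquot d 3 := @sqexpand F U d 2 1 y.

Section Expand3.
Variables (F : fieldType) (U : lmodType F) (d : {linear U -> U}).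
Local Notation ex := (@ex F U d).
Local Notation qc := (@qc F U d _).

Lemma exD : {morph ex : x y / x + y}.
Proof. by move=> x y /=; rewrite ex.unlock qexpandD. Qed.

Lemma exZ a y : ex (a *: y) = a *: ex y.
Proof. rewrite ex.unlock; exact: (@qexpandZ F U d 2 1 a y). Qed.

Lemma ex_c u : ex (qc u) = qc u.
Proof. rewrite ex.unlock; exact: (@qexpand_c F U d 2 1 u). Qed.

Lemma ex_mul0 y : ex (sqmul ord0 y) = sqmul o0 (ex y) + sqmul o1 (ex y).
Proof.
rewrite ex.unlock qexpand_mul0 enum2 -/(emb ord0) -/(emb ord_max).
by rewrite emb0 emb1.
Qed.

Lemma ex_mul1 y : ex (sqmul ord_max y) = sqmul o2 (ex y).
Proof.
rewrite ex.unlock (_ : ord_max = lift ord0 ord0 :> 'I_2); last exact: val_inj.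
rewrite qexpand_mul_lift (_ : rshift 2 ord0 = o2) //; exact: val_inj.
Qed.

Lemma ex_deriv i j y : ex (sqderivB (col j) (col i) y) = sqderivB j i (ex y).
Proof.
move: y; apply: lquot_eqfun => [x y|x y|u|k y hy] /=.
- by rewrite qderivBD exD.
- by rewrite exD qderivBD.
- by rewrite ex_c !qderivB_c (morphD0 exD).
have exM b : ex (y *+ b) = ex y *+ b.
  elim: b => [|b IH]; first by rewrite !mulr0n (morphD0 exD).
  by rewrite !mulrS exD IH.
rewrite qderivB_mul exD (morphDB exD) !exM.
have [->|->] := ord2_eq k.
  rewrite !ex_mul0 qderivBD !qderivB_mul hy [RHS]addrACA; congr (_ + _).
  case: (ord3P i) => ->; case: (ord3P j) => ->;
    by rewrite ?col0 ?col1 ?col2 /= ?mulr0n ?mulr1n ?subrr ?subr0 ?sub0r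
      ?addr0 ?add0r ?addrN ?addNr.
rewrite !ex_mul1 !qderivB_mul hy; congr (_ + _).
by case: (ord3P i) => ->; case: (ord3P j) => ->;
    rewrite ?col0 ?col1 ?col2 /= ?mulr0n ?mulr1n.
Qed.

(** The variables 0 and 1 enter only through lambda_0 + lambda_1. *)
Lemma ex_perm y : sqperm (tperm o0 o1) (ex y) = ex y.
Proof.
have tI := @perm_inj _ (tperm o0 o1); have pD := qpermD (d := d) tI.
move: y; apply: lquot_eqfun => [x y|x y|u|k y hy] /=.
- by rewrite exD pD.
- exact: exD.
- by rewrite ex_c qperm_c.
- have [->|->] := ord2_eq k.
    by rewrite !ex_mul0 pD !qperm_mul // hy tpermL tpermR addrC.
  by rewrite !ex_mul1 qperm_mul // hy tpermD.
Qed.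

End Expand3.

(** The poles allowed in the outer function [g] of a composition: all diagonals except z_0 = z_1. *)
Definition polar2 : {set 'I_3 * 'I_3} :=
  [set e : 'I_3 * 'I_3 | (e.1 < e.2)%N && (2 <= e.2)%N]%SET.

Lemma polar2P e : e \in polar2 -> col e.1 != col e.2.
Proof.
rewrite inE; case: e => i j /=.
by case: (ord3P i) => ->; case: (ord3P j) => ->; rewrite ?col0 ?col1 ?col2.
Qed.

Lemma polar2_neq e : e \in polar2 -> e.1 != e.2.
Proof. by move/polar2P; apply: contra_neq => ->. Qed.

(** The value of a composition as a function of the value [x] of the inner operation. Detaching [x]
    from the inner operation permits induction on it. *)
HB.lock Definition cev (F : fieldType) (U : lmodType F) (d : {linear U -> U})
    (Y : chmap d 2) (w : U) (x : lquot d 2) (g : {fraction {mpoly F[3]}}) :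
    lquot d 3 :=
  lsubst (fun (i : 'I_2) (Phi : {fraction {mpoly F[3]}} -> lquot d 3) g' =>
            sqmul (emb i) (Phi g') - Phi (fd (emb i) g'))
    (fun c g' => ex (Y (v2 c w) (zs col g'))) (repr x) g.

Lemma comp1_atE (F : fieldType) (U : lmodType F) (d : {linear U -> U})
    (Y X : chmap d 2) v f g :
  @comp1_at F U d 2 1 Y X v f g = cev Y (v o2) (X (v2 (v o0) (v o1)) f) g.
Proof.
rewrite cev.unlock /comp1_at.
rewrite (_ : [ffun i => v (lshift 1 i)] = v2 (v o0) (v o1)); last first.
  apply/ffunP => i; rewrite !ffunE -/(emb i).
  by case: (ord2_eq i) => ->; rewrite ?emb0 ?emb1.
set p := repr _; move: p => p; congr (_ g); apply: eq_lsubst => [i Phi|c].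
  by apply: funext => g'; rewrite sqmul.unlock fd.unlock.
apply: funext => g'; rewrite ex.unlock sqexpand.unlock zs.unlock.
congr (qexpand _ (Y _ _)); apply/ffunP => i; rewrite !ffunE.
have [->|->] := ord2_eq i; first by rewrite unlift_none.
rewrite (_ : ord_max = lift ord0 ord0 :> 'I_2); last exact: val_inj.
rewrite liftK (_ : rshift 2 ord0 = o2) //; exact: val_inj.
Qed.

Section CompEval.
Variables (F : fieldType) (U : lmodType F) (d : {linear U -> U}).
Local Notation K := {fraction {mpoly F[3]}}.
Local Notation G := (@OT_polar F 3 polar2).
Local Notation qc := (@qc F U d _).
Variable Y : chmap d 2.
Hypothesis cY : is_chiral Y.
Implicit Types (w u : U) (x y : lquot d 2) (g h : K).

Lemma G_fd i g : G g -> G (fd i g).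
Proof. exact/OT_fd/polar2_neq. Qed.

Lemma G_col g : G g -> OstarT (zs col g).
Proof. exact/OstarT_zs/polar2P. Qed.

Lemma G_zdom g : G g -> zdom col g.
Proof. exact/OT_zdom/polar2P. Qed.

Lemma fd_col0 g : G g -> fd ord0 (zs col g) = zs col (fd o0 g) + zs col (fd o1 g).
Proof.
move=> hg; rewrite (fd_zs polar2P _ hg) big_mkcond enum3.
by rewrite col0 col1 col2 /= addr0.
Qed.

Lemma fd_col1 g : G g -> fd ord_max (zs col g) = zs col (fd o2 g).
Proof.
move=> hg; rewrite (fd_zs polar2P _ hg) big_mkcond enum3.
by rewrite col0 col1 col2 /= !add0r.
Qed.

Section Spec.
Variable w : U.

Let A (i : 'I_2) (Phi : K -> lquot d 3) (g : K) : lquot d 3 :=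
  sqmul (emb i) (Phi g) - Phi (fd (emb i) g).
Let phi c (g : K) : lquot d 3 := ex (Y (v2 c w) (zs col g)).
(** The relation [Rtot] is available only for [g] regular at z_0 = z_1, so functions of [g] are
    compared after truncation to this class, which is stable under derivatives. *)
Let R (Phi : K -> lquot d 3) (g : K) : lquot d 3 :=
  if `[< G g >] then Phi g else 0.

Let AD i : {morph A i : x y / x + y}.
Proof.
move=> P Q /=; apply: funext => g; rewrite /A !fctE qmulD opprD.
exact: addrACA.
Qed.

Let AC i j P : A i (A j P) = A j (A i P).
Proof.
apply: funext => g; rewrite /A !(qmulD, qmulN) !opprD !opprK qmulC fdC.
rewrite -!addrA; congr (_ + _); rewrite !addrA; congr (_ + _); exact: addrC.
Qed.

Let phiD : {morph phi : x y / x + y}.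
Proof.
move=> a b /=; apply: funext => g; rewrite /phi fctE -exD; congr ex.
by rewrite -(upd2_0 a) (mlinD _ _ _ _ (ch_mlin cY _)) !upd2_0.
Qed.

Let RD : {morph R : x y / x + y}.
Proof.
move=> P Q /=; apply: funext => g; rewrite /R !fctE.
by case: asboolP => // _; rewrite addr0.
Qed.

Let RE P g : G g -> R P g = P g.
Proof. by rewrite /R => /asboolP ->. Qed.

Let RA i P : R P = 0 -> R (A i P) = 0.
Proof.
move=> RP; apply: funext => g; rewrite /R; case: asboolP => // hg.
rewrite /A -(RE P hg) -(RE P (G_fd (emb i) hg)) RP.
have -> : (0 : K -> lquot d 3) = fun=> 0 by [].
by rewrite qmul0 subrr.
Qed.

(** This is [chiral_d] for [Y] in its first slot, since d/dw of the restriction of [g] is the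
    restriction of (d/dz_0 + d/dz_1) g. *)
Let Rtot u : R (phi (d u) + \sum_(i < 2) A i (phi u)) = 0.
Proof.
apply: funext => g; rewrite /R; case: asboolP => // hg.
rewrite enum2 !fctE /A /phi emb0 emb1.
have hz := G_col hg; have e := ch_d cY (v2 u w) ord0 hz.
rewrite upd2_0 v2_0 fd_col0 // (ch_fD cY) in e; [|exact/G_col/G_fd..].
have := congr1 (@ex F U d) e; rewrite !exD ex_mul0 => e'.
by rewrite addrACA -opprD -e' addrA subrr.
Qed.

Let cevE x g : G g -> cev Y w x g = R (lsubst A phi (repr x)) g.
Proof. by move=> hg; rewrite cev.unlock RE. Qed.

Lemma cevD x y g : G g -> cev Y w (x + y) g = cev Y w x g + cev Y w y g.
Proof. by move=> hg; rewrite !cevE // (qsubstD AD AC phiD RD RA Rtot). Qed.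

Lemma cev_c u g : G g -> cev Y w (qc u) g = ex (Y (v2 u w) (zs col g)).
Proof. by move=> hg; rewrite cevE // (qsubst_c AD AC phiD RD RA Rtot) RE. Qed.

Lemma cev_mul i x g : G g -> cev Y w (sqmul i x) g
  = sqmul (emb i) (cev Y w x g) - cev Y w x (fd (emb i) g).
Proof.
move=> hg; rewrite cevE // (qsubst_mul AD AC phiD RD RA Rtot) RE // /A.
by rewrite cev.unlock.
Qed.

End Spec.

Lemma cev0 w g : G g -> cev Y w 0 g = 0.
Proof.
by move=> hg; apply: (addrI (cev Y w 0 g)); rewrite -cevD // !addr0.
Qed.

Lemma cevN w x g : G g -> cev Y w (- x) g = - cev Y w x g.
Proof.
by move=> hg; apply: (addrI (cev Y w x g)); rewrite -cevD // !subrr cev0.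
Qed.

Lemma cevMn w x g k : G g -> cev Y w (x *+ k) g = cev Y w x g *+ k.
Proof.
move=> hg; elim: k => [|k IH]; first by rewrite !mulr0n cev0.
by rewrite !mulrS cevD // IH.
Qed.

Lemma cevZ w a x g : G g -> cev Y w (a *: x) g = a *: cev Y w x g.
Proof.
move: g; elim/lquot_ind: x => [x y hx hy|u|i x hx] g hg.
- by rewrite scalerDr !cevD // scalerDr hx // hy.
- rewrite -qcZ !cev_c // -exZ; congr ex.
  by rewrite -(upd2_0 u) (mlinZ _ _ _ _ (ch_mlin cY _)) upd2_0.
- by rewrite -qmulZ !cev_mul // !hx // ?scalerBr ?qmulZ //; apply: G_fd.
Qed.

Lemma cev_gD w x g h : G g -> G h ->
  cev Y w x (g + h) = cev Y w x g + cev Y w x h.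
Proof.
move: g h; elim/lquot_ind: x => [x y hx hy|u|i x hx] g h hg hh; have hgh := OT_D hg hh.
- by rewrite !cevD // hx // hy // addrACA.
- rewrite !cev_c // zsD; [|exact: G_zdom..].
  by rewrite (ch_fD cY) ?exD //; apply: G_col.
- rewrite !cev_mul // fdD !hx //; [|exact: G_fd..].
  by rewrite qmulD opprD addrACA.
Qed.

Lemma cev_gZ w x a g : G g -> cev Y w x (fc 3 a * g) = a *: cev Y w x g.
Proof.
have hc := OT_c polar2 a.
move: g; elim/lquot_ind: x => [x y hx hy|u|i x hx] g hg; have hag := OT_M hc hg.
- by rewrite !cevD // hx // hy // scalerDr.
- rewrite !cev_c // zsM; [|exact: G_zdom..].
  by rewrite zs_c (ch_fZ cY) ?exZ //; apply: G_col.
- rewrite !cev_mul // fdM fdc mul0r add0r !hx //; last exact: G_fd.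
  by rewrite qmulZ scalerBr.
Qed.

Lemma cev_g0 w x : cev Y w x 0 = 0.
Proof.
have h := OT_0 F polar2; apply: (addrI (cev Y w x 0)).
by rewrite -cev_gD // !addr0.
Qed.

Lemma cev_gN w x g : G g -> cev Y w x (- g) = - cev Y w x g.
Proof.
by move=> hg; rewrite -mulN1r -fc1 -fcN cev_gZ // scaleN1r.
Qed.

Lemma cev_gbool w x g (b : bool) : G g -> cev Y w x (b%:R * g) = cev Y w x g *+ b.
Proof.
by case: b => hg; rewrite ?mulr1n ?mulr0n ?mul1r ?mul0r ?cev_g0.
Qed.

(** In the induction on [x], the derivative of z_ij with respect to z_k matches the commutator of
    lambda_k with the difference of lambda-derivatives. *)
Lemma cev_gz w x i j g : G g -> cev Y w x (zd i j * g) = sqderivB j i (cev Y w x g).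
Proof.
have hz k l : G (zd k l) by apply: OT_zd.
have hb (b : bool) : G b%:R by case: b; [apply: OT_1|apply: OT_0].
move: g; elim/lquot_ind: x => [x y hx hy|u|k x hx] g hg; have hzg := OT_M (hz i j) hg.
- by rewrite !cevD // hx // hy // qderivBD.
- rewrite !cev_c // zsM; [|exact: G_zdom..].
  by rewrite zs_zd (ch_z cY) ?ex_deriv //; apply: G_col.
- have hfg := G_fd (emb k) hg.
  rewrite !cev_mul // fdM fd_zd hx //.
  have hs : G ((emb k == i)%:R - (emb k == j)%:R) by apply: OT_D => //; apply: OT_N.
  rewrite cev_gD; [|exact: OT_M..].
  rewrite hx // mulrBl cev_gD; [|exact: (OT_M (hb _) hg)|exact: (OT_N (OT_M (hb _) hg))].
  rewrite cev_gN; last exact: (OT_M (hb _) hg).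
  rewrite !cev_gbool // qderivBD qderivB_mul (morphDN (@qderivBD _ _ _ _ j i)).
  rewrite [j == _]eq_sym [i == _]eq_sym opprD opprB addrA.
  by congr (_ + _ - _).
Qed.

(** A factor z_ab may pass from the inner function, where it acts on [x] by lambda-derivatives, to
    [g]. On constants both sides vanish, as z_ab is 0 on the diagonal; the commutator with lambda_k
    is again balanced by the derivative of z_ab. *)
Lemma cev_deriv w x a b g : G g ->
  cev Y w (sqderivB b a x) g = cev Y w x (zd (emb a) (emb b) * g).
Proof.
have hz k l : G (zd k l) by apply: OT_zd.
have hb (c : bool) : G c%:R by case: c; [apply: OT_1|apply: OT_0].
move: g; elim/lquot_ind: x => [x y hx hy|u|k x hx] g hg;
  have hzg := OT_M (hz (emb a) (emb b)) hg.
- by rewrite qderivBD !cevD // hx // hy.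
- rewrite qderivB_c cev0 // cev_c // zsM; [|exact: G_zdom..].
  by rewrite zs_zd !embK zdii mul0r (ch_f0 cY) (morphD0 (@exD _ _ d)).
- have hfg := G_fd (emb k) hg.
  rewrite qderivB_mul cevD // !cev_mul // cevD // cevN // !cevMn //.
  rewrite !hx // fdM fd_zd.
  have hs : G ((emb k == emb a)%:R - (emb k == emb b)%:R).
    by apply: OT_D => //; apply: OT_N.
  rewrite [in RHS]cev_gD; [|exact: OT_M..].
  rewrite mulrBl [in RHS]cev_gD; [|exact: (OT_M (hb _) hg)|exact: (OT_N (OT_M (hb _) hg))].
  rewrite cev_gN; last exact: (OT_M (hb _) hg).
  rewrite !cev_gbool // !(inj_eq emb_inj) [k == _]eq_sym [k == _]eq_sym.
  by rewrite opprD opprB [in RHS]addrCA addrC addrA.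
Qed.

Lemma cev_w w w' a x g : G g ->
  cev Y (a *: w + w') x g = a *: cev Y w x g + cev Y w' x g.
Proof.
move: g; elim/lquot_ind: x => [x y hx hy|u|i x hx] g hg.
- by rewrite !cevD // hx // hy // scalerDr addrACA.
- rewrite !cev_c // -exZ -exD; congr ex.
  by rewrite -(upd2_1 u w) (ch_mlin cY) !upd2_1.
- rewrite !cev_mul // !hx //; last exact: G_fd.
  by rewrite scalerBr qmulD qmulZ opprD addrACA.
Qed.

Lemma cev_dw w x g : G g ->
  cev Y (d w) x g + sqmul o2 (cev Y w x g) = cev Y w x (fd o2 g).
Proof.
move: g; elim/lquot_ind: x => [x y hx hy|u|i x hx] g hg.
- have hfg := G_fd o2 hg.
  by rewrite !cevD // -hx // -hy // qmulD addrACA.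
- have hfg := G_fd o2 hg.
  rewrite !cev_c // -ex_mul1 -exD; congr ex.
  have := ch_d cY (v2 u w) ord_max (G_col hg).
  by rewrite upd2_1 v2_1 fd_col1.
- have hfg := G_fd o2 hg; have hig := G_fd (emb i) hg.
  rewrite !cev_mul // -hx // fdC -hx // !qmulD qmulN [sqmul (emb i) (sqmul _ _)]qmulC.
  by rewrite opprD !addrA; congr (_ - _); rewrite -!addrA; congr (_ + _); rewrite addrC.
Qed.

(** Neither the restriction to z_0 = z_1 nor lambda_0 + lambda_1 sees the exchange of the two inner
    variables, so the exchange passes to the inner value. *)
Lemma cev_perm w x g : G g ->
  sqperm (tperm o0 o1) (cev Y w x (zs (tperm o0 o1) g))
    = cev Y w (sqperm (tperm ord0 ord_max) x) g.
Proof.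
set t := tperm o0 o1; set t2 := tperm _ _.
have tI := @perm_inj _ t; have pD := qpermD (d := d) tI.
have t2I := @perm_inj _ t2; have pD2 := qpermD (d := d) t2I.
have et i : emb (t2 i) = t (emb i).
  by case: (ord2_eq i) => ->; rewrite /t2 /t ?tpermL ?tpermR ?emb0 ?emb1 ?tpermL ?tpermR.
have ct i : col (t i) = col i.
  by case: (ord3P i) => ->; rewrite /t ?tpermL ?tpermR ?tpermD // ?col0 ?col1.
have tP : forall e, e \in polar2 -> t e.1 != t e.2.
  by move=> e /polar2_neq; rewrite (inj_eq perm_inj).
have hG h : G h -> G (zs t h).
  apply: OT_zs => // -[i j]; rewrite !inE /t /=.
  by case: (ord3P i) => ->; case: (ord3P j) => -> //; rewrite ?tpermL ?tpermR ?tpermD.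
have zst h : G h -> zs col (zs t h) = zs col h.
  elim/OT_ind => [a|h1 h2 g1 g2 e1 e2|h1 h2 g1 g2 e1 e2|i j _|e eE].
  - by rewrite !zs_c.
  - rewrite [zs t _]zsD; [|exact: zdom_perm..].
    rewrite zsD; [|exact/G_zdom/hG..]; rewrite e1 e2.
    by rewrite zsD //; apply: G_zdom.
  - rewrite [zs t _]zsM; [|exact: zdom_perm..].
    rewrite zsM; [|exact/G_zdom/hG..]; rewrite e1 e2.
    by rewrite zsM //; apply: G_zdom.
  - by rewrite !zs_zd !ct.
  - rewrite (proj2 (zs_zdV F (tP e eE))) !(proj2 (zs_zdV F _)) ?ct //.
      exact: polar2P.
    exact: polar2P.
move: g; elim/lquot_ind: x => [x y hx hy|u|i x hx] g hg; have hg' := hG _ hg.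
- by rewrite cevD // pD hx // hy // -cevD // pD2.
- by rewrite qperm_c // !cev_c // zst // ex_perm.
- rewrite cev_mul // (morphDB pD) !qperm_mul // hx // cev_mul // et.
  congr (_ - _); have hd := G_fd (t (emb i)) hg.
  rewrite -hx //; congr (sqperm _ (cev _ _ _ _)).
  rewrite -fd_perm ?permK; last by apply: OT_sub hg; apply/fintype.subsetP
    => e; rewrite !inE => /andP[].
  by rewrite /t tpermK.
Qed.

End CompEval.

Lemma OstarT_M (F : fieldType) n (f g : {fraction {mpoly F[n]}}) :
  OstarT f -> OstarT g -> OstarT (f * g).
Proof. exact: OT_M. Qed.

Section Factor.
Variable F : fieldType.
Local Notation K2 := {fraction {mpoly F[2]}}.
Local Notation K := {fraction {mpoly F[3]}}.
Local Notation G := (@OT_polar F 3 polar2).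
Local Notation z := (@zd F 2 ord_max ord0).
Local Notation Z := (@zd F 3 o1 o0).

Lemma Z_neq0 : Z != 0. Proof. exact: zd_neq0. Qed.

Lemma emb_pair e : e \in ltpairs 2 -> emb e.1 != emb e.2.
Proof. by move/ltpairs_neq; rewrite (inj_eq emb_inj). Qed.

Lemma emb_zdom (f : K2) : OstarT f -> zdom emb f.
Proof. exact/OT_zdom/emb_pair. Qed.

Lemma zs_emb_z : zs emb z = Z.
Proof. by rewrite zs_zd emb0 emb1. Qed.

Lemma OstarT_zVX N : OstarT (z ^- N).
Proof. by rewrite -exprVn; apply/OT_X/OstarT_zdV. Qed.

Lemma zs_emb_zVX N : zs emb (z ^- N) = Z ^- N.
Proof.
have [dz ez] : zdom emb z^-1 /\ zs emb z^-1 = Z^-1.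
  by rewrite -zs_emb_z zs_zd; apply: zs_zdV; rewrite (inj_eq emb_inj).
by rewrite -!exprVn zsX // ez.
Qed.

Lemma G_pz q : G (zs emb (pz q)).
Proof.
have Opz (r : {poly F}) : OstarT (pz r) by apply/OstarT2P; exists 0%N, r; rewrite divr1.
elim/poly_ind: q => [|q c IH]; first by rewrite pz0 zs0; apply: OT_0.
have hz : OstarT z by apply: OT_zd.
rewrite pzD pzM pzX pzC zsD; [|exact/emb_zdom/OstarT_M/hz/Opz|exact: zdom_c].
rewrite zsM; [|exact: emb_zdom..]; rewrite zs_emb_z zs_c.
by apply: OT_D; [apply: OT_M => //; apply: OT_zd|apply: OT_c].
Qed.

Lemma polar2_sub (g : K) : G g -> OstarT g.
Proof. by apply: OT_sub; apply/fintype.subsetP => e; rewrite !inE => /andP[]. Qed.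

(** Only the pole at z_0 = z_1 has to be split off, so powers of 1/z suffice as inner functions. *)
Lemma OstarT_factor (h : K) : OstarT h -> exists N g, G g /\ h = Z ^- N * g.
Proof.
have Zn N : Z ^+ N != 0 by rewrite expf_neq0 // Z_neq0.
have GZ N : G (Z ^+ N) by apply/OT_X/OT_zd.
elim/OT_ind => [a|f g _ _ [N [p [hp ->]]] [M [q [hq ->]]]
  |f g _ _ [N [p [hp ->]]] [M [q [hq ->]]]|i j lt|[i j]].
- by exists 0%N, (fc 3 a); split; [apply: OT_c|rewrite expr0 invr1 mul1r].
- exists (N + M)%N, (p * Z ^+ M + q * Z ^+ N); split.
    by apply: OT_D; apply: OT_M.
  rewrite [Z ^- N * p]mulrC [Z ^- M * q]mulrC.
  by rewrite addf_div; [rewrite exprD mulrC|exact: Zn..].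
- exists (N + M)%N, (p * q); split; first exact: OT_M.
  by rewrite mulrACA -invfM exprD.
- by exists 0%N, (zd i j); split; [apply: OT_zd|rewrite expr0 invr1 mul1r].
- rewrite inE /= => lt; have [jn|jn] := leqP 2 j.
    exists 0%N, (zd i j)^-1; split; last by rewrite expr0 invr1 mul1r.
    by apply: OT_zdV; rewrite inE /= lt jn.
  exists 1%N, (-1); rewrite expr1; split; first exact/OT_N/OT_1.
  move: lt jn; case: (ord3P i) => ->; case: (ord3P j) => -> // _ _.
  by rewrite zdN invrN mulrN1.
Qed.

Lemma OstarT_factor2 (h1 h2 : K) : OstarT h1 -> OstarT h2 ->
  exists N g1 g2, [/\ G g1, G g2, h1 = Z ^- N * g1 & h2 = Z ^- N * g2].
Proof.
move=> /OstarT_factor[N1 [g1 [hg1 ->]]] /OstarT_factor[N2 [g2 [hg2 ->]]].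
have Zn N : Z ^+ N != 0 by rewrite expf_neq0 // Z_neq0.
have GZ N : G (Z ^+ N) by apply/OT_X/OT_zd.
exists (N1 + N2)%N, (Z ^+ N2 * g1), (Z ^+ N1 * g2); split; try exact: OT_M.
  by rewrite exprD mulrA invfM mulfVK.
by rewrite exprD mulrA invfM [_^-1 * _^-1]mulrC mulfVK.
Qed.

End Factor.

Section Comp1.
Variables (F : fieldType) (U : lmodType F) (d : {linear U -> U}).
Local Notation K2 := {fraction {mpoly F[2]}}.
Local Notation K := {fraction {mpoly F[3]}}.
Local Notation G := (@OT_polar F 3 polar2).
Local Notation z := (@zd F 2 ord_max ord0).
Local Notation Z := (@zd F 3 o1 o0).
Variables X Y : chmap d 2.
Hypotheses (cX : is_chiral X) (cY : is_chiral Y).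
Implicit Types (v : {ffun 'I_3 -> U}) (f : K2) (g h : K).

Definition comp3 : chmap d 3 := @comp1 F U d 2 1 Y X.

Lemma cev_pz (u : {ffun 'I_2 -> U}) w q f g : OstarT f -> G g ->
  cev Y w (X u (pz q * f)) g = cev Y w (X u f) (zs emb (pz q) * g).
Proof.
have Opz (r : {poly F}) : OstarT (pz r) by apply/OstarT2P; exists 0%N, r; rewrite divr1.
have hz : OstarT z by apply: OT_zd.
move=> hf; elim/poly_ind: q g => [|q c IH] g hg.
  by rewrite pz0 zs0 !mul0r (ch_f0 cX) (cev0 cY) // (cev_g0 cY).
rewrite pzD pzM pzX pzC zsD; [|exact/emb_zdom/OstarT_M/hz/Opz|exact: zdom_c].
rewrite zsM; [|exact: emb_zdom..]; rewrite zs_emb_z zs_c.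
have hc : OstarT (fc 2 c) by apply: OT_c.
have hZ : G Z by apply: OT_zd.
have hP := G_pz q; have hC := OT_c polar2 c : G (fc 3 c).
rewrite !mulrDl (ch_fD cX); [|by do ?apply: OstarT_M|exact: OstarT_M].
rewrite (cevD cY) // (cev_gD cY); [|by do ?apply: OT_M|exact: OT_M].
rewrite (ch_fZ cX) // (cevZ cY) // (cev_gZ cY) //; congr (_ + _).
rewrite mulrAC mulrC (ch_z cX) //; last exact: OstarT_M.
rewrite (cev_deriv cY) // emb0 emb1 IH; last exact: OT_M.
by rewrite mulrA.
Qed.

Lemma comp3_wd (u : {ffun 'I_2 -> U}) w f f' g g' : OstarT f -> OstarT f' -> G g -> G g' ->
  zs emb f * g = zs emb f' * g' ->
  cev Y w (X u f) g = cev Y w (X u f') g'.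
Proof.
move=> /OstarT2P[N [p ->]] /OstarT2P[M [q ->]] hg hg'.
have Zn N' : Z ^+ N' != 0 by rewrite expf_neq0 // Z_neq0.
have zn N' : z ^+ N' != 0 by rewrite expf_neq0 // z_neq0.
have Opz (r : {poly F}) : OstarT (pz r) by apply/OstarT2P; exists 0%N, r; rewrite divr1.
have hz := OstarT_zVX F.
have e1 : pz p / z ^+ N = pz (p * 'X^M) * z ^- (N + M).
  by rewrite pzM pzXn pzX exprD -mulf_div divff; [rewrite mulr1|exact: zn].
have e2 : pz q / z ^+ M = pz (q * 'X^N) * z ^- (N + M).
  by rewrite pzM pzXn pzX addnC exprD -mulf_div divff; [rewrite mulr1|exact: zn].
rewrite e1 e2.
have zsE' r : zs emb (pz r * z ^- (N + M)) = zs emb (pz r) * Z ^- (N + M).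
  by rewrite zsM ?zs_emb_zVX //; apply: emb_zdom.
rewrite !zsE' => e; rewrite !cev_pz //; congr (cev Y w _ _).
apply: (mulIf (invr_neq0 (Zn (N + M)%N))).
by rewrite mulrAC e mulrAC.
Qed.

Lemma comp3E v f g : OstarT f -> G g ->
  comp3 v (zs emb f * g) = cev Y (v o2) (X (v2 (v o0) (v o1)) f) g.
Proof.
move=> hf hg; rewrite /comp3 /comp1; case: xgetP => [y _|/(_ (cev Y (v o2) (X (v2 (v o0) (v o1)) f) g)) nh].
  move=> [f' [g' [hf' hg' e ->]]]; rewrite comp1_atE.
  by apply: comp3_wd => //; rewrite e zs.unlock.
by case: nh; exists f, g; split; rewrite ?comp1_atE ?zs.unlock.
Qed.

Lemma comp3Z v N g : G g ->
  comp3 v (Z ^- N * g) = cev Y (v o2) (X (v2 (v o0) (v o1)) (z ^- N)) g.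
Proof. by move=> hg; rewrite -comp3E ?zs_emb_zVX //; apply: OstarT_zVX. Qed.

Lemma comp3_out v h : ~ OstarT h -> comp3 v h = 0.
Proof.
move=> nh; rewrite /comp3 /comp1; case: xgetP => [y _|//].
move=> [f [g [hf hg e _]]]; case: nh; rewrite {}e; apply: OT_M.
  have := OstarT_zs (@emb_pair) hf; by rewrite zs.unlock.
exact: polar2_sub.
Qed.

Lemma comp3_mlin h : multilinear comp3 h.
Proof.
move=> v i a x y; have [hh|nh] := pselect (OstarT h); last first.
  by rewrite !comp3_out // scaler0 addr0.
have [N [g [hg ->]]] := OstarT_factor hh.
rewrite !comp3Z // (v3E v); move: (v o0) (v o1) (v o2) => a0 a1 b1.
case: (ord3P i) => ->.
- rewrite !upd3_0 !v3_0 !v3_1 !v3_2 -(upd2_0 x) (ch_mlin cX) !upd2_0.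
  by rewrite (cevD cY) // (cevZ cY).
- rewrite !upd3_1 !v3_0 !v3_1 !v3_2 -(upd2_1 _ x) (ch_mlin cX) !upd2_1.
  by rewrite (cevD cY) // (cevZ cY).
- by rewrite !upd3_2 !v3_0 !v3_1 !v3_2 (cev_w cY).
Qed.

Lemma comp3_lin v a h1 h2 : OstarT h1 -> OstarT h2 ->
  comp3 v (fc 3 a * h1 + h2) = a *: comp3 v h1 + comp3 v h2.
Proof.
move=> H1 H2; have [N [g1 [g2 [hg1 hg2 -> ->]]]] := OstarT_factor2 H1 H2.
have hc := OT_c polar2 a : G (fc 3 a).
rewrite mulrCA -mulrDr !comp3Z //; last exact/OT_D/hg2/OT_M.
by rewrite (cev_gD cY) ?(cev_gZ cY) //; apply: OT_M.
Qed.

Lemma comp3_chiral : is_chiral comp3.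
Proof.
apply: is_chiralI => [h|v a f g|v h|v i h hh|v i j h hh].
- exact: comp3_mlin.
- exact: comp3_lin.
- exact: comp3_out.
- have [N [g [hg ->]]] := OstarT_factor hh.
  have hz := OstarT_zVX F N; have hdg i' := G_fd i' hg.
  have OF := OstarT_zs (@emb_pair) hz; rewrite zs_emb_zVX in OF.
  have CD h1 h2 : OstarT h1 -> OstarT h2 ->
      comp3 v (h1 + h2) = comp3 v h1 + comp3 v h2.
    by move=> H1 H2; rewrite -{1}[h1]mul1r -fc1 comp3_lin // scale1r.
  (* For an inner variable, the derivative of Z^-N is [chiral_d] for [X], and the derivative of [g]
     cancels the correction term in [cev_mul]. *)
  have key a : comp3 (upd v (emb a) (d (v (emb a)))) (Z ^- N * g)
      + sqmul (emb a) (comp3 v (Z ^- N * g)) = comp3 v (fd (emb a) (Z ^- N * g)).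
    rewrite fdM CD; [|by apply: OT_M; [exact: OstarT_fd|exact: polar2_sub]
                     |by apply: OT_M => //; exact/OstarT_fd/polar2_sub].
    rewrite -(zs_emb_zVX F N) (fd_zs (@emb_pair) _ hz).
    rewrite (big_pred1 a) => [|b]; last by rewrite (inj_eq emb_inj).
    rewrite !comp3E //; last exact: OstarT_fd.
    rewrite -(ch_d cX _ _ hz) (cevD cY) // (cev_mul cY) //.
    rewrite addrA subrK; congr (_ + _).
    rewrite (v3E v); move: (v o0) (v o1) (v o2) => a0 a1 b1.
    by case: (ord2_eq a) => ->; rewrite ?emb0 ?emb1 ?upd3_0 ?upd3_1 !v3_0 !v3_1
      !v3_2 ?upd2_0 ?upd2_1 ?v2_0 ?v2_1.
  case: (ord3P i) => ->; [by have := key ord0; rewrite emb0|by have := key ord_max; rewrite emb1|].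
  rewrite fdM (_ : fd o2 (Z ^- N) = 0) ?mul0r ?add0r; last first.
    rewrite -(zs_emb_zVX F N) (fd_zs (@emb_pair) _ hz) big_pred0 // => b.
    exact: o2_neq_emb.
  rewrite !comp3Z //  -(cev_dw cY) //.
  rewrite (v3E v); move: (v o0) (v o1) (v o2) => a0 a1 b1.
  by rewrite upd3_2 !v3_0 !v3_1 !v3_2.
- have [N [g [hg ->]]] := OstarT_factor hh.
  by rewrite mulrCA !comp3Z ?(cev_gz cY) //; apply: OT_M => //; apply: OT_zd.
Qed.

End Comp1.

(** * Reduction to simple poles in three variables *)

Section PoleAlgebra.
Variable K : fieldType.

Lemma pole_algebra (b n a V S P : K) : b * (n * a) = - 1 ->
  b * (n * (P * - (a * V * V)) * S) = P * V * V * S.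
Proof.
move=> e; transitivity (- (b * (n * a)) * (P * V * V * S)); first by ring.
by rewrite e opprK mul1r.
Qed.

(** Multiplication by (x + y) / s = 1. *)
Lemma pole_fraction a b c (x y s : K) : x != 0 -> y != 0 -> s != 0 -> x + y = s ->
  x^-1 ^+ a.+1 * y^-1 ^+ b.+1 * s^-1 ^+ c
    = x^-1 ^+ a * y^-1 ^+ b.+1 * s^-1 ^+ c.+1
      + x^-1 ^+ a.+1 * y^-1 ^+ b * s^-1 ^+ c.+1.
Proof.
move=> x0 y0 s0 e; rewrite !exprS; set A := _ ^+ a; set B := _ ^+ b.
set C := _ ^+ c; transitivity (x^-1 * A * (y^-1 * B) * C * ((x + y) * s^-1)).
  by rewrite e mulfV // mulr1.
by field; rewrite x0 y0 s0.
Qed.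
End PoleAlgebra.

Section Pole3.
Variables (F : fieldType) (charF0 : [pchar F] =i pred0).
Variables (U : lmodType F) (d : {linear U -> U}).
Local Notation K := {fraction {mpoly F[3]}}.
Variable B : chmap d 3.
Hypothesis cB : is_chiral B.
Implicit Types (f g h : K).

(** These functions form a space stable under multiplication by polynomials and under all d/dz_i;
    the reduction to simple poles uses only this. *)
Definition ch_null h := OstarT h /\ forall v, B v h = 0.

Lemma null_mulz i j h : ch_null h -> ch_null (zd i j * h).
Proof.
move=> [hh Bh]; split=> [|v]; first by apply: OstarT_M => //; apply: OT_zd.
rewrite (ch_z cB) // Bh; exact: (morphD0 (@qderivBD _ _ _ _ _ _)).
Qed.

Lemma null_fd i h : ch_null h -> ch_null (fd i h).
Proof.
move=> [hh Bh]; split=> [|v]; first exact: OstarT_fd.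
by rewrite -(ch_d cB) // !Bh add0r qmul0.
Qed.

Lemma null_D h g : ch_null h -> ch_null g -> ch_null (h + g).
Proof.
move=> [hh Bh] [hg Bg]; split=> [|v]; first exact: OT_D.
by rewrite (ch_fD cB) // Bh Bg addr0.
Qed.

Lemma null_c a h : ch_null h -> ch_null (fc 3 a * h).
Proof.
move=> [hh Bh]; split=> [|v]; first by apply: OstarT_M => //; apply: OT_c.
by rewrite (ch_fZ cB) // Bh scaler0.
Qed.

Lemma null_poly p h : OT_polar finset.set0 p -> ch_null h -> ch_null (p * h).
Proof.
move=> hp; move: p hp h; apply: OT_ind =>
  [a|f g _ _ Pf Pg|f g _ _ Pf Pg|i j _|e eE] h.
- exact: null_c.
- by move=> hh; rewrite mulrDl; exact: (null_D (Pf _ hh) (Pg _ hh)).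
- by move=> hh; rewrite -mulrA; exact: (Pf _ (Pg _ hh)).
- exact: null_mulz.
- by rewrite inE in eE.
Qed.

Lemma fdX (i : 'I_3) f m : fd i (f ^+ m.+1) = fc 3 m.+1%:R * (f ^+ m * fd i f).
Proof.
elim: m => [|m IH]; first by rewrite expr1 expr0 mul1r fc1 mul1r.
rewrite exprS fdM IH -[m.+2]add1n natrD fcD fc1 mulrDl mul1r; congr (_ + _).
  exact: mulrC.
by rewrite mulrCA [f * (_ * _)]mulrA -exprS.
Qed.

Lemma nat_neq0 m : m.+1%:R != 0 :> F.
Proof. by rewrite (pcharf0P _).1. Qed.

(** The variable z_l occurs in only one of the two denominators, so d/dz_l raises that pole alone,
    with the factor -(m+1) a, invertible in characteristic 0. *)
Lemma null_pole (l i j i' j' : 'I_3) a m k' : a != 0 ->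
  fd l (zd i j : K) = fc 3 a -> fd l (zd i' j' : K) = 0 -> i != j -> i' != j' ->
  ch_null ((zd i j)^-1 ^+ m.+1 * (zd i' j')^-1 ^+ k'.+1) ->
  ch_null ((zd i j)^-1 ^+ m.+2 * (zd i' j')^-1 ^+ k'.+1).
Proof.
move=> a0 ea e0 nij nij' /(null_fd l).
rewrite fdM !fdX !fdV ?zd_neq0 // e0 !mul0r oppr0 !mulr0 addr0 ea.
set S := _ ^+ k'.+1; set V := (zd i j)^-1.
move/(null_c (- (m.+1%:R * a)^-1)); congr ch_null.
rewrite !exprSr; apply: pole_algebra; rewrite -!fcM mulNr mulVf ?fcN ?fc1 //.
by rewrite mulf_neq0 // nat_neq0.
Qed.

Lemma fd_zd_eq l i : l != i -> fd l (zd l i : K) = fc 3 1.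
Proof. by move=> n; rewrite fd_zd eqxx (negPf n) subr0 fc1. Qed.

Lemma fd_zd_eqN l i : l != i -> fd l (zd i l : K) = fc 3 (- 1).
Proof. by move=> n; rewrite fd_zd eqxx (negPf n) sub0r fcN fc1. Qed.

Lemma fd_zd_neq l i j : l != i -> l != j -> fd l (zd i j : K) = 0.
Proof. by move=> n n'; rewrite fd_zd (negPf n) (negPf n') subrr. Qed.

Let x : K := zd o0 o1.
Let s : K := zd o0 o2.
Let y : K := zd o1 o2.

Let null_xs m k : ch_null (x^-1 * s^-1) -> ch_null (x^-1 ^+ m.+1 * s^-1 ^+ k.+1).
Proof.
move=> h; elim: m => [|m IH]; last first.
  by apply: (null_pole (l := o1) (a := -1)) => //;
    rewrite ?fd_zd_eqN ?fd_zd_neq // oppr_eq0 oner_eq0.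
elim: k => [|k IH]; first by rewrite !expr1.
rewrite mulrC; apply: (null_pole (l := o2) (a := -1)) => //;
  rewrite ?fd_zd_eqN ?fd_zd_neq // ?oppr_eq0 ?oner_eq0 //.
by rewrite mulrC.
Qed.

Let null_ys m k : ch_null (y^-1 * s^-1) -> ch_null (y^-1 ^+ m.+1 * s^-1 ^+ k.+1).
Proof.
move=> h; elim: m => [|m IH]; last first.
  by apply: (null_pole (l := o1) (a := 1)) => //;
    rewrite ?fd_zd_eq ?fd_zd_neq // oner_eq0.
elim: k => [|k IH]; first by rewrite !expr1.
rewrite mulrC; apply: (null_pole (l := o0) (a := 1)) => //;
  rewrite ?fd_zd_eq ?fd_zd_neq // ?oner_eq0 //.
by rewrite mulrC.
Qed.

(* Partial fractions: 1 = (z_01 + z_12) / z_02 lowers the order of the pole at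
   z_0 = z_1 or z_1 = z_2. *)
Lemma null_all h : ch_null (x^-1 * s^-1) -> ch_null (y^-1 * s^-1) ->
  OstarT h -> ch_null h.
Proof.
move=> hxs hys; have [x0 y0 s0] : [/\ x != 0, y != 0 & s != 0].
  by split; apply: zd_neq0.
have xy : x + y = s by rewrite /x /y zd_add.
have key a b c : ch_null (x^-1 ^+ a * y^-1 ^+ b * s^-1 ^+ c).
  have [k] := ubnP (a + b); elim: k a b c => // k IH [|a] [|b] c le.
  - rewrite !expr0 !mul1r; have := null_mulz o0 o2 (null_mulz o0 o1 (null_xs 0 c hxs)).
    by rewrite -/x -/s expr1 (mulVKf x0) exprS (mulVKf s0).
  - rewrite expr0 mul1r; have := null_mulz o0 o2 (null_ys b c hys).
    by rewrite -/s mulrCA exprS [s^-1 ^+ _]exprS (mulVKf s0).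
  - rewrite expr0 mulr1; have := null_mulz o0 o2 (null_xs a c hxs).
    by rewrite -/s mulrCA exprS [s^-1 ^+ _]exprS (mulVKf s0).
  - rewrite (pole_fraction a b c x0 y0 s0 xy); apply: null_D; apply: IH.
      by move: le; rewrite addSn.
    by move: le; rewrite addnS.
move/OstarT3P => [N [p [hp ->]]]; apply: null_poly => //.
by rewrite /zall -/x -/s -/y -exprVn !invfM !exprMn mulrAC; apply: key.
Qed.

End Pole3.

Section KoszulSmall.
Variable F : fieldType.

Lemma koszul2 (s : 'S_2) c : koszul F s c =
  if (s ord_max < s ord0)%N then (-1) ^+ (c ord0 && c ord_max) else 1.
Proof.
rewrite /koszul big_mkcond -(pair_bigA _ (fun i j : 'I_2 =>
  if (i < j)%N && (s j < s i)%N then (-1) ^+ (c i && c j) else 1)) /=.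
have e (f : 'I_2 -> F) : \prod_i f i = f ord0 * f ord_max.
  rewrite !big_ord_recl big_ord0 mulr1; congr (f _ * f _); exact: val_inj.
by rewrite !e /= !mulr1 mul1r.
Qed.

Lemma koszul3 (s : 'S_3) c : koszul F s c =
  (if (s o1 < s o0)%N then (-1) ^+ (c o0 && c o1) else 1) *
  ((if (s o2 < s o0)%N then (-1) ^+ (c o0 && c o2) else 1) *
  (if (s o2 < s o1)%N then (-1) ^+ (c o1 && c o2) else 1)).
Proof.
rewrite /koszul big_mkcond -(pair_bigA _ (fun i j : 'I_3 =>
  if (i < j)%N && (s j < s i)%N then (-1) ^+ (c i && c j) else 1)) /=.
have e (f : 'I_3 -> F) : \prod_i f i = f o0 * (f o1 * f o2).
  rewrite !big_ord_recl big_ord0 mulr1; congr (f _ * (f _ * f _)); exact: val_inj.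
by rewrite !e /= !mulr1 !mul1r mulrA.
Qed.

End KoszulSmall.

(** * Invariance of the box and its test function *)

Section BoxSymmetry.
Variables (F : fieldType) (charF0 : [pchar F] =i pred0).
Variables (U : lmodType F) (d : {linear U -> U}).
Variables (gr : superspace U) (d_even : even_endo gr d).
Local Notation K := {fraction {mpoly F[3]}}.
Variable X : chmap d 2.
Hypothesis cX : is_chiral X.
Let C : chmap d 3 := comp3 X X.

Definition box3 : chmap d 3 := @box F U d gr 1 1 X X.

(** The second block of the shuffle has a single element, so only the order on the first block is a
    condition. *)
Lemma box3E : box3 = \sum_(s : 'S_3 | (s o0 < s o1)%N) ch_act gr (s^-1)%g C.
Proof.
apply: eq_bigl => s; apply/forallP/idP => [/(_ o0)/forallP/(_ o1)/implyP|lt i].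
  by apply.
apply/forallP => j; apply/implyP.
by case: (ord3P i) => ->; case: (ord3P j) => ->.
Qed.

Lemma actD n (t : 'S_n) (A B : chmap d n) :
  ch_act gr t (A + B) = ch_act gr t A + ch_act gr t B.
Proof.
apply/funext => v; apply/funext => f; rewrite !fctE !ch_actE -big_split.
apply: eq_bigr => c _ /=; rewrite !fctE qpermD; last exact: perm_inj.
by rewrite scalerDr.
Qed.

Lemma act_sum n (t : 'S_n) (I : finType) (P : pred I) (A : I -> chmap d n) :
  ch_act gr t (\sum_(i | P i) A i) = \sum_(i | P i) ch_act gr t (A i).
Proof. exact: (morphD_sum _ _ _ (actD t)). Qed.

Lemma is_chiral0 n : is_chiral (0 : chmap d n).
Proof.
have E v f : (0 : chmap d n) v f = 0 by [].
apply: is_chiralI => [f v i a x y|v a f g _ _|//|v i f _|v i j f _]; rewrite !E.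
- by rewrite scaler0 addr0.
- by rewrite scaler0 addr0.
- by rewrite add0r qmul0.
- by rewrite (morphD0 (@qderivBD _ _ _ _ _ _)).
Qed.

Lemma is_chiralD n (A B : chmap d n) :
  is_chiral A -> is_chiral B -> is_chiral (A + B).
Proof.
move=> cA cB; apply: is_chiralI => [f v i a x y|v a f g hf hg|v f hf|v i f hf|v i j f hf];
  rewrite !fctE.
- by rewrite (ch_mlin cA) (ch_mlin cB) scalerDr addrACA.
- by rewrite (ch_lin cA) // (ch_lin cB) // scalerDr addrACA.
- by rewrite (ch_out cA) // (ch_out cB) // addr0.
- by rewrite qmulD addrACA (ch_d cA) // (ch_d cB).
- by rewrite (ch_z cA) // (ch_z cB) // qderivBD.
Qed.

Lemma box3_chiral : is_chiral box3.
Proof.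
rewrite box3E; elim/big_rec: _ => [|s B _ cB]; first exact: is_chiral0.
by apply: is_chiralD => //; apply: act_chiral => //; apply: comp3_chiral.
Qed.

Hypothesis symX : ch_act gr (tperm ord0 ord_max) X = X.

(** The inner operation is invariant, and the outer one does not distinguish the two inner
    variables. The Koszul sign is the same in arities 2 and 3, because the third slot is fixed. *)
Lemma comp3_sym : ch_act gr (tperm o0 o1) C = C.
Proof.
set t := tperm o0 o1; pose t2 : 'S_2 := tperm ord0 ord_max.
have sX : ch_act gr t2 X = X by exact: symX.
have mC : forall f, multilinear C f := comp3_mlin cX cX.
have cC : is_chiral C := comp3_chiral cX cX.
apply/funext => v; apply/funext => h; move: v.
have [hh|nh] := pselect (OstarT h); last first.
  by move=> v; rewrite (ch_out (act_chiral d_even _ cC)) // (ch_out cC).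
apply: (mlin_hom_ext (gr := gr)); [exact: act_mlin|exact: mC|].
move=> c v hv; rewrite (act_hom _ _ mC hv).
have [N [g [hg ->]]] := OstarT_factor hh.
have hz := OstarT_zVX F N; rewrite -(zs_emb_zVX F N).
move: hz; set f := _ ^- N => hf.
have tK i : t (t i) = i by rewrite /t tpermK.
have tV : (t^-1)%g = t by rewrite /t tpermV.
have t2V : (t2^-1)%g = t2 by rewrite /t2 tpermV.
have et i : t (emb i) = emb (t2 i).
  by case: (ord2_eq i) => ->; rewrite /t2 /t ?tpermL ?tpermR ?emb0 ?emb1 ?tpermL ?tpermR.
have tP : forall e, e \in polar2 -> t e.1 != t e.2.
  by move=> e /polar2_neq; rewrite (inj_eq perm_inj).
have hGt : OT_polar polar2 (zs t g).
  apply: OT_zs hg => // -[i j]; rewrite !inE /t /=.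
  by case: (ord3P i) => ->; case: (ord3P j) => -> //; rewrite ?tpermL ?tpermR ?tpermD.
have hft : OstarT (zs t2 f) by apply/OstarT_perm.
have e1 : zs t (zs emb f) = zs emb (zs t2 f).
  move: f hf {hft}; apply: OT_ind => [a|h1 h2 g1 g2 e1 e2|h1 h2 g1 g2 e1 e2|i j _|e eE].
  - by rewrite !zs_c.
  - rewrite zsD; [|exact: emb_zdom..]; rewrite zsD; [|exact: zdom_perm..].
    rewrite e1 e2 [zs t2 (h1 + h2)]zsD; [|exact: zdom_perm..].
    by rewrite zsD //; apply/emb_zdom/OstarT_perm.
  - rewrite zsM; [|exact: emb_zdom..]; rewrite zsM; [|exact: zdom_perm..].
    rewrite e1 e2 [zs t2 (h1 * h2)]zsM; [|exact: zdom_perm..].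
    by rewrite zsM //; apply/emb_zdom/OstarT_perm.
  - by rewrite !zs_zd !et.
  - have ne := ltpairs_neq eE.
    rewrite (proj2 (zs_zdV F (emb_pair eE))) (proj2 (zs_zdV F _))
      ?(inj_eq perm_inj) ?(inj_eq emb_inj) //.
    rewrite (proj2 (zs_zdV F _)) ?(inj_eq perm_inj) //.
    by rewrite (proj2 (zs_zdV F _)) ?(inj_eq emb_inj) ?(inj_eq perm_inj) // !et.
rewrite zsM; [|exact: zdom_perm..]; rewrite e1 /C !comp3E //.
rewrite !ffunE tV /t tpermL tpermR tpermD // -/t.
pose c2 (i : 'I_2) := c (emb i).
have hv2 i : hom_par gr (c2 i) (v2 (v o0) (v o1) i).
  by rewrite ffunE /c2; case: (ord2_eq i) => ->; rewrite /= ?emb0 ?emb1.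
have eX : X (v2 (v o0) (v o1)) f = koszul F t2 c2 *:
    sqperm t2 (X (vperm t2 (v2 (v o0) (v o1))) (zs t2 f)).
  by rewrite -{1}sX (act_hom _ _ (ch_mlin cX) hv2) t2V.
rewrite [in RHS]eX (cevZ cX) //.
rewrite -(cev_perm cX) // -/t koszul2 koszul3 /c2 emb0 emb1.
rewrite /t2 tpermL tpermR /t tpermL tpermR tpermD //= !mulr1 -/t.
congr (_ *: sqperm _ (cev _ _ (X _ _) _)).
by apply/ffunP => i; rewrite !ffunE t2V; case: (ord2_eq i) => ->;
  rewrite /t2 ?tpermL ?tpermR.
Qed.

(** Left multiplication by the transposition exchanges the shuffles with the other permutations, and
    by [comp3_sym] it does not change the summand. *)
Lemma box3_sum : box3 + box3 = \sum_(s : 'S_3) ch_act gr s C.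
Proof.
have mC : forall f, multilinear C f := comp3_mlin cX cX.
rewrite [RHS](reindex_inj invg_inj) (bigID (fun s : 'S_3 => (s o0 < s o1)%N)) /=.
rewrite -box3E; congr (_ + _); rewrite box3E.
rewrite [RHS](reindex_inj (mulgI (tperm o0 o1))); apply: eq_big => s.
  rewrite !permM tpermL tpermR -leqNgt ltn_neqAle andb_idl // => le.
  by rewrite (inj_eq val_inj) (inj_eq perm_inj).
by move=> _; rewrite invMg tpermV -(act_comp _ _ _ mC) comp3_sym.
Qed.

Lemma box3_sym t : ch_act gr t box3 = box3.
Proof.
have mC : forall f, multilinear C f := comp3_mlin cX cX.
suff e : ch_act gr t box3 + ch_act gr t box3 = box3 + box3.
  apply/funext => v; apply/funext => h.
  have := congr1 (fun B : chmap d 3 => B v h) e; rewrite !fctE => e'.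
  have two : 2%:R != 0 :> F by rewrite (pcharf0P _).1.
  by apply: (scalerI two); rewrite !scaler_nat !mulr2n.
rewrite -actD box3_sum act_sum [RHS](reindex_inj (mulgI t)).
by apply: eq_bigr => s _; rewrite act_comp.
Qed.

Local Notation h0 := ((zd o2 o0)^-1 * (zd o2 o1)^-1 : K).

Lemma box3_eq0 :
  (forall (c : 'I_3 -> bool) (v : {ffun 'I_3 -> U}),
     (forall i, hom_par gr (c i) (v i)) -> box3 v h0 = 0) ->
  box3 = 0.
Proof.
move=> H; have cB := box3_chiral; have mB := ch_mlin cB.
have O (i j : 'I_3) : i != j -> OstarT ((zd i j)^-1 : K) by apply: OstarT_zdV.
have h00 : OstarT h0 by apply: OstarT_M; apply: O.
have Bh0 v : box3 v h0 = 0.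
  have E u f : (0 : chmap d 3) u f = 0 by [].
  apply: (mlin_hom_ext (gr := gr) (Y := 0)) => // v' i a x y.
  by rewrite !E scaler0 addr0.
(* The transposition of 0 and 2 carries this function to [h0]; together with [h0] itself, rewritten
   with two changes of sign, it is what [null_all] requires. *)
have t02 : ch_null box3 ((zd o0 o1)^-1 * (zd o0 o2)^-1 : K).
  split=> [|v]; first by apply: OstarT_M; apply: O.
  rewrite -(box3_sym (tperm o0 o2)) ch_actE big1 // => c _.
  have V (i j : 'I_3) : i != j -> zdom (tperm o0 o2) ((zd i j)^-1 : K) /\
      zs (tperm o0 o2) ((zd i j)^-1 : K)
        = (zd (tperm o0 o2 i) (tperm o0 o2 j))^-1.
    by move=> ne; apply: zs_zdV; rewrite (inj_eq perm_inj).
  have [n1 z1] := V o0 o1 isT; have [n2 z2] := V o0 o2 isT.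
  rewrite tpermL tpermD // in z1; rewrite tpermL tpermR in z2.
  rewrite zsM // z1 z2 mulrC Bh0.
  by rewrite (morphD0 (qpermD (@perm_inj _ _))) scaler0.
have t12 : ch_null box3 ((zd o1 o2)^-1 * (zd o0 o2)^-1 : K).
  split=> [|v]; first by apply: OstarT_M; apply: O.
  by rewrite zdN [zd o0 o2]zdN !invrN mulrNN mulrC Bh0.
apply/funext => v; apply/funext => h; have [hh|nh] := pselect (OstarT h).
  by case: (null_all charF0 cB t02 t12 hh).
by rewrite (ch_out cB).
Qed.

End BoxSymmetry.

(** * From chiral operations to vertex algebras *)

Section Substitution.
Variables (F : fieldType) (V : lmodType F).
Local Notation L n := (lpoly V n).

Definition subst1 n (A : L n -> L n) (p : L 1) : L n :=
  lsubst (fun _ : 'I_1 => A) (@lcst F V n) p.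

Section Subst1.
Variables (n : nat) (A : L n -> L n).
Hypothesis AD : {morph A : x y / x + y}.

Lemma subst1D p q : subst1 A (p + q) = subst1 A p + subst1 A q.
Proof. by apply: lsubstD => // u v; rewrite lcstD. Qed.

Lemma subst1_c u : subst1 A (lcst 1 u) = lcst n u.
Proof. by apply: lsubst_const => // v w; rewrite lcstD. Qed.

Lemma subst1_mul i p : subst1 A (lmul i p) = A (subst1 A p).
Proof. by apply: lsubst_mul => // v w; rewrite lcstD. Qed.
End Subst1.

Lemma lmap_subst1 n (A : L n -> L n) (d : {linear V -> V}) p :
  {morph A : x y / x + y} -> (forall q, lmap d (A q) = A (lmap d q)) ->
  lmap d (subst1 A p) = subst1 A (lmap d p).
Proof.
move=> AD dA; move: p; apply: lpoly_eqfun => [p q|p q|u|i p hp] /=.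
- by rewrite subst1D // lmapD.
- by rewrite lmapD subst1D.
- by rewrite subst1_c // !lmap_const ?raddf0 // subst1_c.
- by rewrite subst1_mul // dA hp lmap_mul ?raddf0 // subst1_mul.
Qed.

Lemma subst1Z n (A : L n -> L n) a p : {morph A : x y / x + y} ->
  (forall q, A (a *: q) = a *: A q) -> subst1 A (a *: p) = a *: subst1 A p.
Proof.
move=> AD AZ; move: p; apply: lpoly_eqfun => [p q|p q|u|i p hp] /=.
- by rewrite scalerDr subst1D.
- by rewrite subst1D // scalerDr.
- by rewrite -lcstZ !subst1_c // lcstZ.
- by rewrite -lmulZ !subst1_mul // hp AZ.
Qed.

(** The extension of [phi] that is linear over polynomials in the lambda_i. *)
Definition ext n (phi : V -> L n) (p : L n) : L n := lsubst (@lmul F V n) phi p.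

Section Ext.
Variables (n : nat) (phi : V -> L n).
Hypothesis phiD : {morph phi : x y / x + y}.
Let mD := @lmulD F V n.
Let mC := @lmulC F V n.

Lemma extD p q : ext phi (p + q) = ext phi p + ext phi q.
Proof. by rewrite /ext lsubstD. Qed.

Lemma ext_c u : ext phi (lcst n u) = phi u.
Proof. by rewrite /ext lsubst_const. Qed.

Lemma ext_mul i p : ext phi (lmul i p) = lmul i (ext phi p).
Proof. by rewrite /ext lsubst_mul. Qed.

Lemma extB p q : ext phi (p - q) = ext phi p - ext phi q.
Proof. exact: (morphDB extD). Qed.

Lemma extZ a p : (forall u, phi (a *: u) = a *: phi u) ->
  ext phi (a *: p) = a *: ext phi p.
Proof.
move=> phiZ; move: p; apply: lpoly_eqfun => [p q|p q|u|i p hp] /=.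
- by rewrite scalerDr extD.
- by rewrite extD scalerDr.
- by rewrite -lcstZ !ext_c phiZ.
- by rewrite -lmulZ !ext_mul hp lmulZ.
Qed.
End Ext.

(** Used with maps that agree only on vectors of one parity, that of all the coefficients of [p]. *)
Lemma eq_ext_in n (phi phi' : V -> L n) p :
  (forall m, phi (lcf m p) = phi' (lcf m p)) -> ext phi p = ext phi' p.
Proof.
rewrite lcf.unlock => e; apply: eq_bigr => m _.
by elim: (enum _) => [|i s IH] //=; rewrite IH.
Qed.

Lemma extDphi n (phi psi : V -> L n) p :
  {morph phi : x y / x + y} -> {morph psi : x y / x + y} ->
  ext (fun c => phi c + psi c) p = ext phi p + ext psi p.
Proof.
move=> phiD psiD.
have cD : {morph (fun c => phi c + psi c) : x y / x + y}.
  by move=> x y /=; rewrite phiD psiD addrACA.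
move: p; apply: lpoly_eqfun => [p q|p q|u|i p hp] /=.
- exact: extD.
- by rewrite !extD // addrACA.
- by rewrite !ext_c.
- by rewrite !ext_mul // hp lmulD.
Qed.

Lemma extZphi n (phi : V -> L n) a p : {morph phi : x y / x + y} ->
  ext (fun c => a *: phi c) p = a *: ext phi p.
Proof.
move=> phiD.
have cD : {morph (fun c => a *: phi c) : x y / x + y}.
  by move=> x y /=; rewrite phiD scalerDr.
move: p; apply: lpoly_eqfun => [p q|p q|u|i p hp] /=.
- exact: extD.
- by rewrite !extD // scalerDr.
- by rewrite !ext_c.
- by rewrite !ext_mul // hp lmulZ.
Qed.

End Substitution.

Lemma elim_last_emb (F : fieldType) (V : lmodType F) (d : {linear V -> V}) a
    (x : lquot d 3) : elim_last (sqmul (emb a) x) = lmul a (elim_last x).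
Proof.
have -> : emb a = lift ord_max a.
  by apply: val_inj; rewrite /= /bump leqNgt ltn_ord.
by rewrite elim_last_mul last_op_lift.
Qed.

Lemma lift1_ord0 : lift ord_max (ord0 : 'I_1) = ord0 :> 'I_2.
Proof. exact: val_inj. Qed.

Lemma last_op_ord0 (F : fieldType) (V : lmodType F) (d : {linear V -> V})
    (p : lpoly V 1) : last_op d (ord0 : 'I_2) p = lmul ord0 p.
Proof. by rewrite -[X in last_op _ X]lift1_ord0 last_op_lift. Qed.

Section Evaluation.
Variables (F : fieldType) (V : lmodType F) (d : {linear V -> V}).
Local Notation K := {fraction {mpoly F[3]}}.
Local Notation z := (@zd F 2 ord_max ord0).
Local Notation L n := (lpoly V n).
Local Notation eli := (@elim_last_inv F V d 1).
Variable X : chmap d 2.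
Hypothesis cX : is_chiral X.

Definition lambda_map (u v : V) : L 1 := elim_last (X (v2 u v) z^-1).
Local Notation J := lambda_map.

Lemma JDl u u' v : J (u + u') v = J u v + J u' v.
Proof.
by rewrite /J -(upd2_0 u) (mlinD _ _ _ _ (ch_mlin cX _)) elim_lastD !upd2_0.
Qed.

Lemma JDr u v v' : J u (v + v') = J u v + J u v'.
Proof.
by rewrite /J -(upd2_1 _ v) (mlinD _ _ _ _ (ch_mlin cX _)) elim_lastD !upd2_1.
Qed.

Lemma JZl a u v : J (a *: u) v = a *: J u v.
Proof.
by rewrite /J -(upd2_0 u) (mlinZ _ _ _ _ (ch_mlin cX _)) elim_lastZ !upd2_0.
Qed.

Lemma JZr a u v : J u (a *: v) = a *: J u v.
Proof.
by rewrite /J -(upd2_1 _ v) (mlinZ _ _ _ _ (ch_mlin cX _)) elim_lastZ !upd2_1.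
Qed.

Lemma eliJ u v : eli (J u v) = X (v2 u v) z^-1.
Proof. exact: elim_lastK. Qed.

Lemma eli_mul i p : eli (lmul i p) = sqmul ord0 (eli p).
Proof. by rewrite (ord1 i) elim_last_inv_mul lift1_ord0. Qed.

Lemma eli_mul_max p : sqmul ord_max (eli p) = - sqmul ord0 (eli p) - eli (lmap d p).
Proof. by rewrite elim_last_inv_map enum2 opprK addKr. Qed.

Lemma elim_ex_eli q : elim_last (ex (eli q))
  = subst1 (fun p => lmul ord0 p + lmul ord_max p) q.
Proof.
have AD : {morph (fun p : L 2 => lmul ord0 p + lmul ord_max p) : x y / x + y}.
  by move=> x y /=; rewrite !lmulD addrACA.
have iD := @elim_last_invD F V d 1.
move: q; apply: lpoly_eqfun => [p q|p q|u|i p hp] /=.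
- by rewrite iD exD elim_lastD.
- exact: subst1D.
- by rewrite elim_last_inv_c ex_c elim_last_c subst1_c.
- rewrite eli_mul ex_mul0 -emb0 -emb1 elim_lastD !elim_last_emb subst1_mul //.
  by rewrite hp.
Qed.

(** The inner transposition, which comes from skew-symmetry, moves lambda to the last slot of the
    outer operation; [s] then names that slot [b]. *)
Lemma elim_perm_eli (s : 'S_3) b q : s o2 = emb b ->
  elim_last (sqperm s (ex (sqperm (tperm ord0 ord_max) (eli q))))
  = subst1 (@lmul F V 2 b) q.
Proof.
move=> sb; have iD := @elim_last_invD F V d 1.
have sI := @perm_inj _ s; have tI := @perm_inj _ (tperm (ord0 : 'I_2) ord_max).
move: q; apply: lpoly_eqfun => [p q|p q|u|i p hp] /=.
- by rewrite iD qpermD // exD qpermD // elim_lastD.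
- by rewrite subst1D // => x y; rewrite lmulD.
- by rewrite elim_last_inv_c !qperm_c // ex_c qperm_c // elim_last_c subst1_c // => x y; rewrite lmulD.
- rewrite eli_mul qperm_mul // tpermL ex_mul1 qperm_mul // sb elim_last_emb hp.
  by rewrite subst1_mul // => x y; rewrite lmulD.
Qed.

Let g12 : K := (zd o1 o2)^-1.
Let g21 : K := (zd o2 o1)^-1.
Let g20 : K := (zd o2 o0)^-1.

Let G21 : OT_polar polar2 g21.
Proof. by apply: OT_zdV; rewrite !inE. Qed.
Let G12 : OT_polar polar2 g12.
Proof. by apply: OT_zdV; rewrite !inE. Qed.
Let G20 : OT_polar polar2 g20.
Proof. by apply: OT_zdV; rewrite !inE. Qed.

Let col21 : zs col g21 = z^-1.
Proof. by rewrite (proj2 (zs_zdV F _)) ?col1 ?col2. Qed.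
Let col20 : zs col g20 = z^-1.
Proof. by rewrite (proj2 (zs_zdV F _)) ?col0 ?col2. Qed.
Let g12E : g12 = - g21.
Proof. by rewrite /g12 zdN invrN. Qed.
Let fd021 : fd o0 g21 = 0.
Proof. by rewrite fdV ?zd_neq0 // fd_zd_neq // !mul0r oppr0. Qed.
Let fd120 : fd o1 g20 = 0.
Proof. by rewrite fdV ?zd_neq0 // fd_zd_neq // !mul0r oppr0. Qed.

Let psiD w : {morph (fun c => elim_last (ex (X (v2 c w) z^-1))) : x y / x + y}.
Proof.
move=> x y /=; rewrite -elim_lastD -exD; congr (elim_last (ex _)).
by rewrite -(upd2_0 x) (mlinD _ _ _ _ (ch_mlin cX _)) !upd2_0.
Qed.

(** The function [g12] does not involve z_0, so lambda_0 - d/dz_0 acts on it as lambda_0. The sign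
    appears because z_12 restricts to -z. *)
Lemma elim_cev_perm (s : 'S_3) a w p : s o0 = emb a ->
  elim_last (sqperm s (cev X w (eli p) g12)) =
  - ext (fun c => elim_last (sqperm s (ex (X (v2 c w) z^-1))))
      (subst1 (@lmul F V 2 a) p).
Proof.
move=> sa; rewrite g12E (cev_gN cX) // (morphDN (qpermD (@perm_inj _ s))).
rewrite (morphDN (@elim_lastD _ _ d 2)); congr (- _).
have iD := @elim_last_invD F V d 1; have sI := @perm_inj _ s.
have pD : {morph (fun c => elim_last (sqperm s (ex (X (v2 c w) z^-1)))) : x y / x + y}.
  move=> x y /=; rewrite -elim_lastD -(qpermD sI) -exD; congr (elim_last (sqperm _ (ex _))).
  by rewrite -(upd2_0 x) (mlinD _ _ _ _ (ch_mlin cX _)) !upd2_0.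
have mD : {morph (@lmul F V 2 a) : x y / x + y} by move=> x y; rewrite lmulD.
move: p; apply: lpoly_eqfun => [p q|p q|u|i p hp] /=.
- by rewrite iD (cevD cX) // qpermD // elim_lastD.
- by rewrite subst1D // extD.
- by rewrite elim_last_inv_c (cev_c cX) // col21 subst1_c // ext_c.
- rewrite eli_mul (cev_mul cX) // emb0 fd021 (cev_g0 cX) subr0 qperm_mul // sa.
  by rewrite elim_last_emb hp subst1_mul // ext_mul.
Qed.

Let elim_cev21 w p : elim_last (cev X w (eli p) g21) =
  ext (fun c => elim_last (ex (X (v2 c w) z^-1))) (subst1 (@lmul F V 2 ord0) p).
Proof.
have iD := @elim_last_invD F V d 1.
have mD : {morph (@lmul F V 2 ord0) : x y / x + y} by move=> x y; rewrite lmulD.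
move: p; apply: lpoly_eqfun => [p q|p q|u|i p hp] /=.
- by rewrite iD (cevD cX) // elim_lastD.
- by rewrite subst1D // extD.
- by rewrite elim_last_inv_c (cev_c cX) // col21 subst1_c // ext_c.
- rewrite eli_mul (cev_mul cX) // emb0 fd021 (cev_g0 cX) subr0 -emb0.
  by rewrite elim_last_emb hp subst1_mul // ext_mul.
Qed.

Let mu_op (p : L 2) : L 2 := - lmul ord_max p - lmap d p.

Let mu_opD : {morph mu_op : x y / x + y}.
Proof. by move=> x y; rewrite /mu_op lmulD lmapD !opprD addrACA. Qed.

Let mu_op_map q : lmap d (mu_op q) = mu_op (lmap d q).
Proof.
have dD := lmapdD d (n := 2).
by rewrite /mu_op (morphDB dD) (morphDN dD) lmap_mul ?raddf0.
Qed.

(** Here the pole does not involve z_1, so the inner variable with no derivative term is lambda_1,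
    and lambda_0 has to be expressed as - lambda_1 minus the derivation. *)
Let elim_cev20 w p : elim_last (cev X w (eli p) g20) =
  ext (fun c => elim_last (ex (X (v2 c w) z^-1))) (subst1 mu_op p).
Proof.
have iD := @elim_last_invD F V d 1; have eD := @elim_lastD F V d 2.
have pD := psiD w; have xD := extD pD.
(* That substitution replaces [p] by [lmap d p], so the induction must cover all iterates of
   [lmap d]. *)
suff h j : elim_last (cev X w (eli (iter j (lmap d) p)) g20) =
  ext (fun c => elim_last (ex (X (v2 c w) z^-1))) (subst1 mu_op (iter j (lmap d) p)).
  exact: (h 0%N).
have itD k (x y : L 1) : iter k (lmap d) (x + y) = iter k (lmap d) x + iter k (lmap d) y.
  by elim: k => //= k ->; rewrite lmapD.
have itc k u : iter k (lmap d) (lcst 1 u) = lcst 1 (iter k d u).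
  by elim: k => //= k ->; rewrite lmap_const ?raddf0.
have itm k i (x : L 1) : iter k (lmap d) (lmul i x) = lmul i (iter k (lmap d) x).
  by elim: k => //= k ->; rewrite lmap_mul ?raddf0.
elim/lpoly_ind: p j => [p q hp hq|u|i p hp] j.
- by rewrite itD iD (cevD cX) // eD hp hq subst1D // xD.
- by rewrite itc elim_last_inv_c (cev_c cX) // col20 subst1_c // ext_c.
- rewrite itm eli_mul subst1_mul // {1}/mu_op.
  set q := iter j (lmap d) p.
  have -> : sqmul ord0 (eli q) = - sqmul ord_max (eli q) - eli (lmap d q).
    by rewrite eli_mul_max !opprD !opprK addrK.
  rewrite (cevD cX) // !(cevN cX) // (cev_mul cX) // emb1 fd120 (cev_g0 cX) subr0.
  rewrite eD !(morphDN eD) -emb1 elim_last_emb hp (hp j.+1).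
  by rewrite xD !(morphDN xD) ext_mul // lmap_subst1.
Qed.

(** Write 1 = z (1/z) and move z outside: z_10 / (z_20 z_21) = 1/z_21 - 1/z_20. The two simple poles
    give the two bounds lambda and - mu - d of the integral in the third Jacobi term. *)
Lemma elim_cev_one w u v :
  elim_last (cev X w (X (v2 u v) 1) ((zd o2 o0)^-1 * (zd o2 o1)^-1)) =
  ext (fun c => elim_last (ex (X (v2 c w) z^-1)))
    (subst1 (@lmul F V 2 ord0) (J u v)
     - subst1 (fun p => - lmul ord_max p - lmap d p) (J u v)).
Proof.
have Oz : OstarT z^-1 by apply: OstarT_zdV.
rewrite -(mulfV (z_neq0 F)) (ch_z cX) //.
have Gh : OT_polar polar2 (g20 * g21) by apply: OT_M.
rewrite (cev_deriv cX) // emb0 emb1.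
have -> : zd o1 o0 * (g20 * g21) = g21 - g20.
  rewrite -(zd_add F o1 o2 o0) mulrDl [zd o1 o2]zdN mulNr addrC.
  by rewrite mulrA mulfV ?zd_neq0 // mul1r mulrCA mulfV ?zd_neq0 // mulr1.
rewrite (cev_gD cX) //; last exact: OT_N.
rewrite (cev_gN cX) // -eliJ (morphDB (@elim_lastD _ _ d 2)).
by rewrite elim_cev21 elim_cev20 extB.
Qed.

End Evaluation.

Section Shuffles.

(** A shuffle is determined by the image [k] of the last element; the two others take the remaining
    places in order. *)
Definition shuf (k : 'I_3) : 'S_3 := lift_perm (ord_max : 'I_3) k 1%g.

Lemma shuf_max k : shuf k o2 = k.
Proof. by rewrite (_ : o2 = ord_max) ?lift_perm_id //; apply: val_inj. Qed.

Lemma shuf_emb k (i : 'I_2) : shuf k (emb i) = lift k i.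
Proof.
have -> : emb i = lift ord_max i.
  by apply: val_inj; rewrite /= /bump leqNgt ltn_ord.
by rewrite lift_perm_lift perm1.
Qed.

Lemma shuf_o0 k : shuf k o0 = lift k ord0. Proof. by rewrite -emb0 shuf_emb. Qed.
Lemma shuf_o1 k : shuf k o1 = lift k ord_max. Proof. by rewrite -emb1 shuf_emb. Qed.

Lemma perm_eqV n (s : 'S_n) i j : s i = j -> (s^-1)%g j = i.
Proof. by move=> <-; rewrite permK. Qed.

Lemma sum_shuffles (M : zmodType) (G : 'S_3 -> M) :
  \sum_(s : 'S_3 | (s o0 < s o1)%N) G s
    = G (shuf o0) + (G (shuf o1) + G (shuf o2)).
Proof.
rewrite -(enum3 (fun k => G (shuf k))).
rewrite (reindex_onto shuf (fun s : 'S_3 => s o2)) => [|s lt]; last first.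
  have n01 : s o0 != s o1 by rewrite neq_ltn lt.
  have n02 : s o0 != s o2 by rewrite (inj_eq perm_inj).
  have n12 : s o1 != s o2 by rewrite (inj_eq perm_inj).
  apply/permP => i; case: (ord3P i) => ->; rewrite ?shuf_max ?shuf_o0 ?shuf_o1 //;
  move: lt n01 n02 n12; case: (ord3P (s o0)) => ->; case: (ord3P (s o1)) => ->;
  by case: (ord3P (s o2)) => -> // _ _ _ _; apply: val_inj.
apply: eq_bigl => k; rewrite shuf_max eqxx andbT shuf_o0 shuf_o1.
by case: (ord3P k) => ->.
Qed.

End Shuffles.

(** * Polynomials with coefficients in a fixed subspace *)

Section Coefficients.
Variables (F : fieldType) (V : lmodType F).

Definition coef_in n (S : set V) (p : lpoly V n) := forall m, S (lcf m p).

Lemma coef_in_ind n (S : set V) (P : lpoly V n -> Prop) : S 0 ->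
  (forall p q, P p -> P q -> P (p + q)) -> (forall u, S u -> P (lcst n u)) ->
  (forall i p, P p -> P (lmul i p)) -> forall p, coef_in S p -> P p.
Proof.
move=> S0 PD Pc Pm p hp.
have P0 : P 0 by rewrite -lcst0; apply: Pc.
have Pmon m u : S u -> P (lmon m u).
  move=> Su; have [k] := ubnP (mdeg m); elim: k m => // k IH m le_m.
  have [->|m0] := eqVneq m 0%MM; first by rewrite -lcstE; apply: Pc.
  have [i def_m mi] := mnm_neq0 m0.
  rewrite def_m -lmul_monom; apply/Pm/IH.
  by move: le_m; rewrite {1}def_m mdegD mdeg1 add1n.
rewrite (lmonE p); elim/big_rec: _ => // m q _ Pq.
by apply: PD => //; apply/Pmon/hp.
Qed.

Section Closed.
Variables (S : set V).
Hypothesis S_lin : forall a u v, S u -> S v -> S (a *: u + v).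
Hypothesis S_0 : S 0.

Lemma S_add u v : S u -> S v -> S (u + v).
Proof. by move=> hu hv; rewrite -[u]scale1r; apply: S_lin. Qed.

Lemma S_opp u : S u -> S (- u).
Proof. by move=> hu; rewrite -scaleN1r -[_ *: _]addr0; apply: S_lin. Qed.

Lemma S_scale a u : S u -> S (a *: u).
Proof. by move=> hu; rewrite -[_ *: _]addr0; apply: S_lin. Qed.

Lemma S_muln u k : S u -> S (u *+ k).
Proof. by move=> hu; rewrite -scaler_nat; apply: S_scale. Qed.

Lemma coef_inD n (p q : lpoly V n) : coef_in S p -> coef_in S q -> coef_in S (p + q).
Proof. by move=> hp hq m; rewrite lcfD; apply: S_add. Qed.

Lemma coef_inN n (p : lpoly V n) : coef_in S p -> coef_in S (- p).
Proof. by move=> hp m; rewrite lcfN; apply: S_opp. Qed.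

Lemma coef_inZ n a (p : lpoly V n) : coef_in S p -> coef_in S (a *: p).
Proof. by move=> hp m; rewrite lcfZ; apply: S_scale. Qed.

Lemma coef_in_sum n (I : Type) (r : seq I) (P : pred I) (f : I -> lpoly V n) :
  (forall i, coef_in S (f i)) -> coef_in S (\sum_(i <- r | P i) f i).
Proof.
move=> hf; elim/big_rec: _ => [m|i p _ hp]; first by rewrite lcf0.
exact: coef_inD.
Qed.

Lemma coef_in_cst n u : S u -> coef_in S (lcst n u).
Proof. by move=> hu m; rewrite lcf_cst; case: eqP; rewrite ?mulr1n ?mulr0n. Qed.

Lemma coef_in_mul n i (p : lpoly V n) : coef_in S p -> coef_in S (lmul i p).
Proof. by move=> hp m; rewrite lcf_mul; case: (m i). Qed.

Lemma coef_in_deriv n i (p : lpoly V n) : coef_in S p -> coef_in S (lderiv i p).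
Proof. by move=> hp m; rewrite lcf_deriv; apply: S_muln. Qed.

Lemma coef_in_map n (d : {linear V -> V}) (p : lpoly V n) :
  (forall u, S u -> S (d u)) -> coef_in S p -> coef_in S (lmap d p).
Proof. by move=> hd hp m; rewrite lcf_map ?raddf0 //; apply: hd. Qed.

(** Stability of [S] under [d] makes the elimination of the last variable harmless. It serves for
    parities, with [S] a homogeneous component, and for filtrations, with [S] a term of the
    filtration. *)
Lemma qcoef_inP n (d : {linear V -> V}) (x : lquot d n.+1) :
  (forall u, S u -> S (d u)) ->
  qcoef_in S x <-> coef_in S (elim_last x).
Proof.
move=> Sd; split=> [[p -> hp]|hx].
  have {}hp : coef_in S p by move=> m; rewrite lcf.unlock.
  rewrite qpE; move: p hp; apply: coef_in_ind => // [p q hp hq|u hu|i p hp].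
  - by rewrite qpD elim_lastD; apply: coef_inD.
  - by rewrite qcE elim_last_c; apply: coef_in_cst.
  - rewrite -qmul_qp elim_last_mul; case: (unliftP ord_max i) => [j ->|->].
      by rewrite last_op_lift; apply: coef_in_mul.
    rewrite last_op_max; apply: coef_inD; apply: coef_inN.
      by apply: coef_in_sum => j; apply: coef_in_mul.
    exact: coef_in_map.
suff [p -> hp] : exists2 p, x = qp d p & coef_in S p.
  by exists p; rewrite ?qpE // => m; have := hp m; rewrite lcf.unlock.
rewrite -(elim_lastK x); move: (elim_last x) hx.
apply: coef_in_ind => // [p q [p' ep hp'] [q' eq hq']|u hu|i p [p' e hp']].
- by exists (p' + q'); [rewrite elim_last_invD ep eq qpD|apply: coef_inD].
- by exists (lcst n.+1 u); [rewrite elim_last_inv_c qcE|apply: coef_in_cst].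
- by exists (lmul (lift ord_max i) p'); [rewrite elim_last_inv_mul e qmul_qp|
    apply: coef_in_mul].
Qed.
End Closed.

Lemma hom_par_lin (gr : superspace V) b a u v :
  hom_par gr b u -> hom_par gr b v -> hom_par gr b (a *: u + v).
Proof. by rewrite /hom_par linearP => -> ->. Qed.

Lemma hom_par0 (gr : superspace V) b : hom_par gr b 0.
Proof. exact: raddf0. Qed.

End Coefficients.

Section VaOf.
Variables (F : fieldType) (V : lmodType F) (gr : superspace V).
Variable d : {linear V -> V}.
Hypothesis d_even : even_endo gr d.
Local Notation pg := (parity_shift gr).
Local Notation z := (@zd F 2 ord_max ord0).
Variable X : chmap d 2.
Local Notation J := (lambda_map X).
Local Notation I := (va_of gr d X).

Lemma pg_even : even_endo pg d.
Proof. by move=> b u; apply: (d_even (b := ~~ b)). Qed.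

Lemma to_lambdaE (x : lquot d 2) : to_lambda x = elim_last x.
Proof.
rewrite elim_last.unlock; apply: eq_lsubst => [i p|u]; last exact: lcst_unlock.
have [->|->] := ord2_eq i.
  by rewrite -lift1_ord0 last_op_lift.
by rewrite last_op_max big_ord1.
Qed.

Lemma va_ofE u v : I u v = \sum_(b : bool) (-1) ^+ b *: J (pr gr b u) v.
Proof.
by apply: eq_bigr => b _; rewrite to_lambdaE /lambda_map zd.unlock.
Qed.

Hypothesis cX : is_chiral X.

Lemma J0l v : J 0 v = 0.
Proof. by have := JZl cX 0 0 v; rewrite !scale0r. Qed.

Lemma va_of_hom a u v : hom_par gr a u -> I u v = (-1) ^+ a *: J u v.
Proof.
move=> hu; rewrite va_ofE (bigD1 a) //= hu big1 ?addr0 // => b nb.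
by rewrite (pr_par _ hu) (negPf nb) J0l scaler0.
Qed.

Lemma sign_sq (a : bool) : (-1) ^+ a * (-1) ^+ a = 1 :> F.
Proof. by rewrite -expr2 -exprM mulnC exprM sqrrN !expr1n. Qed.

Lemma J_hom a u v : hom_par gr a u -> J u v = (-1) ^+ a *: I u v.
Proof. by move/va_of_hom => ->; rewrite scalerA sign_sq scale1r. Qed.

Lemma va_of_linl a u u' v : I (a *: u + u') v = a *: I u v + I u' v.
Proof.
rewrite !va_ofE scaler_sumr -big_split; apply: eq_bigr => b _ /=.
by rewrite linearP (JDl cX) (JZl cX) scalerDr !scalerA mulrC.
Qed.

Lemma va_of_linr a u v v' : I u (a *: v + v') = a *: I u v + I u v'.
Proof.
rewrite !va_ofE scaler_sumr -big_split; apply: eq_bigr => b _ /=.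
by rewrite (JDr cX) (JZr cX) scalerDr !scalerA mulrC.
Qed.

Hypothesis parX : ch_parity pg true X.

Lemma J_par a b u v : hom_par gr a u -> hom_par gr b v ->
  coef_in (hom_par gr (a (+) b)) (J u v).
Proof.
move=> hu hv; rewrite /lambda_map.
pose c (i : 'I_2) := if i == ord0 then ~~ a else ~~ b.
have hc i : hom_par pg (c i) (v2 u v i).
  by rewrite ffunE /c; case: (i == ord0) => /=; rewrite /hom_par /= negbK.
have := parX z^-1 hc; rewrite !big_ord_recl big_ord0 /= => h.
apply/(qcoef_inP (S := hom_par gr (a (+) b))) => //.
- by move=> *; apply: hom_par_lin.
- exact: hom_par0.
- by move=> w; apply: d_even.
case: h => p -> hp; exists p => // m; move: (hp m).
by rewrite /c /hom_par /=; case: (a); case: (b).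
Qed.

Hypothesis symX : ch_act pg (tperm ord0 ord_max) X = X.

(** The exchange of the variables turns 1/z into -1/z, and the Koszul sign is that of the shifted
    parities. *)
Lemma X_skew a b u v : hom_par gr a u -> hom_par gr b v ->
  X (v2 u v) z^-1 = - ((-1) ^+ (~~ a && ~~ b) *:
    sqperm (tperm ord0 ord_max) (X (v2 v u) z^-1)).
Proof.
move=> hu hv; pose c (i : 'I_2) := if i == ord0 then ~~ a else ~~ b.
have hc i : hom_par pg (c i) (v2 u v i).
  by rewrite ffunE /c; case: (i == ord0) => /=; rewrite /hom_par /= negbK.
rewrite -{1}symX (act_hom _ _ (ch_mlin cX) hc) koszul2 tpermL tpermR tpermV /=.
have -> : zs (tperm ord0 ord_max) z^-1 = - z^-1.
  by rewrite (proj2 (zs_zdV F _)) ?tpermL ?tpermR // zdN invrN.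
rewrite (ch_fN cX); last exact: OstarT_zdV.
rewrite (morphDN (qpermD (@perm_inj _ _))) scalerN; congr (- (_ *: sqperm _ (X _ _))).
by apply/ffunP => i; rewrite !ffunE tpermV; case: (ord2_eq i) => ->;
  rewrite ?tpermL ?tpermR.
Qed.

End VaOf.

(** * The box at the test function and the Jacobi identity *)

Section Jacobi.
Variables (F : fieldType) (V : lmodType F) (gr : superspace V).
Variable d : {linear V -> V}.
Hypothesis d_even : even_endo gr d.
Local Notation pg := (parity_shift gr).
Local Notation z := (@zd F 2 ord_max ord0).
Local Notation lam := (@lmul F V 2 ord0).
Local Notation mu := (@lmul F V 2 ord_max).

Section Defect.
Variable I : V -> V -> lpoly V 1.

Definition jac1 u v w := ext (fun c => subst1 lam (I u c)) (subst1 mu (I v w)).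
Definition jac2 u v w := ext (fun c => subst1 mu (I v c)) (subst1 lam (I u w)).
Definition jac3 u v w :=
  ext (fun c => subst1 (fun p => lam p + mu p) (I c w))
    (subst1 lam (I u v) - subst1 (fun p => - mu p - lmap d p) (I u v)).

Lemma int_toE n (A : lpoly V n -> lpoly V n) u v : int_to I A u v = subst1 A (I u v).
Proof. by apply: eq_lsubst => // w; apply: lcst_unlock. Qed.

Lemma jacobiE b u v w :
  int_to_r I lam u (int_to I mu v w) - b *: int_to_r I mu v (int_to I lam u w)
    - int_to_l I (fun p => lam p + mu p)
        (int_to I lam u v - int_to I (fun p => - mu p - lmap d p) u v) w
  = jac1 u v w - b *: jac2 u v w - jac3 u v w.
Proof.
rewrite /jac1 /jac2 /jac3 -!int_toE; congr (_ - _ *: _ - _);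
  by apply: eq_lsubst => // c; rewrite int_toE.
Qed.

End Defect.

Variable X : chmap d 2.
Local Notation J := (lambda_map X).
Local Notation I := (va_of gr d X).
Hypotheses (cX : is_chiral X) (parX : ch_parity pg true X).
Hypothesis symX : ch_act pg (tperm ord0 ord_max) X = X.
Let K := {fraction {mpoly F[3]}}.
Let h0 : K := (zd o2 o0)^-1 * (zd o2 o1)^-1.
Let g12 : K := (zd o1 o2)^-1.

Let box3_shuf v h : box3 pg X v h =
  ch_act pg (shuf o0)^-1%g (comp3 X X) v h +
  (ch_act pg (shuf o1)^-1%g (comp3 X X) v h +
   ch_act pg (shuf o2)^-1%g (comp3 X X) v h).
Proof. by rewrite box3E sum_shuffles. Qed.

Let lamD : {morph lam : x y / x + y}. Proof. by move=> x y; rewrite lmulD. Qed.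
Let mulD' (i : 'I_2) : {morph (@lmul F V 2 i) : x y / x + y}.
Proof. by move=> x y; rewrite lmulD. Qed.
Let lmD : {morph (fun p => lam p + mu p) : x y / x + y}.
Proof. by move=> x y /=; rewrite !lmulD addrACA. Qed.
Let lmZ a q : lam (a *: q) + mu (a *: q) = a *: (lam q + mu q).
Proof. by rewrite !lmulZ scalerDr. Qed.
Let mdD : {morph (fun p => - mu p - lmap d p) : x y / x + y}.
Proof. by move=> x y /=; rewrite lmulD lmapD !opprD addrACA. Qed.
Let mdZ a q : - mu (a *: q) - lmap d (a *: q) = a *: (- mu q - lmap d q).
Proof.
rewrite lmulZ scalerDr !scalerN; congr (- _ - _).
apply/lcfP => m; rewrite lcf_map ?raddf0 // !lcfZ lcf_map ?raddf0 //.
by rewrite linearZ.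
Qed.

Let IDl w : {morph I^~ w : x y / x + y}.
Proof. by move=> x y /=; have := va_of_linl gr cX 1 x y w; rewrite !scale1r. Qed.
Let IDr u : {morph I u : x y / x + y}.
Proof. by move=> x y /=; have := va_of_linr gr cX 1 u x y; rewrite !scale1r. Qed.

Let par_lin b : forall a u v, hom_par gr b u -> hom_par gr b v ->
  hom_par gr b (a *: u + v).
Proof. by move=> a u v; apply: hom_par_lin. Qed.

Lemma va_of_par a b u v : hom_par gr a u -> hom_par gr b v ->
  coef_in (hom_par gr (a (+) b)) (I u v).
Proof.
move=> hu hv; rewrite (va_of_hom cX _ hu); apply: (coef_inZ (@par_lin _) (hom_par0 gr _)).
exact: (J_par d_even parX).
Qed.

Lemma coef_in_subst1 n (S : set V) (A : lpoly V n -> lpoly V n) p :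
  {morph A : x y / x + y} ->
  (forall a u v, S u -> S v -> S (a *: u + v)) -> S 0 ->
  (forall q, coef_in S q -> coef_in S (A q)) ->
  coef_in S p -> coef_in S (subst1 A p).
Proof.
move=> AD Sl S0 SA; move: p; apply: coef_in_ind => // [p q hp hq|u hu|i p hp].
- by rewrite subst1D //; apply: coef_inD.
- by rewrite subst1_c //; apply: coef_in_cst.
- by rewrite subst1_mul //; apply: SA.
Qed.

(** A composition nests on the left, as X(X(x, y), t), whereas the first two Jacobi terms nest on
    the right. Skew-symmetry of the outer [X] turns one into the other, and its minus sign cancels
    that of [elim_cev_perm]; the remaining signs relate J to I. *)
Let cev_skew (s : 'S_3) i j a1 a2 a3 x y t : s o0 = emb i -> s o2 = emb j ->
  hom_par gr a1 x -> hom_par gr a2 y -> hom_par gr a3 t ->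
  elim_last (sqperm s (cev X t (X (v2 x y) z^-1) g12)) =
  ((-1) ^+ a1 * ((-1) ^+ (~~ (a1 (+) a2) && ~~ a3) * (-1) ^+ a3)) *:
    ext (fun c => subst1 (@lmul F V 2 j) (I t c)) (subst1 (@lmul F V 2 i) (I x y)).
Proof.
move=> s0 s2 hx hy ht; rewrite -eliJ (elim_cev_perm cX _ _ s0).
rewrite (J_hom cX _ hx) subst1Z //; last by move=> q; rewrite lmulZ.
set q := subst1 _ (I x y).
have hq : coef_in (hom_par gr (a1 (+) a2)) q.
  apply: (coef_in_subst1 (mulD' i) (@par_lin _) (hom_par0 gr _)); last exact: va_of_par.
  by move=> p hp; apply: (coef_in_mul (hom_par0 gr _)).
have sI := @perm_inj _ s; have eD := @elim_lastD F V d 2.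
have pD : {morph (fun c => elim_last (sqperm s (ex (X (v2 c t) z^-1)))) : x y / x + y}.
  move=> p r /=; rewrite -eD -(qpermD sI) -exD; congr (elim_last (sqperm _ (ex _))).
  by rewrite -(upd2_0 p) (mlinD _ _ _ _ (ch_mlin cX _)) !upd2_0.
rewrite extZ //; last first.
  move=> k; rewrite -(upd2_0 k) (mlinZ _ _ _ _ (ch_mlin cX _)) !upd2_0.
  by rewrite exZ qpermZ // elim_lastZ.
pose r := (-1) ^+ (~~ (a1 (+) a2) && ~~ a3) * (-1) ^+ a3 : F.
rewrite (eq_ext_in (phi' := fun c => - (r *: subst1 (@lmul F V 2 j) (I t c)))); last first.
  move=> m; rewrite (X_skew cX symX (hq m) ht) -eliJ.
  rewrite (morphDN (@exD _ _ d)) (morphDN (qpermD sI)) (morphDN eD) exZ qpermZ //.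
  rewrite elim_lastZ (elim_perm_eli _ _ s2) (J_hom cX _ ht) subst1Z // ?scalerA //.
  by move=> q'; rewrite lmulZ.
have sD : {morph (fun c => subst1 (@lmul F V 2 j) (I t c)) : x y / x + y}.
  by move=> p k /=; rewrite IDr subst1D.
have -> : (fun c => - (r *: subst1 (@lmul F V 2 j) (I t c)))
    = (fun c => (- r) *: subst1 (@lmul F V 2 j) (I t c)).
  by apply: funext => k; rewrite scaleNr.
by rewrite extZphi // scaleNr scalerN opprK scalerA.
Qed.

(** The shuffles with last image 0, 1, 2 give respectively the terms with u, with v and with w
    outside the inner bracket. *)
Lemma box_jacobi a b e u v w :
  hom_par gr a u -> hom_par gr b v -> hom_par gr e w ->
  elim_last (box3 pg X (v3 u v w) h0) =
    - ((-1) ^+ b *: (jac1 I u v w - (-1) ^+ (a && b) *: jac2 I u v w - jac3 I u v w)).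
Proof.
move=> hu hv hw.
pose c (i : 'I_3) := if i == o0 then ~~ a else if i == o1 then ~~ b else ~~ e.
have hc i : hom_par pg (c i) (v3 u v w i).
  by rewrite ffunE /c; case: (i == o0) => /=; [|case: (i == o1) => /=];
    rewrite /hom_par /= negbK.
have mC := comp3_mlin cX cX.
have eD := @elim_lastD F V d 2.
have G0 : OT_polar polar2 h0.
  by apply: OT_M; apply: OT_zdV; rewrite !inE.
have G12 : OT_polar polar2 g12 by apply: OT_zdV; rewrite !inE.
rewrite box3_shuf.
have T1 : elim_last (ch_act pg (shuf o2)^-1%g (comp3 X X) (v3 u v w) h0)
    = (-1) ^+ b *: jac3 I u v w.
  have s1 : shuf o2 = 1%g.
    apply/permP => i; rewrite perm1; case: (ord3P i) => ->;
    by rewrite ?shuf_max ?shuf_o0 ?shuf_o1; apply: val_inj.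
  rewrite s1 invg1 act1 //.
  rewrite -[h0]mul1r -{1}(zs1 F emb) (comp3E cX cX) //; last exact: OT_1.
  rewrite v3_0 v3_1 v3_2 (elim_cev_one cX) /jac3.
  rewrite (J_hom cX _ hu) !subst1Z //; last by move=> q; rewrite lmulZ.
  rewrite -scalerBr; set q := subst1 _ (I u v) - _.
  have hq : coef_in (hom_par gr (a (+) b)) q.
    have h0' := hom_par0 gr (a (+) b).
    have hI := va_of_par hu hv.
    have hl := @par_lin (a (+) b).
    apply: (coef_inD hl); last apply: (coef_inN hl h0').
      apply: (coef_in_subst1 lamD hl h0') hI => p hp; exact: (coef_in_mul h0').
    apply: (coef_in_subst1 mdD hl h0') hI => p hp.
    apply: (coef_inD hl); apply: (coef_inN hl h0').
      exact: (coef_in_mul h0').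
    by apply: coef_in_map hp => k; apply: d_even.
  have iJ x y : elim_last (ex (X (v2 x y) z^-1))
      = subst1 (fun p => lam p + mu p) (J x y).
    by rewrite -(eliJ X x y) elim_ex_eli.
  have pD : {morph (fun x => elim_last (ex (X (v2 x w) z^-1))) : x y / x + y}.
    by move=> x y /=; rewrite !iJ (JDl cX) subst1D.
  rewrite extZ //; last by move=> k; rewrite !iJ (JZl cX) subst1Z.
  rewrite (eq_ext_in (phi' := fun k => (-1) ^+ (a (+) b) *:
      subst1 (fun p => lam p + mu p) (I k w))); last first.
    by move=> m; rewrite iJ (J_hom cX _ (hq m)) subst1Z.
  rewrite extZphi ?scalerA; last by move=> x y /=; rewrite IDl subst1D.
  by congr (_ *: _); case: (a); case: (b); rewrite /= ?expr0 ?expr1 ?mulrNN ?mulr1 ?mul1r.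
have TS (s : 'S_3) i j x y t a1 a2 a3 E :
    ext (fun c => subst1 (@lmul F V 2 j) (I t c)) (subst1 (@lmul F V 2 i) (I x y)) = E ->
    s o0 = emb i -> s o2 = emb j -> s o1 = o2 ->
    v3 u v w (s o0) = x -> v3 u v w (s o1) = y -> v3 u v w (s o2) = t ->
    hom_par gr a1 x -> hom_par gr a2 y -> hom_par gr a3 t ->
    elim_last (ch_act pg s^-1%g (comp3 X X) (v3 u v w) h0) =
    koszul F s^-1%g c *: (((-1) ^+ a1 * ((-1) ^+ (~~ (a1 (+) a2) && ~~ a3) * (-1) ^+ a3)) *: E).
  move=> <- s0 s2 s1 ex ey et hx hy ht; rewrite (act_hom _ _ mC hc) elim_lastZ invgK.
  congr (_ *: _); rewrite -(cev_skew s0 s2 hx hy ht); congr (elim_last (sqperm _ _)).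
  (* Since [s] sends 1 to 2, the common index 2 of both poles becomes 1: one pole lies inside the
     inner pair, the other between z_1 and z_2. *)
  have zh : zs s^-1%g h0 = (zd o1 o0)^-1 * g12.
    have zV (k l : 'I_3) : k != l -> zdom s^-1%g ((zd k l)^-1 : K) /\
        zs s^-1%g ((zd k l)^-1 : K) = (zd (s^-1%g k) (s^-1%g l))^-1.
      by move=> ne; apply: zs_zdV; rewrite (inj_eq perm_inj).
    have [n1 z1] := zV o2 o0 isT; have [n2 z2] := zV o2 o1 isT.
    rewrite zsM // z1 z2 (perm_eqV s1).
    move: s0 s2; case: (ord2_eq i) => ->; case: (ord2_eq j) => ->;
      rewrite ?emb0 ?emb1 => s0 s2.
    - by have := perm_inj (etrans s0 (esym s2)).
    - by rewrite (perm_eqV s0) (perm_eqV s2).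
    - by rewrite (perm_eqV s0) (perm_eqV s2) mulrC.
    - by have := perm_inj (etrans s0 (esym s2)).
  rewrite zh -[(zd o1 o0)^-1]expr1 exprVn (comp3Z cX cX) // expr1.
  have ev k : vperm s^-1%g (v3 u v w) k = v3 u v w (s k) by rewrite ffunE invgK.
  by rewrite !ev ex ey et.
have eD3 (x y t : lquot d 3) : elim_last (x + (y + t)) = elim_last x + (elim_last y + elim_last t).
  by rewrite !eD.
have l00 : lift o0 (ord0 : 'I_2) = o1 by apply: val_inj.
have l01 : lift o0 (ord_max : 'I_2) = o2 by apply: val_inj.
have l10 : lift o1 (ord0 : 'I_2) = o0 by apply: val_inj.
have l11 : lift o1 (ord_max : 'I_2) = o2 by apply: val_inj.
have p00 : shuf o0 o0 = o1 by rewrite shuf_o0.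
have p01 : shuf o0 o1 = o2 by rewrite shuf_o1.
have p10 : shuf o1 o0 = o0 by rewrite shuf_o0.
have p11 : shuf o1 o1 = o2 by rewrite shuf_o1.
have T3 := TS (shuf o0) ord_max ord0 v w u b e a (jac1 I u v w) erefl.
rewrite p00 p01 shuf_max emb0 emb1 v3_0 v3_1 v3_2 in T3.
have {}T3 := T3 erefl erefl erefl erefl erefl erefl hv hw hu.
have T2 := TS (shuf o1) ord0 ord_max u w v a e b (jac2 I u v w) erefl.
rewrite p10 p11 shuf_max emb0 emb1 v3_0 v3_1 v3_2 in T2.
have {}T2 := T2 erefl erefl erefl erefl erefl erefl hu hw hv.
have e3 (x y t x' y' t' : lpoly V 2) : x = x' -> y = y' -> t = t' ->
    x + (y + t) = x' + (y' + t') by move=> -> -> ->.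
rewrite eD3; apply: (etrans (e3 _ _ _ _ _ _ T3 T2 T1)).
move: (jac1 _ _ _ _) (jac2 _ _ _ _) (jac3 _ _ _ _) => j1 j2 j3.
rewrite !scalerA !koszul3.
rewrite (perm_eqV p00) (perm_eqV p01) (perm_eqV (shuf_max o0)).
rewrite (perm_eqV p10) (perm_eqV p11) (perm_eqV (shuf_max o1)) /c /=.
(* The parity [e] of [w] cancels in both coefficients, as the cases show. *)
rewrite [X in X *: j1](_ : _ = - (-1) ^+ b); last first.
  by case: (a); case: (b); case: (e) => /=; ring.
rewrite [X in X *: j2](_ : _ = (-1) ^+ b * (-1) ^+ (a && b)); last first.
  by case: (a); case: (b); case: (e) => /=; ring.
rewrite scaleNr !scalerBr scalerA !opprB.
by rewrite addrA [- _ + _]addrC addrC.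
Qed.

End Jacobi.

(** Needed because the Jacobi identity is required for an arbitrary third vector, while [box_jacobi]
    treats homogeneous ones. *)
Lemma hom_ext0 (F : fieldType) (V : lmodType F) (gr : superspace V) (M : zmodType)
    (f : V -> M) : {morph f : x y / x + y} ->
  (forall e w, hom_par gr e w -> f w = 0) -> forall w, f w = 0.
Proof.
move=> fD f0 w; rewrite [w](prE gr) fD.
by rewrite (f0 _ _ (hom_pr gr false w)) (f0 _ _ (hom_pr gr true w)) addr0.
Qed.

Section FromChiral.
Variables (F : fieldType) (charF0 : [pchar F] =i pred0).
Variables (V : lmodType F) (gr : superspace V) (d : {linear V -> V}).
Hypothesis d_even : even_endo gr d.
Local Notation pg := (parity_shift gr).
Local Notation z := (@zd F 2 ord_max ord0).
Variable X : chmap d 2.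
Local Notation J := (lambda_map X).
Local Notation I := (va_of gr d X).
Hypothesis cX : is_chiral X.

Let Oz : OstarT z^-1. Proof. exact: OstarT_zdV. Qed.

Lemma lderiv_J u v : lderiv ord0 (J u v) = elim_last (X (v2 u v) 1).
Proof.
rewrite /lambda_map -elim_last_deriv lift1_ord0 -(ch_z cX) //.
by rewrite mulfV // z_neq0.
Qed.

Let O1 : OstarT (1 : {fraction {mpoly F[2]}}). Proof. exact: OT_1. Qed.

Let lderivD0 := @lderivD F V 1 ord0.

Lemma lderiv_Jdl u v :
  lderiv ord0 (J (d u) v) = - lmul ord0 (lderiv ord0 (J u v)).
Proof.
have := ch_d cX (v2 u v) ord0 O1; rewrite upd2_0 v2_0 fd1 (ch_f0 cX).
move/eqP; rewrite addr_eq0 => /eqP e; rewrite !lderiv_J e.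
rewrite (morphDN (@elim_lastD _ _ d 1)) elim_last_mul.
by rewrite last_op_ord0.
Qed.

Lemma lderiv_Jdr u v : lderiv ord0 (J u (d v))
  = lmap d (lderiv ord0 (J u v)) + lmul ord0 (lderiv ord0 (J u v)).
Proof.
have := ch_d cX (v2 u v) ord_max O1; rewrite upd2_1 v2_1 fd1 (ch_f0 cX).
move/eqP; rewrite addr_eq0 => /eqP e; rewrite !lderiv_J e.
rewrite (morphDN (@elim_lastD _ _ d 1)) elim_last_mul last_op_max big_ord1.
by rewrite opprD !opprK addrC.
Qed.

(** Add [chiral_d] in both slots at 1/z: the right-hand sides cancel, as d/dz_1 + d/dz_2 kills
    1/z. *)
Lemma lmap_J u v : lmap d (J u v) = J (d u) v + J u (d v).
Proof.
have := ch_d cX (v2 u v) ord0 Oz; have := ch_d cX (v2 u v) ord_max Oz.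
rewrite upd2_1 v2_1 upd2_0 v2_0 => e1 e2.
have e : fd ord0 (z^-1) + fd ord_max (z^-1) = 0.
  rewrite -(enum2 (fun i => fd i (z^-1))).
  by apply: (OT_fd_sum _ Oz) => e; apply: ltpairs_neq.
have : X (v2 u v) (fd ord0 z^-1 + fd ord_max z^-1) = 0 by rewrite e (ch_f0 cX).
rewrite (ch_fD cX); [|exact: OstarT_fd..]; rewrite -e1 -e2 addrACA.
move/(congr1 (@elim_last F V d 1)); have eD := @elim_lastD F V d 1.
rewrite (morphD0 eD) !eD !elim_last_mul last_op_ord0.
rewrite last_op_max big_ord1 addNKr => /eqP; rewrite subr_eq0 => /eqP <-.
by [].
Qed.

Lemma lmap_va u v : lmap d (I u v) = I (d u) v + I u (d v).
Proof.
rewrite !va_ofE (morphD_sum _ _ _ (lmapdD d (n := 1))) -big_split.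
apply: eq_bigr => b _ /=; rewrite (even_endo_pr d_even) -scalerDr -lmap_J.
apply/lcfP => m; rewrite lcf_map ?raddf0 // !lcfZ lcf_map ?raddf0 //.
by rewrite linearZ.
Qed.

Let lbr u v : lbracket I u v = \sum_(b : bool) (-1) ^+ b *: lderiv ord0 (J (pr gr b u) v).
Proof.
rewrite /lbracket va_ofE (morphD_sum _ _ _ lderivD0).
by apply: eq_bigr => b _; rewrite lderivZ.
Qed.

Lemma va_of_dl u v : lbracket I (d u) v = - lmul ord0 (lbracket I u v).
Proof.
rewrite !lbr (morphD_sum _ _ _ (@lmulD F V 1 ord0)) -sumrN.
apply: eq_bigr => b _; rewrite (even_endo_pr d_even) lderiv_Jdl lmulZ.
by rewrite scalerN.
Qed.

Lemma lmapdZ n a (p : lpoly V n) : lmap d (a *: p) = a *: lmap d p.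
Proof.
apply/lcfP => m; rewrite lcf_map ?raddf0 // !lcfZ lcf_map ?raddf0 //.
by rewrite linearZ.
Qed.

Lemma va_of_dr u v : lbracket I u (d v)
  = lmap d (lbracket I u v) + lmul ord0 (lbracket I u v).
Proof.
rewrite !lbr (morphD_sum _ _ _ (@lmulD F V 1 ord0)).
rewrite (morphD_sum _ _ _ (lmapdD d (n := 1))) -big_split.
apply: eq_bigr => b _ /=.
by rewrite lderiv_Jdr lmulZ lmapdZ scalerDr.
Qed.

Hypothesis parX : ch_parity pg true X.
Hypothesis symX : ch_act pg (tperm ord0 ord_max) X = X.

Let sk (p : lpoly V 1) : lpoly V 1 := - lmul ord0 p - lmap d p.
Let skD : {morph sk : x y / x + y}.
Proof. by move=> x y /=; rewrite /sk lmulD lmapD !opprD addrACA. Qed.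
Let skZ a q : sk (a *: q) = a *: sk q.
Proof. by rewrite /sk lmulZ lmapdZ scalerBr scalerN. Qed.

(** After elimination, the exchange of lambda_1 and lambda_2 is the substitution of - lambda - d for
    lambda. *)
Lemma elim_perm2 p : elim_last (sqperm (tperm ord0 ord_max) (elim_last_inv d p))
  = subst1 sk p.
Proof.
have tI := @perm_inj _ (tperm (ord0 : 'I_2) ord_max).
have iD := @elim_last_invD F V d 1.
move: p; apply: lpoly_eqfun => [p q|p q|u|i p hp] /=.
- by rewrite iD qpermD // elim_lastD.
- exact: subst1D.
- by rewrite elim_last_inv_c qperm_c // elim_last_c subst1_c.
- rewrite eli_mul qperm_mul // tpermL elim_last_mul last_op_max big_ord1 hp.
  by rewrite subst1_mul.
Qed.

Lemma va_of_skew a b u v : hom_par gr a u -> hom_par gr b v ->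
  I v u = (-1) ^+ (a && b) *: int_to I sk u v.
Proof.
move=> hu hv; rewrite int_toE (va_of_hom cX _ hv) (va_of_hom cX _ hu).
rewrite subst1Z // {1}/lambda_map (X_skew cX symX hv hu) -eliJ.
rewrite (morphDN (@elim_lastD _ _ d 1)) elim_lastZ elim_perm2.
rewrite scalerN !scalerA -scaleNr; congr (_ *: _).
by case: (a); case: (b) => /=; ring.
Qed.

Let IDl w : {morph I^~ w : x y / x + y}.
Proof. by move=> x y /=; have := va_of_linl gr cX 1 x y w; rewrite !scale1r. Qed.
Let IDr u : {morph I u : x y / x + y}.
Proof. by move=> x y /=; have := va_of_linr gr cX 1 u x y; rewrite !scale1r. Qed.

Let mD (i : 'I_2) : {morph (@lmul F V 2 i) : x y / x + y}.
Proof. by move=> x y; rewrite lmulD. Qed.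
Let lmD : {morph (fun p => @lmul F V 2 ord0 p + @lmul F V 2 ord_max p) : x y / x + y}.
Proof. by move=> x y /=; rewrite !lmulD addrACA. Qed.

Lemma jac1D u v w w' : jac1 I u v (w + w') = jac1 I u v w + jac1 I u v w'.
Proof.
rewrite /jac1 IDr subst1D // extD // => x y.
by rewrite IDr subst1D.
Qed.

Lemma jac2D u v w w' : jac2 I u v (w + w') = jac2 I u v w + jac2 I u v w'.
Proof.
rewrite /jac2 IDr subst1D // extD // => x y.
by rewrite IDr subst1D.
Qed.

Lemma jac3D u v w w' :
  jac3 d I u v (w + w') = jac3 d I u v w + jac3 d I u v w'.
Proof.
rewrite /jac3 -extDphi; last 2 first.
- by move=> x y /=; rewrite IDl subst1D.
- by move=> x y /=; rewrite IDl subst1D.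
congr ext; apply: funext => c.
by rewrite IDr subst1D.
Qed.

Lemma va_of_nuva : box pg X X = 0 -> is_nuva gr d I.
Proof.
move=> box0; split.
- exact: va_of_linl.
- exact: va_of_linr.
- move=> a b u v hu hv m; have := va_of_par d_even cX parX hu hv m.
  by rewrite lcf.unlock.
- exact: va_of_dl.
- exact: va_of_dr.
- move=> u v; have := congr1 (lcf 0%MM) (lmap_va u v).
  by rewrite lcf_map ?raddf0 // lcfD /nprod lcf.unlock.
- exact: va_of_skew.
- move=> a b u v w hu hv; rewrite jacobiE.
  have key e w' : hom_par gr e w' ->
      jac1 I u v w' - (-1) ^+ (a && b) *: jac2 I u v w' - jac3 d I u v w' = 0.
    move=> hw; have := box_jacobi d_even cX parX symX hu hv hw.
    have -> : box3 pg X = 0 := box0.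
    have -> : (0 : chmap d 3) (v3 u v w') ((zd o2 o0)^-1 * (zd o2 o1)^-1) = 0 by [].
    rewrite (morphD0 (@elim_lastD _ _ d 2)) => /esym/eqP.
    by rewrite oppr_eq0 scaler_eq0 signr_eq0 => /eqP.
  move: w; apply: (hom_ext0 (gr := gr) _ key) => w1 w2.
  by rewrite jac1D jac2D jac3D scalerDr !opprD [X in X + _ = _]addrACA [LHS]addrACA.
Qed.

Lemma box_of_nuva : is_nuva gr d I -> box pg X X = 0.
Proof.
move=> nI; apply: (box3_eq0 charF0 (pg_even d_even) cX symX) => c v hc.
have h i b : hom_par pg b (v i) -> hom_par gr (~~ b) (v i) by [].
have h0 := h _ _ (hc o0); have h1 := h _ _ (hc o1); have h2 := h _ _ (hc o2).
apply: (@elim_last_inj F V d 2); rewrite (v3E v).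
rewrite (box_jacobi d_even cX parX symX h0 h1 h2) -jacobiE.
by rewrite (nuva_jacobi nI) // scaler0 oppr0 (morphD0 (@elim_lastD _ _ d 2)).
Qed.

End FromChiral.

(** * From vertex algebras to chiral operations *)

Section Generation.
Variables (F : fieldType) (charF0 : [pchar F] =i pred0).
Local Notation K := {fraction {mpoly F[2]}}.
Local Notation z := (@zd F 2 ord_max ord0).

Lemma fd0_zVX N : fd ord0 (z^-1 ^+ N.+1) = fc 2 N.+1%:R * z^-1 ^+ N.+2.
Proof.
have e : fd ord0 z^-1 = z^-1 ^+ 2.
  by rewrite fdV ?z_neq0 // fd_zd eqxx sub0r mulN1r mulNr opprK -expr2.
elim: N => [|N IH]; first by rewrite expr1 e fc1 mul1r.
rewrite exprS fdM IH e -[N.+2]add1n natrD fcD fc1 mulrDl mul1r add1n.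
by rewrite -exprD add2n mulrCA -exprS.
Qed.

Lemma OstarT2_gen (P : K -> Prop) :
  (forall f, OstarT f -> P f -> P (fd ord0 f)) ->
  (forall f, OstarT f -> P f -> P (z * f)) ->
  (forall a f, OstarT f -> P f -> P (fc 2 a * f)) ->
  (forall f g, OstarT f -> OstarT g -> P f -> P g -> P (f + g)) ->
  P z^-1 -> forall f, OstarT f -> P f.
Proof.
move=> Pd Pz Pc PD P1 f /OstarT2P[N [p ->]].
have OV M : OstarT (z^-1 ^+ M) by apply/OT_X/OstarT_zdV.
have Oz : OstarT z by apply: OT_zd.
have PV M : P (z^-1 ^+ M.+1).
  elim: M => [|M IH]; first by rewrite expr1.
  have := Pc M.+1%:R^-1 _ (OstarT_fd ord0 (OV M.+1)) (Pd _ (OV M.+1) IH).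
  by rewrite fd0_zVX mulrA -fcM mulVf ?fc1 ?mul1r // nat_neq0.
have Opz (r : {poly F}) : OstarT (pz r) by apply/OstarT2P; exists 0%N, r; rewrite divr1.
(* One extra factor z in numerator and denominator makes the exponent positive, since [PV] covers
   only actual poles. *)
have -> : pz p / z ^+ N = pz (p * 'X) * z^-1 ^+ N.+1.
  rewrite pzM pzX exprS -mulrA [z * _]mulrA mulfV ?z_neq0 // mul1r.
  by rewrite exprVn.
elim/poly_ind: (p * 'X) => [|q c IH].
  by rewrite pz0 mul0r -[0](mul0r z^-1) -(fc0 F 2); apply: Pc => //; apply: (OV 1%N).
rewrite pzD pzM pzX pzC mulrDl; apply: PD; try exact: OstarT_M.
- by do ?apply: OstarT_M.
- by apply: OstarT_M => //; apply: OT_c.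
- by rewrite mulrAC mulrC; apply: Pz => //; apply: OstarT_M.
- exact: Pc.
Qed.

(** Polynomials must be reached from 1 without passing through 1/z, whose values satisfy only the
    weaker filtration bound. *)
Lemma OT2_poly_gen (P : K -> Prop) :
  (forall f, OstarT f -> P f -> P (z * f)) ->
  (forall a f, OstarT f -> P f -> P (fc 2 a * f)) ->
  (forall f g, OstarT f -> OstarT g -> P f -> P g -> P (f + g)) ->
  P 1 -> forall f, OT_polar finset.set0 f -> P f.
Proof.
move=> Pz Pc PD P1 f hf; have O1 : OstarT (1 : K) by apply: OT_1.
have sub g : OT_polar finset.set0 g -> OstarT g.
  by apply: OT_sub; apply: finset.sub0set.
suff key : forall g, OT_polar finset.set0 g -> forall h, OstarT h -> P h -> P (g * h).
  by rewrite -[f]mulr1; apply: key.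
apply: OT_ind => [a|g g' hg hg' Pg Pg'|g g' hg hg' Pg Pg'|i j lt|e eE] h Oh Ph.
- exact: Pc.
- rewrite mulrDl; apply: PD; [|by apply: OstarT_M; first exact: sub..| |].
  + by apply: OstarT_M => //; apply: sub.
  + exact: Pg.
  + exact: Pg'.
- rewrite -mulrA; apply: Pg; last exact: Pg'.
  by apply: OstarT_M => //; apply: sub.
- have ne : i != j by rewrite neq_ltn lt.
  have Ozh : OstarT (z * h) by apply: OstarT_M => //; apply: OT_zd.
  case: (zd2 F ne) => ->; first exact: Pz.
  by rewrite mulNr -mulN1r -fc1 -fcN; apply: Pc => //; apply: Pz.
- by rewrite inE in eE.
Qed.

Section Ext.
Variables (U : lmodType F) (d : {linear U -> U}).

Lemma chiral2_ext (A B : chmap d 2) : is_chiral A -> is_chiral B ->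
  (forall v, A v z^-1 = B v z^-1) -> A = B.
Proof.
move=> cA cB e; apply/funext => v; apply/funext => f.
have [Of|nOf] := pselect (OstarT f); last by rewrite (ch_out cA) // (ch_out cB).
move: f Of v; apply: OstarT2_gen => [f Of Pf v|f Of Pf v|a f Of Pf v|f g Of Og Pf Pg v|//].
- by rewrite -(ch_d cA) // -(ch_d cB) // !Pf.
- by rewrite (ch_z cA) // (ch_z cB) // Pf.
- by rewrite (ch_fZ cA) // (ch_fZ cB) // Pf.
- by rewrite (ch_fD cA) // (ch_fD cB) // Pf Pg.
Qed.

Variable X : chmap d 2.
Hypothesis cX : is_chiral X.
Variable S : set U.
Hypothesis S_lin : forall a u v, S u -> S v -> S (a *: u + v).
Hypothesis S_0 : S 0.
Hypothesis S_d : forall u, S u -> S (d u).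
Let Sd2 (x : lquot d 2) : qcoef_in S x <-> coef_in S (elim_last x).
Proof. exact: (@qcoef_inP F U S S_lin S_0 1 d x S_d). Qed.

Let coef_z (x : lquot d 2) : coef_in S (elim_last x) ->
  coef_in S (elim_last (sqderivB ord0 ord_max x)).
Proof.
rewrite -lift1_ord0 elim_last_deriv; exact: (coef_in_deriv S_lin S_0).
Qed.

Lemma coef_in_chiral (A : set U) v : (forall u, A u -> A (d u)) ->
  (forall u, A u -> coef_in S (lambda_map X u v)) ->
  forall f u, OstarT f -> A u -> qcoef_in S (X (v2 u v) f).
Proof.
move=> Ad AJ f u Of Au; apply/Sd2; move: f Of u Au.
apply: OstarT2_gen => [f Of Pf u Au|f Of Pf u Au|a f Of Pf u Au|f g Of Og Pf Pg u Au|u Au].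
- rewrite -(ch_d cX) // upd2_0 v2_0 elim_lastD; apply: (coef_inD S_lin).
    exact: (Pf _ (Ad _ Au)).
  rewrite elim_last_mul last_op_ord0; exact: (coef_in_mul S_0 _ (Pf _ Au)).
- by rewrite (ch_z cX) //; apply: (coef_z (Pf _ Au)).
- by rewrite (ch_fZ cX) // elim_lastZ; apply: (coef_inZ S_lin S_0 _ (Pf _ Au)).
- by rewrite (ch_fD cX) // elim_lastD; apply: (coef_inD S_lin); [apply: Pf|apply: Pg].
- exact: AJ.
Qed.

Lemma coef_in_chiral_poly u v : coef_in S (lderiv ord0 (lambda_map X u v)) ->
  forall f, OT_polar finset.set0 f -> qcoef_in S (X (v2 u v) f).
Proof.
move=> hJ f Of; apply/Sd2; move: f Of.
apply: OT2_poly_gen => [f Of Pf|a f Of Pf|f g Of Og Pf Pg|].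
- by rewrite (ch_z cX) //; apply: coef_z.
- by rewrite (ch_fZ cX) // elim_lastZ; apply: (coef_inZ S_lin S_0).
- by rewrite (ch_fD cX) // elim_lastD; apply: (coef_inD S_lin).
- by rewrite -lderiv_J.
Qed.

End Ext.
End Generation.

(** The action of p(z) forced by [chiral_z]: z = z_2 - z_1 acts as the difference D of the
    derivatives in lambda_1 and lambda_2. *)
HB.lock Definition poly_act (F : fieldType) (U : lmodType F)
    (d : {linear U -> U}) (p : {poly F}) (x : lquot d 2) : lquot d 2 :=
  \sum_(i < size p) p`_i *: iter i (sqderivB ord0 ord_max) x.

Section PolyAction.
Variables (F : fieldType) (U : lmodType F) (d : {linear U -> U}).
Local Notation D := (@sqderivB F U d 2 ord0 ord_max).
Local Notation poly_act := (@poly_act F U d).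
Implicit Types (p q : {poly F}) (x y : lquot d 2).

Let DD := @qderivBD F U d 2 ord0 ord_max.

Lemma poly_actE n p x : (size p <= n)%N ->
  poly_act p x = \sum_(i < n) p`_i *: iter i D x.
Proof.
move=> le; rewrite poly_act.unlock (big_ord_widen n (fun i => p`_i *: iter i D x)) //.
rewrite big_mkcond; apply: eq_bigr => i _; case: ltnP => // h.
by rewrite nth_default // scale0r.
Qed.

Lemma poly_act0 x : poly_act 0 x = 0.
Proof. by rewrite poly_act.unlock size_poly0 big_ord0. Qed.

Lemma poly_actD p q x : poly_act (p + q) x = poly_act p x + poly_act q x.
Proof.
rewrite !(@poly_actE (maxn (size p) (size q))) ?leq_maxl ?leq_maxr //.
  by rewrite -big_split; apply: eq_bigr => i _; rewrite coefD scalerDl.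
exact: size_polyD.
Qed.

Lemma poly_act_MXaddC p c x :
  poly_act (p * 'X + c%:P) x = poly_act p (D x) + c *: x.
Proof.
rewrite (@poly_actE (size p).+1); last first.
  apply: leq_trans (size_polyD _ _) _; rewrite geq_max.
  rewrite (leq_trans (size_polyC_leq1 _)) // andbT.
  have [->|p0] := eqVneq p 0; first by rewrite mul0r size_poly0.
  by rewrite size_mulX.
rewrite big_ord_recl /= coefD coefMX coefC /= add0r addrC; congr (_ + _).
rewrite poly_act.unlock; apply: eq_bigr => i _.
by rewrite coefD coefMX coefC /= addr0 -iterSr.
Qed.

Lemma poly_actC c x : poly_act c%:P x = c *: x.
Proof. by rewrite -[c%:P]add0r -(mul0r 'X) poly_act_MXaddC poly_act0 add0r. Qed.

Lemma poly_act1 x : poly_act 1 x = x.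
Proof. by rewrite poly_actC scale1r. Qed.

Lemma poly_act_MX p x : poly_act (p * 'X) x = poly_act p (D x).
Proof. by rewrite -[p * 'X]addr0 poly_act_MXaddC scale0r addr0. Qed.

Lemma poly_actDr p x y : poly_act p (x + y) = poly_act p x + poly_act p y.
Proof.
elim/poly_ind: p x y => [|p c IH] x y; first by rewrite !poly_act0 addr0.
by rewrite !poly_act_MXaddC DD IH scalerDr addrACA.
Qed.

Lemma poly_actZr p a x : poly_act p (a *: x) = a *: poly_act p x.
Proof.
elim/poly_ind: p x => [|p c IH] x; first by rewrite !poly_act0 scaler0.
by rewrite !poly_act_MXaddC qderivBZ IH scalerDr !scalerA mulrC.
Qed.

Lemma poly_actZl p a x : poly_act (a *: p) x = a *: poly_act p x.
Proof.
elim/poly_ind: p x => [|p c IH] x; first by rewrite scaler0 !poly_act0 scaler0.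
rewrite scalerDr scalerAl -[a *: c%:P]mul_polyC -polyCM !poly_act_MXaddC IH.
by rewrite scalerDr scalerA.
Qed.

Lemma poly_act_deriv p x : poly_act p (D x) = D (poly_act p x).
Proof.
elim/poly_ind: p x => [|p c IH] x; first by rewrite !poly_act0 (morphD0 DD).
by rewrite !poly_act_MXaddC IH DD qderivBZ.
Qed.

(** The commutator of D with lambda_1 is 1, hence that of p(D) is p'(D). *)
Lemma poly_act_mul0 p x :
  poly_act p (sqmul ord0 x) = sqmul ord0 (poly_act p x) + poly_act p^`() x.
Proof.
elim/poly_ind: p x => [|p c IH] x; first by rewrite deriv0 !poly_act0 qmul0 addr0.
rewrite !poly_act_MXaddC qderivB_mul /= mulr1n mulr0n subr0 poly_actDr IH.
rewrite derivD derivM derivX derivC addr0 mulr1 poly_actD poly_act_MX.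
by rewrite qmulD qmulZ -[X in X + _ = _]addrA addrAC.
Qed.

Lemma poly_act_r0 p : poly_act p 0 = 0.
Proof. exact: (morphD0 (poly_actDr p)). Qed.

(** D commutes with lambda_1 + lambda_2, the two commutators being opposite. *)
Lemma poly_act_tot p x :
  poly_act p (sqmul ord0 x + sqmul ord_max x)
    = sqmul ord0 (poly_act p x) + sqmul ord_max (poly_act p x).
Proof.
elim/poly_ind: p x => [|p c IH] x; first by rewrite !poly_act0 !qmul0 addr0.
rewrite !poly_act_MXaddC DD !qderivB_mul /= !mulr1n !mulr0n subr0 sub0r.
rewrite addrACA subrr addr0 IH !qmulD !qmulZ scalerDr.
exact: addrACA.
Qed.

End PolyAction.

Section ToChiral.
Variables (F : fieldType) (charF0 : [pchar F] =i pred0).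
Variables (V : lmodType F) (gr : superspace V) (d : {linear V -> V}).
Hypothesis d_even : even_endo gr d.
Local Notation pg := (parity_shift gr).
Local Notation K := {fraction {mpoly F[2]}}.
Local Notation z := (@zd F 2 ord_max ord0).
Local Notation D := (@sqderivB F V d 2 ord0 ord_max).
Variable I : V -> V -> lpoly V 1.
Hypothesis nI : is_nuva gr d I.

(* Undoes the sign (-1)^p(u) of [va_of]. *)
Definition unsign (u v : V) : lpoly V 1 :=
  \sum_(b : bool) (-1) ^+ b *: I (pr gr b u) v.

Let Q u v : lquot d 2 := elim_last_inv d (unsign u v).

Let IDl u u' v : I (u + u') v = I u v + I u' v.
Proof. by have := nuva_linl nI 1 u u' v; rewrite !scale1r. Qed.
Let IDr u v v' : I u (v + v') = I u v + I u v'.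
Proof. by have := nuva_linr nI 1 u v v'; rewrite !scale1r. Qed.
Let I0l v : I 0 v = 0.
Proof. by apply: (addrI (I 0 v)); rewrite -IDl !addr0. Qed.

Lemma unsign_hom a u v : hom_par gr a u -> unsign u v = (-1) ^+ a *: I u v.
Proof.
move=> hu; rewrite /unsign (bigD1 a) //= hu big1 ?addr0 // => b nb.
by rewrite (pr_par _ hu) (negPf nb) I0l scaler0.
Qed.

Let unsign_linl a u u' v : unsign (a *: u + u') v = a *: unsign u v + unsign u' v.
Proof.
rewrite scaler_sumr -big_split; apply: eq_bigr => b _ /=.
by rewrite linearP (nuva_linl nI) scalerDr !scalerA mulrC.
Qed.

Let unsign_linr a u v v' : unsign u (a *: v + v') = a *: unsign u v + unsign u v'.
Proof.
rewrite scaler_sumr -big_split; apply: eq_bigr => b _ /=.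
by rewrite (nuva_linr nI) scalerDr !scalerA mulrC.
Qed.

Lemma lderivC_lmap n i (p : lpoly V n) : lderiv i (lmap d p) = lmap d (lderiv i p).
Proof.
apply/lcfP => m; rewrite lcf_deriv !lcf_map ?raddf0 // lcf_deriv.
by rewrite raddfMn.
Qed.

(** The two bracket axioms give the derivative in lambda of this identity, and the axiom on products
    its constant term; characteristic 0 recovers the other coefficients from the derivative. *)
Let lmap_I u v : lmap d (I u v) = I (d u) v + I u (d v).
Proof.
have e : lderiv ord0 (lmap d (I u v)) = lderiv ord0 (I (d u) v + I u (d v)).
  have := nuva_dl nI u v; have := nuva_dr nI u v; rewrite /lbracket.
  by rewrite lderivD lderivC_lmap => -> ->; rewrite addrC addrK.
have e0 : lcf 0%MM (lmap d (I u v)) = lcf 0%MM (I (d u) v + I u (d v)).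
  rewrite lcf_map ?raddf0 // lcfD.
  by have := nuva_dprod nI u v; rewrite /nprod lcf.unlock.
apply/lcfP => m; have [->//|m0] := eqVneq m 0%MM.
have [i em mi] := mnm_neq0 m0; have := congr1 (lcf (m - U_(i))%MM) e.
rewrite (ord1 i) in em mi *; rewrite !lcf_deriv -em => e'.
apply: (scalerI (nat_neq0 charF0 ((m - U_(ord0))%MM ord0))).
by rewrite !scaler_nat.
Qed.

Let lmap_unsign u v : lmap d (unsign u v) = unsign (d u) v + unsign u (d v).
Proof.
rewrite (morphD_sum _ _ _ (lmapdD d (n := 1))) -big_split.
apply: eq_bigr => b _ /=.
by rewrite (even_endo_pr d_even) -scalerDr -lmap_I lmapdZ.
Qed.

Let iD := @elim_last_invD F V d 1.

Let iZ a p : elim_last_inv d (a *: p) = a *: elim_last_inv d p :> lquot d 2.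
Proof. by apply: (@elim_last_inj F V d 1); rewrite elim_lastZ !elim_last_invK. Qed.

Let Q_linl a u u' v : Q (a *: u + u') v = a *: Q u v + Q u' v.
Proof. by rewrite /Q unsign_linl iD iZ. Qed.

Let Q_linr a u v v' : Q u (a *: v + v') = a *: Q u v + Q u v'.
Proof. by rewrite /Q unsign_linr iD iZ. Qed.

Let Q_d u v : Q (d u) v + Q u (d v) + (sqmul ord0 (Q u v) + sqmul ord_max (Q u v)) = 0.
Proof.
by rewrite -iD -lmap_unsign elim_last_inv_map enum2 addNr.
Qed.

Let DQ p : D (elim_last_inv d p) = elim_last_inv d (lderiv ord0 p).
Proof.
apply: (@elim_last_inj F V d 1).
by rewrite -{1}lift1_ord0 elim_last_deriv !elim_last_invK.
Qed.

(** This is [chiral_d] in the first slot at the function 1 = z (1/z). *)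
Let DQ_d u v : D (Q (d u) v) + sqmul ord0 (D (Q u v)) = 0.
Proof.
rewrite !DQ -(eli_mul d ord0) -iD -[RHS](morphD0 iD); congr elim_last_inv.
rewrite !(morphD_sum _ _ _ (@lderivD F V 1 ord0)).
rewrite (morphD_sum _ _ _ (@lmulD F V 1 ord0)) -big_split big1 // => b _ /=.
rewrite (even_endo_pr d_even) !lderivZ lmulZ -scalerDr.
by have := nuva_dl nI (pr gr b u) v; rewrite /lbracket => ->; rewrite addNr scaler0.
Qed.

(* The value at z_21^(-1-N), forced by d/dz_1 z_21^(-N) = N z_21^(-1-N). *)
Fixpoint polar_value N u v : lquot d 2 :=
  if N is M.+1 then
    M.+1%:R^-1 *: (polar_value M (d u) v + sqmul ord0 (polar_value M u v))
  else Q u v.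

Let nz N := nat_neq0 charF0 N.

Lemma polar_valueS N u v : N.+1%:R *: polar_value N.+1 u v
  = polar_value N (d u) v + sqmul ord0 (polar_value N u v).
Proof. by rewrite /= scalerA mulfV ?scale1r // nz. Qed.

Lemma polar_value_linl N a u u' v :
  polar_value N (a *: u + u') v = a *: polar_value N u v + polar_value N u' v.
Proof.
elim: N u u' => [|N IH] u u' /=; first exact: Q_linl.
rewrite linearP !IH qmulD qmulZ addrACA.
by rewrite -scalerDr [LHS]scalerDr !scalerA mulrC.
Qed.

Lemma polar_value_linr N a u v v' :
  polar_value N u (a *: v + v') = a *: polar_value N u v + polar_value N u v'.
Proof.
elim: N u => [|N IH] u /=; first exact: Q_linr.
rewrite !IH qmulD qmulZ addrACA.
by rewrite -scalerDr [LHS]scalerDr !scalerA mulrC.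
Qed.

(** Consistency of multiplication by z with the forced values: the commutator of D with lambda_1
    supplies the missing unit in N+2 = (N+1) + 1, and [DQ_d] starts the induction. *)
Lemma D_polar_value N u v : D (polar_value N.+1 u v) = polar_value N u v.
Proof.
elim: N u => [|N IH] u.
  apply: (scalerI (nz 0)); rewrite -qderivBZ (polar_valueS 0).
  by rewrite qderivBD qderivB_mul addrA DQ_d /= mulr1n mulr0n subr0 add0r scale1r.
apply: (scalerI (nz N.+1)); rewrite -qderivBZ (polar_valueS N.+1).
rewrite qderivBD qderivB_mul !IH addrA -(polar_valueS N) eqxx.
rewrite (_ : (ord_max == ord0 :> 'I_2) = false) // mulr1n mulr0n subr0.
by rewrite -[N.+2]add1n natrD scalerDl scale1r addrC.
Qed.

(** The counterpart of (d/dz_1 + d/dz_2) z^(-1-N) = 0; it gives [chiral_d] in the second slot. *)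
Lemma polar_value_d N u v : polar_value N (d u) v + polar_value N u (d v)
  + (sqmul ord0 (polar_value N u v) + sqmul ord_max (polar_value N u v)) = 0.
Proof.
elim: N u => [|N IH] u; first exact: Q_d.
apply: (scalerI (nz N)); rewrite scaler0 !scalerDr -!qmulZ !polar_valueS.
rewrite !qmulD [sqmul ord_max (sqmul _ _)]qmulC.
have := IH (d u); have := congr1 (sqmul ord0) (IH u).
rewrite qmul0 !qmulD => e1 e2.
have addr8 (W : zmodType) (a b a' b' x y x' y' : W) :
    a + b + (x + y) = 0 -> a' + b' + (x' + y') = 0 ->
    (a + a') + (b + b') + ((x + x') + (y + y')) = 0.
  by move=> h h'; rewrite [a + a' + _]addrACA [x + x' + _]addrACA [LHS]addrACA h h' addr0.
exact: addr8 e2 e1.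
Qed.

(* Every f in O^{*T}_2 is p(z_21) / z_21^(N+1), where z_21 acts as the operator
   D; [xget] gives the junk value 0 outside O^{*T}_2. *)
Definition chiral_of : chmap d 2 := fun v f =>
  xget 0 [set y | exists N p, f = pz p * z^-1 ^+ N.+1
    /\ y = poly_act p (polar_value N (v ord0) (v ord_max))].

Lemma poly_act_polar p N M u v :
  poly_act (p * 'X^M) (polar_value (N + M) u v) = poly_act p (polar_value N u v).
Proof.
elim: M => [|M IH]; first by rewrite addn0 mulr1.
by rewrite addnS exprSr mulrA poly_act_MX D_polar_value.
Qed.

Lemma pzV_shift p N M : pz p * z^-1 ^+ N = pz (p * 'X^M) * z^-1 ^+ (N + M).
Proof.
by rewrite pzM pzXn pzX exprD mulrACA -exprMn mulfV ?z_neq0 // expr1n mulr1.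
Qed.

Lemma chiral_ofE v p N : chiral_of v (pz p * z^-1 ^+ N.+1)
  = poly_act p (polar_value N (v ord0) (v ord_max)).
Proof.
rewrite /chiral_of; case: xgetP => [y _ [M [q [e ->]]]|h]; last first.
  by have := h _; case: (h (poly_act p (polar_value N (v ord0) (v ord_max)))); exists N, p.
have {e} e : p * 'X^M = q * 'X^N.
  apply: pz_inj; move: e; rewrite (pzV_shift p _ M) (pzV_shift q _ N) [(M.+1 + N)%N]addnC.
  rewrite addnS addSn; apply: mulIf.
  by rewrite expf_neq0 // invr_eq0 z_neq0.
by rewrite -(poly_act_polar p N M) -(poly_act_polar q M N) e addnC.
Qed.

Lemma OstarT2_normal f : OstarT f -> exists N p, f = pz p * z^-1 ^+ N.+1.
Proof.
move=> /OstarT2P[N [p ->]]; exists N, (p * 'X).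
by have := pzV_shift p N 1; rewrite addn1 expr1 => <-; rewrite exprVn.
Qed.

Lemma chiral_of_chiral : is_chiral chiral_of.
Proof.
have Out v f : ~ OstarT f -> chiral_of v f = 0.
  move=> nf; rewrite /chiral_of; case: xgetP => // y _ [N [p [e _]]]; case: nf.
  by apply/OstarT2P; exists N.+1, p; rewrite e exprVn.
have E := chiral_ofE.
have FZ v a f : OstarT f -> chiral_of v (fc 2 a * f) = a *: chiral_of v f.
  move=> /OstarT2_normal[N [p ->]].
  by rewrite mulrA -pzC -pzM mul_polyC !E poly_actZl.
have FD v f g : OstarT f -> OstarT g ->
    chiral_of v (f + g) = chiral_of v f + chiral_of v g.
  move=> /OstarT2_normal[N [p ->]] /OstarT2_normal[M [q ->]].
  rewrite (pzV_shift p _ M) (pzV_shift q _ N) [(M.+1 + N)%N]addnC addnS addSn.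
  by rewrite -mulrDl -pzD !E poly_actD.
have FN v f : OstarT f -> chiral_of v (- f) = - chiral_of v f.
  by move=> Of; rewrite -mulN1r -fc1 -fcN FZ // scaleN1r.
have C0 v : chiral_of v 0 = 0.
  by rewrite -[0](mul0r (z^-1 ^+ 1)) -(pz0 F) E poly_act0.
have Fd0 v f : OstarT f -> chiral_of (upd v ord0 (d (v ord0))) f
    + sqmul ord0 (chiral_of v f) = chiral_of v (fd ord0 f).
  move=> /OstarT2_normal[N [p ->]]; rewrite (v2E v) upd2_0 v2_0.
  move: (v ord0) (v ord_max) => {}v w.
  (* As dz/dz_1 = -1, the derivative over z^(N+2) has numerator (N+1) p - z p'. *)
  have -> : fd ord0 (pz p * z^-1 ^+ N.+1)
      = pz (N.+1%:R *: p - p^`() * 'X) * z^-1 ^+ N.+2.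
    rewrite fdM fd_pz eqxx (fd0_zVX) pzD pzN -mul_polyC !pzM pzC pzX.
    rewrite mulrDl [in RHS]addrC; congr (_ + _); last by rewrite mulrA [pz p * _]mulrC.
    rewrite !mulNr; congr (- _); rewrite [z^-1 ^+ N.+2]exprS [in RHS]mulrA.
    by rewrite mulfK ?z_neq0.
  rewrite !E !v2_0 !v2_1 poly_actD -scaleN1r -[p^`() * 'X]scale1r.
  rewrite scalerA mulr1 !poly_actZl scaleN1r poly_act_MX D_polar_value.
  by rewrite -poly_actZr polar_valueS poly_actDr poly_act_mul0 addrA addrK.
apply: is_chiralI => //.
- move=> f v i a x y; have [Of|nf] := pselect (OstarT f); last first.
    by rewrite !Out // scaler0 addr0.
  have [N [p ->]] := OstarT2_normal Of; rewrite (v2E v).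
  case: (ord2_eq i) => ->; rewrite ?upd2_0 ?upd2_1 !E ?v2_0 ?v2_1.
    by rewrite polar_value_linl poly_actDr poly_actZr.
  by rewrite polar_value_linr poly_actDr poly_actZr.
- move=> v a f g Of Og; rewrite FD ?FZ //.
  by apply: OstarT_M => //; apply: OT_c.
- move=> v i f Of; case: (ord2_eq i) => ->; first exact: Fd0.
  (* By translation invariance the second slot is reduced to the first one through
     [polar_value_d]. *)
  have e : fd ord_max f = - fd ord0 f.
    apply/eqP; rewrite -addr_eq0 addrC -(enum2 (fun i => fd i f)).
    by rewrite (OT_fd_sum _ Of) // => e; apply: ltpairs_neq.
  rewrite e FN; last exact: OstarT_fd.
  rewrite -Fd0 //; apply/eqP; rewrite -addr_eq0; apply/eqP.
  have [N [p ->]] := OstarT2_normal Of; rewrite (v2E v) upd2_0 upd2_1 v2_0 v2_1.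
  rewrite !E !v2_0 !v2_1.
  have := congr1 (poly_act p) (polar_value_d N (v ord0) (v ord_max)).
  rewrite poly_act_r0 2!poly_actDr poly_act_tot => e1.
  by rewrite addrACA [X in X + _]addrC [sqmul ord_max _ + _]addrC.
- move=> v i j f Of.
  have DN (k l : 'I_2) x : sqderivB l k x = - sqderivB k l x :> lquot d 2.
    by rewrite -(qp_repr x) !qderivB_qp -qpN opprB.
  have key : chiral_of v (z * f) = D (chiral_of v f).
    have [N [p ->]] := OstarT2_normal Of.
    by rewrite mulrA -{1}pzX -pzM (mulrC 'X p) !E poly_act_MX poly_act_deriv.
  case: (ord2_eq i) => ->; case: (ord2_eq j) => ->.
  + rewrite zdii mul0r C0; have := DN ord0 ord0 (chiral_of v f).
    by rewrite sqderivB.unlock /qderivB subrr qpE qp0.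
  + rewrite zdN mulNr FN ?key; last by apply: OstarT_M => //; apply: OT_zd.
    by rewrite -DN.
  + exact: key.
  + by rewrite zdii mul0r C0 sqderivB.unlock /qderivB subrr qpE qp0.
Qed.

Lemma lambda_map_chiral_of u v : lambda_map chiral_of u v = unsign u v.
Proof.
rewrite /lambda_map -[z^-1]mul1r -{1}(pz1 F) -[z^-1]expr1 chiral_ofE poly_act1.
by rewrite v2_0 v2_1 elim_last_invK.
Qed.

Lemma va_of_chiral_of : va_of gr d chiral_of = I.
Proof.
apply/funext => u; apply/funext => v; rewrite va_ofE.
rewrite [in RHS](prE gr u) IDl !big_bool /= !lambda_map_chiral_of.
rewrite !(unsign_hom _ (hom_pr _ _ _)) !scalerA addrC.
by rewrite !expr0 !expr1 mulr1 mulrNN mulr1 !scale1r.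
Qed.

Lemma chiral_of_parity : ch_parity pg true chiral_of.
Proof.
move=> c v f hv; have c0 := hv ord0; have c1 := hv ord_max.
set S := hom_par _ _.
have ES : S = hom_par gr (~~ c ord0 (+) ~~ c ord_max).
  rewrite /S !big_ord_recl big_ord0 /= (_ : lift ord0 ord0 = ord_max); last exact: val_inj.
  by rewrite /hom_par /=; case: (c ord0); case: (c ord_max).
have Sl : forall a x y, S x -> S y -> S (a *: x + y).
  by rewrite ES => a x y; apply: hom_par_lin.
have S0 : S 0 by rewrite ES; apply: hom_par0.
have Sd x : S x -> S (d x) by rewrite ES; apply: d_even.
have [Of|nf] := pselect (OstarT f); last first.
  rewrite (ch_out chiral_of_chiral) //; exists 0; first by rewrite qpE qp0.
  by move=> m; rewrite -[lcoef]lcf.unlock lcf0.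
rewrite (v2E v).
apply: (coef_in_chiral charF0 chiral_of_chiral Sl S0 Sd
  (A := hom_par gr (~~ c ord0))) => // [x|x hx].
  exact: d_even.
rewrite lambda_map_chiral_of (unsign_hom _ hx) ES.
apply: (coef_inZ _ (hom_par0 _ _)) => [a x' y|]; first exact: hom_par_lin.
by move=> m; have := nuva_even nI hx (c1 : hom_par gr (~~ c ord_max) _) m; rewrite lcf.unlock.
Qed.

(** Both sides are chiral, so by [chiral2_ext] it is enough to compare them at 1/z, where the claim
    is skew-symmetry. *)
Lemma chiral_of_sym : ch_act pg (tperm ord0 ord_max) chiral_of = chiral_of.
Proof.
have cX := chiral_of_chiral.
have cA := act_chiral (pg_even d_even) (tperm ord0 ord_max) cX.
apply: (chiral2_ext charF0 cA cX); apply: (mlin_hom_ext (gr := pg)).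
- exact: ch_mlin.
- exact: ch_mlin.
move=> c v hv; have c0 : hom_par gr (~~ c ord0) (v ord0) := hv ord0.
have c1 : hom_par gr (~~ c ord_max) (v ord_max) := hv ord_max.
rewrite (act_hom _ _ (ch_mlin cX) hv) koszul2 tpermL tpermR tpermV /=.
have -> : zs (tperm ord0 ord_max) z^-1 = - z^-1.
  by rewrite (proj2 (zs_zdV F _)) ?tpermL ?tpermR // zdN invrN.
rewrite (ch_fN cX); last exact: OstarT_zdV.
have -> : vperm (tperm ord0 ord_max) v = v2 (v ord_max) (v ord0).
  by apply/ffunP => i; rewrite !ffunE tpermV; case: (ord2_eq i) => ->;
    rewrite ?tpermL ?tpermR.
rewrite [in RHS](v2E v); apply: (@elim_last_inj F V d 1).
rewrite -!eliJ !lambda_map_chiral_of elim_last_invK.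
rewrite (morphDN (qpermD (@perm_inj _ _))) elim_lastZ (morphDN (@elim_lastD _ _ d 1)).
rewrite elim_perm2 (unsign_hom _ c0) (unsign_hom _ c1).
rewrite [in RHS](nuva_skew nI c1 c0) int_toE subst1Z.
- rewrite scalerN -scaleNr !scalerA; congr (_ *: _).
  by case: (c ord0); case: (c ord_max) => /=; ring.
- by move=> x y /=; rewrite lmulD lmapD !opprD addrACA.
- by move=> q; rewrite lmulZ lmapdZ scalerBr scalerN.
Qed.

End ToChiral.

(** * Filtrations *)

Section Filtered.
Variables (F : fieldType) (charF0 : [pchar F] =i pred0).
Variables (V : lmodType F) (gr : superspace V) (d : {linear V -> V}).
Variables (Fil : int -> set V) (FilP : is_filtration gr d Fil).
Local Notation z := (@zd F 2 ord_max ord0).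

Lemma filO_zV : filO 1 z^-1.
Proof.
exists 1%N, (fun=> [set (ord0, ord_max)]%SET), (fun=> z^-1); split; last by rewrite big_ord1.
move=> k; split; first by apply/fintype.subsetP => e; rewrite !inE => /eqP->.
  by rewrite cards1.
(* The generators are the inverses of z_ij with i < j, while z is z_2 - z_1. *)
have -> : z^-1 = fconst 2 (-1) * (zdiff F (ord0 : 'I_2) ord_max)^-1.
  by have := fcN 2 (1 : F); rewrite fc1 fc.unlock => ->; rewrite zdN zd.unlock invrN mulN1r.
apply: adjoin_mul; first exact: adjoin_const.
by apply: adjoin_gen; right; exists (ord0, ord_max); rewrite ?inE.
Qed.

Lemma filO_1 : filO 0 (1 : {fraction {mpoly F[2]}}).
Proof.
exists 1%N, (fun=> finset.set0), (fun=> 1); split; last by rewrite big_ord1.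
move=> k; split; [exact: finset.sub0set|by rewrite cards0|].
by have := fc1 F 2; rewrite fc.unlock => <-; apply: adjoin_const.
Qed.

Variable X : chmap d 2.
Hypothesis cX : is_chiral X.
Local Notation J := (lambda_map X).
Local Notation I := (va_of gr d X).

Section Op.
Variable T : lpoly V 1 -> lpoly V 1.
Hypothesis TD : {morph T : p q / p + q}.
Hypothesis TZ : forall a p, T (a *: p) = a *: T p.

(** [T] is the identity for the integrals and [lderiv] for the brackets; the filtration is graded,
    so bounds pass between J and I through homogeneous components. *)
Lemma lambda_map_coef r u v :
  (forall b, coef_in (Fil r) (T (I (pr gr b u) v))) -> coef_in (Fil r) (T (J u v)).
Proof.
move=> h; have e b : coef_in (Fil r) (T (J (pr gr b u) v)).
  have -> : J (pr gr b u) v = (-1) ^+ b *: I (pr gr b u) v.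
    exact: (J_hom cX _ (hom_pr gr b u)).
  rewrite TZ; exact: (coef_inZ (fil_lin FilP (r := r)) (fil_0 FilP r) _ (h b)).
have -> : J u v = J (pr gr false u) v + J (pr gr true u) v by rewrite -(JDl cX) -prE.
rewrite TD; exact: (coef_inD (fil_lin FilP (r := r))).
Qed.

Lemma va_of_coef r u v :
  (forall b, coef_in (Fil r) (T (J (pr gr b u) v))) -> coef_in (Fil r) (T (I u v)).
Proof.
move=> h; have -> : I u v = (-1) ^+ true *: J (pr gr true u) v
    + (-1) ^+ false *: J (pr gr false u) v by rewrite va_ofE big_bool.
rewrite TD !TZ; apply: (coef_inD (fil_lin FilP (r := r))).
  exact: (coef_inZ (fil_lin FilP (r := r)) (fil_0 FilP r) _ (h true)).
exact: (coef_inZ (fil_lin FilP (r := r)) (fil_0 FilP r) _ (h false)).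
Qed.

End Op.

Lemma filP_va_of : filP d Fil 2 1 X <->
  forall p q u v, Fil p u -> Fil q v -> Fil (p + q) (nprod I u v) /\
    forall m, Fil (p + q - 1) (lcoef m (lbracket I u v)).
Proof.
have Dz := @lderivZ F V 1 ord0; have DD := @lderivD F V 1 ord0.
have Qin r (x : lquot d 2) := @qcoef_inP F V _ (fil_lin FilP (r := r)) (fil_0 FilP r)
  1 d x (fil_d FilP (r := r)).
split=> [[_ h] p q u v hu hv|h].
  have key s f b : filO s f -> coef_in (Fil (p + q + s - 1))
      (elim_last (X (v2 (pr gr b u) v) f)).
    move=> fs; apply/Qin.
    have -> : p + q + s - 1 = \sum_(i < 2) (if i == ord0 then p else q) + s - 1.
      by rewrite enum2.
    apply: h => // i; case: (ord2_eq i) => ->; rewrite ?v2_0 ?v2_1 //=.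
    exact: (fil_graded FilP).
  split.
    have := va_of_coef (T := id) (fun _ _ => erefl) (fun _ _ => erefl)
      (fun b => key 1 _ b filO_zV) 0%MM.
    by rewrite addrK /nprod lcf.unlock.
  move=> m; rewrite -[lcoef]lcf.unlock; move: m.
  apply: (va_of_coef DD Dz (r := p + q - 1) (u := u) (v := v)) => b.
  rewrite (lderiv_J cX) -[p + q]addr0.
  exact: key filO_1.
split=> // rs s v f hv [N [E [g [hg ->]]]]; rewrite enum2.
(* The constant coefficient is the product; the others are coefficients of the bracket divided by
   nonzero integers, and even lie one step lower. *)
have hI p q u w : Fil p u -> Fil q w -> coef_in (Fil (p + q)) (I u w).
  move=> hu hw m; have [hn hl] := h p q u w hu hw.
  have [->|m0] := eqVneq m 0%MM; first by move: hn; rewrite /nprod lcf.unlock.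
  have [i em mi] := mnm_neq0 m0; rewrite (ord1 i) in em mi.
  have := hl (m - U_(ord0))%MM; rewrite -[lcoef]lcf.unlock lcf_deriv -em.
  move/(@fil_incr _ _ _ _ _ FilP _ (p + q)).
  have le : p + q - 1 <= p + q by rewrite gerBl.
  move=> /(_ le) /(S_scale (fil_lin FilP (r := p + q)) (fil_0 FilP (p + q))).
  move=> /(_ ((m - U_(ord0))%MM ord0).+1%:R^-1).
  by rewrite -scaler_nat scalerA mulVf ?scale1r // nat_neq0.
have h0 := hv ord0; have h1 := hv ord_max; rewrite (v2E v).
move: (rs ord0) (rs ord_max) (v ord0) (v ord_max) h0 h1 => p q u w hu hw.
set S := Fil _.
suff [] : OstarT (\sum_(k < N) g k) /\ qcoef_in S (X (v2 u w) (\sum_(k < N) g k)) by [].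
apply: (big_ind (fun f => OstarT f /\ qcoef_in S (X (v2 u w) f))).
- split; first by rewrite -(fc0 F 2); apply: OT_c.
  rewrite (ch_f0 cX); apply/Qin => m.
  by rewrite (morphD0 (@elim_lastD F V d 1)) lcf0; apply: (fil_0 FilP).
- move=> a b [Oa Sa] [Ob Sb]; split; first exact: adjoin_add.
  move/Qin: Sa => Sa; move/Qin: Sb => Sb; rewrite (ch_fD cX) //.
  by apply/Qin; rewrite elim_lastD; apply: (coef_inD (fil_lin FilP (r := _))).
move=> k _; have [subE cE Eg] := hg k; split; first exact: (OT_sub subE).
have up r : r <= p + q + s - 1 -> qcoef_in (Fil r) (X (v2 u w) (g k)) ->
    qcoef_in S (X (v2 u w) (g k)).
  by move=> le [y -> hy]; exists y => // m; apply: (fil_incr FilP le).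
(* Without polar divisors [g k] is a polynomial and s >= 0 suffices. Otherwise s >= 1, which
   compensates the shift by -1. *)
have [E0|[e eE]] := set_0Vmem (E k).
  apply: (up (p + q - 1)).
    by rewrite lerB // lerDl (Order.POrderTheory.le_trans _ cE).
  move: Eg; rewrite E0; apply: (coef_in_chiral_poly cX (fil_lin FilP (r := _)) (fil_0 FilP _)
    (fil_d FilP (r := _))).
  apply: (lambda_map_coef DD Dz) => b m.
  have [_] := h p q (pr gr b u) w (fil_graded FilP b hu) hw.
  by move/(_ m); rewrite lcf.unlock.
apply: (up (p + q)).
  rewrite -addrA lerDl subr_ge0 (Order.POrderTheory.le_trans _ cE) // lez_nat card_gt0.
  by apply/set0Pn; exists e.
apply: (coef_in_chiral charF0 cX (fil_lin FilP (r := _)) (fil_0 FilP _)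
  (fil_d FilP (r := _)) (A := Fil p)) => //.
- exact: (fil_d FilP).
- move=> x hx; apply: (lambda_map_coef (T := id)) => // b.
  by apply: hI => //; apply: (fil_graded FilP).
- exact: (OT_sub subE).
Qed.

End Filtered.

(** * The two bijections *)

Lemma perm2 (s : 'S_2) : s = 1%g \/ s = tperm ord0 ord_max.
Proof.
have i01 : (ord_max == ord0 :> 'I_2) = false by [].
case: (ord2_eq (s ord0)) => e0; [left|right]; apply/permP => i.
  rewrite perm1; case: (ord2_eq i) => -> //.
  by case: (ord2_eq (s ord_max)) => // e1; move: (perm_inj (etrans e1 (esym e0))) => /eqP.
case: (ord2_eq i) => ->; rewrite ?tpermL ?tpermR //.
by case: (ord2_eq (s ord_max)) => // e1; move: (perm_inj (etrans e1 (esym e0))) => /eqP.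
Qed.

Lemma set_bij_sub (T T' : Type) (A P : set T) (B Q : set T') (f : T -> T') :
  set_bij A B f -> (forall x, A x -> P x <-> Q (f x)) ->
  set_bij (A `&` P) (B `&` Q) f.
Proof.
move=> [fAB inj surj] PQ; split=> [x [Ax Px]|x y|y [By Qy]].
- by split; [apply: fAB|apply/PQ].
- rewrite !inE => -[Ax _] [Ay _]; apply: inj; exact: mem_set.
- have [x Ax e] := surj y By; exists x => //; split=> //.
  by apply/PQ; rewrite ?e.
Qed.

Lemma va_of_bij (F : fieldType) (charF0 : [pchar F] =i pred0)
    (V : lmodType F) (gr : superspace V) (d : {linear V -> V})
    (d_even : even_endo gr d) :
  set_bij
    [set X : chmap d 2 |
      [/\ Wch d (parity_shift gr) 1 X, ch_parity (parity_shift gr) true X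
        & box (parity_shift gr) X X = 0]]
    [set I : V -> V -> lpoly V 1 | is_nuva gr d I]
    (va_of gr d).
Proof.
split=> [X [[cX symX] parX box0]|X Y|I nI].
- exact: (va_of_nuva d_even cX parX (symX _)).
- move=> /set_mem[[cX _] _ _] /set_mem[[cY _] _ _] e.
  apply: (chiral2_ext charF0 cX cY) => v; rewrite (v2E v) -!eliJ; congr elim_last_inv.
  (* On homogeneous vectors the sign can be undone, so [va_of] determines J there. *)
  have eJ b u w : lambda_map X (pr gr b u) w = lambda_map Y (pr gr b u) w.
    have hu := hom_pr gr b u; apply: etrans (J_hom cX w hu) _.
    by rewrite e; apply/esym; apply: J_hom.
  have JE Z u w : is_chiral Z -> lambda_map Z u w
      = lambda_map Z (pr gr false u) w + lambda_map Z (pr gr true u) w.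
    by move=> cZ; rewrite -(JDl cZ) -prE.
  by rewrite (JE _ _ _ _ cX) (JE _ _ _ _ cY) !eJ.
- have cX := chiral_of_chiral charF0 d_even nI.
  have symX := chiral_of_sym charF0 d_even nI.
  have parX := chiral_of_parity charF0 d_even nI.
  have e := va_of_chiral_of charF0 d_even nI.
  exists (chiral_of gr d I); last exact: e.
  split; [split; first exact: cX|exact: parX|].
    move=> s; case: (perm2 s) => ->; last exact: symX.
    by apply: act1 => f; apply: ch_mlin.
  by apply: (box_of_nuva charF0 d_even cX parX symX); rewrite e.
Qed.

Theorem theorem8p10 (F : fieldType) (charF0 : [pchar F]%R =i pred0)
    (V : lmodType F) (gr : superspace V) (d : {linear V -> V})
    (d_even : even_endo gr d)
    (Fil : int -> set V) (FilP : is_filtration gr d Fil) :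
  set_bij
    [set X : chmap d 2 |
      [/\ Wch d (parity_shift gr) 1 X, ch_parity (parity_shift gr) true X
        & box (parity_shift gr) X X = 0]]
    [set I : V -> V -> lpoly V 1 | is_nuva gr d I]
    (va_of gr d)
  /\
  set_bij
    [set X : chmap d 2 |
      [/\ filW d (parity_shift gr) Fil 1 1 X, ch_parity (parity_shift gr) true X
        & box (parity_shift gr) X X = 0]]
    [set I : V -> V -> lpoly V 1 | is_filtered_nuva gr d I Fil]
    (va_of gr d).
Proof.
have bij := va_of_bij charF0 d_even; split; first exact: bij.
set A' := [set X | _]; set A := [set X : chmap d 2 | _] in bij.
have -> : A' = A `&` filP d Fil 2 1.
  apply/seteqP; split=> [X [[WX fX] pX bX]|X [[WX pX bX] fX]].
    by split; [split|].
  by split; [split| |].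
apply: (set_bij_sub bij) => X [[cX _] _ _]; exact: filP_va_of.
Qed.
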